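(* Let $(R,\mathfrak{m})$ be a Cohen--Macaulay (Noetherian) local ring of finite Cohen--Macaulay type. Then $R$ is an isolated singularity; that is, $R_{\mathfrak{p}}$ is a regular local ring for every prime ideal $\mathfrak{p}\neq\mathfrak{m}$ of $R$.
   Context: A finitely generated $R$-module $M$ is maximal Cohen--Macaulay (MCM) if $\operatorname{depth} M=\dim R$. The ring $R$ has finite Cohen--Macaulay type if there are only finitely many isomorphism classes of indecomposable MCM $R$-modules. *)

(* Defs.v *)
From HB Require Import structures.
From mathcomp Require Import all_boot all_order all_algebra.
From mathcomp Require Import generic_quotient ring_quotient.
From mathcomp Require Import boolp classical_sets.
From mathcomp Require Import ring.

Set Implicit Arguments.
Unset Strict Implicit.
Unset Printing Implicit Defensive.

Import GRing.Theory.
Local Open Scope classical_set_scope.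
Local Open Scope ring_scope.
Local Open Scope quotient_scope.

(* Ideals and submodules are arbitrary Prop-valued sets; [mem] turns them into
   the (classically decidable) predicates expected by the algebra library. *)

Definition submodule (R : comNzRingType) (M : lmodType R) (N : set M) : Prop :=
  GRing.submod_closed (mem N).

Definition ideal (R : comNzRingType) (I : set R) : Prop :=
  submodule (I : set R^o).

(* [idealr_closed] includes properness: [1 \notin P]. *)
Definition prime_ideal (R : comNzRingType) (P : set R) : Prop :=
  idealr_closed (mem P) /\ prime_idealr_closed (mem P).

Definition maximal_ideal (R : comNzRingType) (m : set R) : Prop :=
  [/\ ideal m, m <> setT &
      forall I : set R, ideal I -> m `<=` I -> I = m \/ I = setT].

Definition local_ring (R : comNzRingType) (m : set R) : Prop :=
  maximal_ideal m /\ forall n : set R, maximal_ideal n -> n = m.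

Definition lin_span (R : comNzRingType) (M : lmodType R) (g : seq M) : set M :=
  [set u | exists a : 'I_(size g) -> R, u = \sum_(i < size g) a i *: g`_i].

Definition fin_gen (R : comNzRingType) (M : lmodType R) : Prop :=
  exists g : seq M, lin_span g = setT.

Definition ideal_gen (R : comNzRingType) (xs : seq R) : set R :=
  lin_span (xs : seq R^o).

Definition noetherian (R : comNzRingType) : Prop :=
  forall I : set R, ideal I -> exists xs : seq R, I = ideal_gen xs.

Definition noetherian_local (R : comNzRingType) (m : set R) : Prop :=
  noetherian R /\ local_ring m.

Definition is_max (S : set nat) (d : nat) : Prop :=
  S d /\ forall n, S n -> (n <= d)%N.

(* [n] counts the strict inclusions P 0 < P 1 < ... < P n. *)
Definition prime_chain (R : comNzRingType) (n : nat) : Prop :=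
  exists P : nat -> set R,
    (forall i, (i <= n)%N -> prime_ideal (P i)) /\
    (forall i, (i < n)%N -> P i `<` P i.+1).

Definition krull_dim (R : comNzRingType) (d : nat) : Prop :=
  is_max (prime_chain R) d.

(* The submodule (x_1, ..., x_n)M. *)
Definition seq_mul (R : comNzRingType) (M : lmodType R) (xs : seq R) : set M :=
  [set u | exists v : 'I_(size xs) -> M, u = \sum_(i < size xs) xs`_i *: v i].
Arguments seq_mul {R} M xs.

(* Each x_i is a nonzerodivisor on M/(x_1, ..., x_(i-1))M, and
   M/(x_1, ..., x_n)M is nonzero. *)
Definition regular_seq (R : comNzRingType) (M : lmodType R) (xs : seq R)
    : Prop :=
  (forall i, (i < size xs)%N -> forall u : M,
     seq_mul M (take i xs) (xs`_i *: u) -> seq_mul M (take i xs) u) /\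
  seq_mul M xs <> setT.

(* The supremum of the lengths of the M-regular sequences in m, as a relation;
   since the empty sequence is regular iff M is nonzero, the zero module has
   no depth. *)
Definition depth (R : comNzRingType) (m : set R) (M : lmodType R) (d : nat)
    : Prop :=
  is_max [set n | exists xs : seq R,
            [/\ size xs = n, {in xs, forall x, m x} & regular_seq M xs]] d.

Definition depth_eq_dim (R : comNzRingType) (m : set R) (M : lmodType R)
    : Prop :=
  exists d, depth m M d /\ krull_dim R d.

Definition cohen_macaulay (R : comNzRingType) (m : set R) : Prop :=
  depth_eq_dim m R^o.

Definition maximal_cohen_macaulay (R : comNzRingType) (m : set R)
    (M : lmodType R) : Prop :=
  fin_gen M /\ depth_eq_dim m M.

Definition indecomposable (R : comNzRingType) (M : lmodType R) : Prop :=
  (exists u : M, u <> 0) /\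
  forall N1 N2 : set M, submodule N1 -> submodule N2 ->
    (forall u, exists u1 u2, [/\ N1 u1, N2 u2 & u = u1 + u2]) ->
    N1 `&` N2 = [set 0] -> N1 = [set 0] \/ N2 = [set 0].

Definition mod_iso (R : comNzRingType) (M N : lmodType R) : Prop :=
  exists f : {linear M -> N}, bijective f.

(* The N i need not themselves be indecomposable MCM: they only bound the number
   of isomorphism classes. *)
Definition finite_cm_type (R : comNzRingType) (m : set R) : Prop :=
  exists (n : nat) (N : 'I_n -> lmodType R),
    forall M : lmodType R, maximal_cohen_macaulay m M -> indecomposable M ->
      exists i, mod_iso M (N i).

Definition regular_local (R : comNzRingType) : Prop :=
  exists m : set R, noetherian_local m /\
    exists xs : seq R, krull_dim R (size xs) /\ m = ideal_gen xs.

(* Bundled so that the equivalence relation on fractions determines the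
   primality proof during canonical structure inference. *)
Record prime_pt (R : comNzRingType) := PrimePt {
  pt_set : set R;
  pt_prime : prime_ideal pt_set }.

Section Localization.

Variables (R : comNzRingType) (q : prime_pt R).
Local Notation p := (pt_set q).

Lemma compl1 : 1 \notin p.
Proof. by case: (pt_prime q) => -[_ +] _. Qed.

Lemma complM s t : s \notin p -> t \notin p -> s * t \notin p.
Proof.
case: (pt_prime q) => _ pP hs ht; apply/negP => /pP.
by rewrite (negbTE hs) (negbTE ht).
Qed.

Lemma compl0 s : s \notin p -> s <> 0.
Proof. by case: (pt_prime q) => -[p0 _ _] _ /negP hs s0; rewrite s0 in hs. Qed.

Record loc_frac := LocFrac { loc_numden : R * R; _ : loc_numden.2 \notin p }.

HB.instance Definition _ := [isSub for loc_numden].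
HB.instance Definition _ := [Choice of loc_frac by <:].

Implicit Types x y z : loc_frac.

Definition loc_num x := (loc_numden x).1.
Definition loc_den x := (loc_numden x).2.

Lemma loc_denP x : loc_den x \notin p. Proof. by case: x. Qed.

Definition loc_mk (a s : R) (hs : s \notin p) : loc_frac := @LocFrac (a, s) hs.

Definition loc_equiv x y : bool :=
  `[< exists2 u, u \notin p &
        u * (loc_num x * loc_den y) = u * (loc_num y * loc_den x) >].

Lemma loc_equiv_refl : reflexive loc_equiv.
Proof. by move=> x; apply/asboolP; exists 1; first exact: compl1. Qed.

Lemma loc_equiv_sym : symmetric loc_equiv.
Proof.
by move=> x y; apply/asboolP/asboolP => -[u up e]; exists u.
Qed.

Lemma loc_equiv_trans : transitive loc_equiv.
Proof.
move=> y x z /asboolP[u up e] /asboolP[v vp f]; apply/asboolP.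
exists (u * v * loc_den y); first by rewrite !complM ?loc_denP.
have -> : u * v * loc_den y * (loc_num x * loc_den z) =
  (u * (loc_num x * loc_den y)) * (v * loc_den z) by ring.
rewrite e.
have -> : u * (loc_num y * loc_den x) * (v * loc_den z) =
  (v * (loc_num y * loc_den z)) * (u * loc_den x) by ring.
by rewrite f; ring.
Qed.

Canonical loc_equiv_rel :=
  EquivRel loc_equiv loc_equiv_refl loc_equiv_sym loc_equiv_trans.

Definition loc_type := {eq_quot loc_equiv}.

HB.instance Definition _ : EqQuotient _ loc_equiv loc_type :=
  EqQuotient.on loc_type.
HB.instance Definition _ := Choice.on loc_type.

Lemma loc_repr_equiv x : loc_equiv (repr (\pi_loc_type x)) x.
Proof. by rewrite -[loc_equiv _ _]/(loc_equiv_rel _ _) -eqmodE reprK. Qed.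

Lemma loc_pi_eq x y : loc_equiv x y -> \pi_loc_type x = \pi_loc_type y.
Proof. by move=> e; apply/eqmodP. Qed.

Definition loc_addf x y :=
  loc_mk (loc_num x * loc_den y + loc_num y * loc_den x)
    (complM (loc_denP x) (loc_denP y)).
Definition loc_oppf x := loc_mk (- loc_num x) (loc_denP x).
Definition loc_mulf x y :=
  loc_mk (loc_num x * loc_num y) (complM (loc_denP x) (loc_denP y)).

Definition loc_zero : loc_type := \pi_loc_type (loc_mk 0 compl1).
Definition loc_one : loc_type := \pi_loc_type (loc_mk 1 compl1).
Definition loc_add := lift_op2 loc_type loc_addf.
Definition loc_opp := lift_op1 loc_type loc_oppf.
Definition loc_mul := lift_op2 loc_type loc_mulf.

Lemma loc_pi_add : {morph \pi : x y / loc_addf x y >-> loc_add x y}.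
Proof.
move=> x y; unlock loc_add; apply/esym/loc_pi_eq/asboolP.
have /asboolP[u up e] := loc_repr_equiv x.
have /asboolP[v vp f] := loc_repr_equiv y.
exists (u * v); first exact: complM.
move: (repr (\pi x)) (repr (\pi y)) e f => x' y' e f.
rewrite /loc_num /loc_den /=.
rewrite -/(loc_num x) -/(loc_num y) -/(loc_num x') -/(loc_num y').
rewrite -/(loc_den x) -/(loc_den y) -/(loc_den x') -/(loc_den y').
transitivity ((u * (loc_num x' * loc_den x)) * (v * loc_den y' * loc_den y)
  + (v * (loc_num y' * loc_den y)) * (u * loc_den x' * loc_den x)); first by ring.
by rewrite e f; ring.
Qed.
Canonical loc_pi_add_morph := PiMorph2 loc_pi_add.

Lemma loc_pi_opp : {morph \pi : x / loc_oppf x >-> loc_opp x}.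
Proof.
move=> x; unlock loc_opp; apply/esym/loc_pi_eq/asboolP.
have /asboolP[u up e] := loc_repr_equiv x; exists u => //.
move: (repr _) e => x' e; rewrite /loc_num /loc_den /=.
rewrite -/(loc_num x) -/(loc_num x') -/(loc_den x) -/(loc_den x').
by rewrite !mulNr !mulrN e.
Qed.
Canonical loc_pi_opp_morph := PiMorph1 loc_pi_opp.

Lemma loc_pi_mul : {morph \pi : x y / loc_mulf x y >-> loc_mul x y}.
Proof.
move=> x y; unlock loc_mul; apply/esym/loc_pi_eq/asboolP.
have /asboolP[u up e] := loc_repr_equiv x.
have /asboolP[v vp f] := loc_repr_equiv y.
exists (u * v); first exact: complM.
move: (repr (\pi x)) (repr (\pi y)) e f => x' y' e f.
rewrite /loc_num /loc_den /=.
rewrite -/(loc_num x) -/(loc_num y) -/(loc_num x') -/(loc_num y').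
rewrite -/(loc_den x) -/(loc_den y) -/(loc_den x') -/(loc_den y').
transitivity
  ((u * (loc_num x' * loc_den x)) * (v * (loc_num y' * loc_den y))); first by ring.
by rewrite e f; ring.
Qed.
Canonical loc_pi_mul_morph := PiMorph2 loc_pi_mul.

Lemma loc_pi_eq1 x y :
  loc_num x * loc_den y = loc_num y * loc_den x ->
  \pi_loc_type x = \pi_loc_type y.
Proof.
by move=> e; apply/loc_pi_eq/asboolP; exists 1; [exact: compl1 | rewrite e].
Qed.

Local Ltac loc_ring :=
  apply: loc_pi_eq1;
  rewrite /loc_addf /loc_mulf /loc_oppf /loc_mk /loc_num /loc_den /=; ring.

Lemma loc_addA : associative loc_add.
Proof.
elim/quotW=> x; elim/quotW=> y; elim/quotW=> z; rewrite !piE.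
by loc_ring.
Qed.

Lemma loc_addC : commutative loc_add.
Proof.
elim/quotW=> x; elim/quotW=> y; rewrite !piE.
by loc_ring.
Qed.

Lemma loc_add0 : left_id loc_zero loc_add.
Proof.
elim/quotW=> x; rewrite /loc_zero !piE.
by loc_ring.
Qed.

Lemma loc_addN : left_inverse loc_zero loc_opp loc_add.
Proof.
elim/quotW=> x; rewrite /loc_zero !piE.
by loc_ring.
Qed.

HB.instance Definition _ :=
  GRing.isZmodule.Build loc_type loc_addA loc_addC loc_add0 loc_addN.

Lemma loc_mulA : associative loc_mul.
Proof.
elim/quotW=> x; elim/quotW=> y; elim/quotW=> z; rewrite !piE.
by loc_ring.
Qed.

Lemma loc_mulC : commutative loc_mul.
Proof.
elim/quotW=> x; elim/quotW=> y; rewrite !piE.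
by loc_ring.
Qed.

Lemma loc_mul1 : left_id loc_one loc_mul.
Proof.
elim/quotW=> x; rewrite /loc_one !piE.
by loc_ring.
Qed.

Lemma loc_mulDl : left_distributive loc_mul loc_add.
Proof.
elim/quotW=> x; elim/quotW=> y; elim/quotW=> z; rewrite !piE.
by loc_ring.
Qed.

Lemma loc_one_neq0 : loc_one != loc_zero.
Proof.
apply/eqP => /eqmodP /asboolP[u up].
by rewrite /loc_num /loc_den /= !mulr1 mulr0; exact: compl0.
Qed.

HB.instance Definition _ :=
  GRing.Zmodule_isComNzRing.Build loc_type loc_mulA loc_mulC loc_mul1
    loc_mulDl loc_one_neq0.

End Localization.

(* The localization R_p, as classes of fractions a/s with s outside p, where
   a/s = b/t iff u(at - bs) = 0 for some u outside p. *)
Definition localization (R : comNzRingType) (p : set R) (hp : prime_ideal p)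
    : comNzRingType :=
  loc_type (PrimePt hp).

Definition isolated_singularity (R : comNzRingType) (m : set R) : Prop :=
  forall (p : set R) (hp : prime_ideal p), p <> m ->
    regular_local (localization hp).

(* Main.v *)
Require Import Defs.
From HB Require Import structures.
From mathcomp Require Import all_boot all_order all_algebra.
From mathcomp Require Import generic_quotient ring_quotient.
From mathcomp Require Import boolp classical_sets.
From mathcomp Require Import ring.

Set Implicit Arguments.
Unset Strict Implicit.
Unset Printing Implicit Defensive.

Import GRing.Theory.
Local Open Scope classical_set_scope.
Local Open Scope ring_scope.
Local Open Scope quotient_scope.

(* Following Huneke and Leuschke. Let p <> m be a prime and r in m outside p. Take
   a free resolution of R/p and let 0 -> N -> F -> M -> 0 be the step in which M
   and N are syzygies of order at least dim R; both are MCM, and so is the middle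
   term X_j of r^j times the class of this extension. The X_j need a bounded
   number of generators, so by finite CM type X_i and X_j are isomorphic for some
   i < j. The pushout square gives 0 -> N -> X_i + N -> X_j -> 0, which splits by
   Miyata's theorem; as r^(j-i) lies in m this makes the i-th extension split. So
   r^i kills the class of 0 -> N -> F -> M -> 0, M becomes projective over R_p, the
   residue field of R_p has finite projective dimension, and R_p is regular by
   the theorem of Auslander, Buchsbaum and Serre.

   Modules are submodules of R^n, given by sets of row vectors; Ext, Tor and
   quotient modules are avoided by working with generators and relations. *)

(** * Submodules and Noetherian rings *)

(** The obstacle is to handle extension classes when Ext is absent. With N = ker D generated by the
    rows of B, s times the class of 0 -> N -> R^n -> im D -> 0 vanishes exactly when multiplication
    by s on N extends to a map R^n -> N, that is, when B C B = s B for some matrix C. This condition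
    localises, and once s is a unit it gives B a generalised inverse, which means projectivity.

    Miyata's theorem is reached by counting. If Y is isomorphic to X + K, tensoring 0 -> K -> Y -> X
    -> 0 with a module of finite length and comparing lengths shows that exactness on the left is
    kept. Krull's intersection theorem extends this to all finitely presented modules, so K is pure
    in Y, and purity splits the sequence because X is finitely presented.

    Depth is tested on one fixed R-regular sequence of length dim R: each syzygy gains a term of it,
    while extensions and summands inherit it. *)

Section Submodules.
Variables (R : comNzRingType) (V : lmodType R).
Implicit Types (A B C : set V) (u v w : V) (a : R) (g : seq V).

Lemma submoduleP A :
  submodule A <-> A 0 /\ forall a u v, A u -> A v -> A (a *: u + v).
Proof.
rewrite /submodule /GRing.submod_closed /GRing.linear_closed.
split=> -[A0 AL]; split.
- by move: A0; rewrite in_setE.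
- by move=> a u v /mem_set hu /mem_set hv; apply: set_mem; exact: AL.
- by rewrite in_setE.
- by move=> a u v; rewrite !in_setE; exact: AL.
Qed.

Lemma submod0 A : submodule A -> A 0.
Proof. by move=> /submoduleP[]. Qed.

Lemma submodL A a u v : submodule A -> A u -> A v -> A (a *: u + v).
Proof. by move=> /submoduleP[_]; apply. Qed.

Lemma submodD A u v : submodule A -> A u -> A v -> A (u + v).
Proof. by move=> hA hu hv; rewrite -[u]scale1r; exact: submodL. Qed.

Lemma submodZ A a u : submodule A -> A u -> A (a *: u).
Proof. by move=> hA hu; rewrite -[_ *: _]addr0; apply: submodL => //; exact: submod0. Qed.

Lemma submodN A u : submodule A -> A u -> A (- u).
Proof. by move=> hA hu; rewrite -scaleN1r; exact: submodZ. Qed.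

Lemma submodB A u v : submodule A -> A u -> A v -> A (u - v).
Proof. by move=> hA hu hv; apply: submodD => //; exact: submodN. Qed.

Lemma submod_addl A u v : submodule A -> A v -> A (u + v) -> A u.
Proof. by move=> hA hv huv; rewrite -(addrK v u); exact: submodB. Qed.

Lemma submod_sum A I (r : seq I) (P : pred I) (F : I -> V) :
  submodule A -> (forall i, P i -> A (F i)) -> A (\sum_(i <- r | P i) F i).
Proof.
by move=> hA hF; apply: (big_ind A); [exact: submod0 | move=> ? ?; exact: submodD |].
Qed.

Lemma submodule_setT : submodule ([set: V]).
Proof. by apply/submoduleP. Qed.

Lemma submodule_set0 : submodule ([set 0] : set V).
Proof. by apply/submoduleP; split=> // a u v /= -> ->; rewrite scaler0 addr0. Qed.

Lemma submoduleI A B : submodule A -> submodule B -> submodule (A `&` B).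
Proof.
move=> hA hB; apply/submoduleP; split; first by split; exact: submod0.
by move=> a u v [? ?] [? ?]; split; exact: submodL.
Qed.

Definition addS A B : set V := [set w | exists u v, [/\ A u, B v & w = u + v]].

Lemma submodule_addS A B : submodule A -> submodule B -> submodule (addS A B).
Proof.
move=> hA hB; apply/submoduleP; split.
  by exists 0, 0; split; [exact: submod0 | exact: submod0 | rewrite addr0].
move=> a _ _ [u1 [v1 [? ? ->]]] [u2 [v2 [? ? ->]]].
exists (a *: u1 + u2), (a *: v1 + v2); split; try exact: submodL.
by rewrite scalerDr addrACA.
Qed.

Lemma addSl A B : submodule B -> A `<=` addS A B.
Proof. by move=> hB u hu; exists u, 0; split=> //; [exact: submod0 | rewrite addr0]. Qed.

Lemma addSr A B : submodule A -> B `<=` addS A B.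
Proof. by move=> hA u hu; exists 0, u; split=> //; [exact: submod0 | rewrite add0r]. Qed.

Lemma addS_min A B C : submodule C -> A `<=` C -> B `<=` C -> addS A B `<=` C.
Proof. by move=> hC hA hB _ [u [v [? ? ->]]]; apply: submodD => //;
  [exact: hA | exact: hB]. Qed.

Lemma addSS A B A' B' : A `<=` A' -> B `<=` B' -> addS A B `<=` addS A' B'.
Proof. by move=> hA hB _ [u [v [? ? ->]]]; exists u, v; split; [exact: hA | exact: hB |]. Qed.

Lemma lin_span_nil w : lin_span ([::] : seq V) w <-> w = 0.
Proof.
split=> [[a ->]|->]; first by rewrite big_ord0.
by exists (fun _ => 0); rewrite big_ord0.
Qed.

Lemma lin_span_cons u g w :
  lin_span (u :: g) w <-> exists a v, lin_span g v /\ w = a *: u + v.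
Proof.
split=> [[a ->]|[a [v [[b ->] ->]]]].
  exists (a ord0), (\sum_(i < size g) a (lift ord0 i) *: g`_i); split.
    by exists (fun i => a (lift ord0 i)).
  by rewrite big_ord_recl.
exists (fun i => if unlift ord0 i is Some j then b j else a).
rewrite big_ord_recl unlift_none; congr (_ + _).
by apply: eq_bigr => i _; rewrite liftK.
Qed.

Lemma submodule_span g : submodule (lin_span g).
Proof.
apply/submoduleP; split.
  by exists (fun _ => 0); rewrite big1 // => i _; rewrite scale0r.
move=> a _ _ [b ->] [c ->]; exists (fun i => a * b i + c i).
rewrite scaler_sumr -big_split; apply: eq_bigr => i _ /=.
by rewrite scalerDl scalerA.
Qed.

Lemma lin_span_min A g :
  submodule A -> {in g, forall u, A u} -> lin_span g `<=` A.
Proof.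
move=> hA hg _ [a ->]; apply: submod_sum => // i _.
by apply: submodZ => //; apply: hg; exact: mem_nth.
Qed.

Lemma lin_span_in g u : u \in g -> lin_span g u.
Proof.
elim: g => // v g IH; rewrite in_cons => /orP[/eqP<-|/IH ?]; apply/lin_span_cons.
  by exists 1, 0; rewrite scale1r addr0; split=> //; exact: submod0 (submodule_span g).
by exists 0, u; rewrite scale0r add0r.
Qed.

Lemma lin_spanS g h : {subset g <= h} -> lin_span g `<=` lin_span h.
Proof.
by move=> gh; apply: lin_span_min; [exact: submodule_span|move=> u /gh /lin_span_in].
Qed.

Lemma lin_span_cat g h : lin_span (g ++ h) = addS (lin_span g) (lin_span h).
Proof.
apply/seteqP; split.
  apply: lin_span_min; first by apply: submodule_addS; exact: submodule_span.
  by move=> u; rewrite mem_cat => /orP[] /lin_span_in hu;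
    [apply: addSl | apply: addSr] => //; exact: submodule_span.
apply: addS_min; first exact: submodule_span.
  by apply: lin_spanS => u; rewrite mem_cat => ->.
by apply: lin_spanS => u; rewrite mem_cat => ->; rewrite orbT.
Qed.

Definition fgs A := exists g, A = lin_span g.

End Submodules.

Section Noetherian.
Variables (R : comNzRingType) (V : lmodType R).
Implicit Types (A B C : set V) (u v w : V) (a : R) (g : seq V).

Lemma noeth_sub A g :
  noetherian R -> submodule A -> A `<=` lin_span g -> fgs A.
Proof.
move=> hR; elim: g A => [|u g IH] A hA Ag.
  exists [::]; apply/seteqP; split=> // w /lin_span_nil->; exact: submod0.
(* [I] collects the coefficients of [u] in elements of [A]. Lifts of its generators, together with
   generators of the part of [A] inside the span of [g], generate [A]. *)
pose I : set R := [set a | exists2 w, lin_span g w & A (a *: u + w)].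
have hI : ideal I.
  apply/(@submoduleP R R^o); split.
    exists 0; first exact: submod0 (submodule_span g).
    by rewrite scale0r addr0; exact: submod0.
  move=> a b c [w1 ? h1] [w2 ? h2]; exists (a *: w1 + w2).
    by apply: submodL => //; exact: submodule_span.
  have := submodL a hA h1 h2; congr A.
  by rewrite scalerDr scalerA addrACA -scalerDl.
have [xs Ixs] := hR _ hI.
have [h hh] : fgs (A `&` lin_span g).
  by apply: IH; [apply: submoduleI => //; exact: submodule_span | move=> ? []].
have [k [kA Hk]] : exists k, {in k, forall v, A v} /\
    forall a, ideal_gen xs a -> exists v w, [/\ lin_span k v, lin_span g w & v = a *: u + w].
  have : forall x, x \in xs -> I x.
    by move=> x xin; rewrite Ixs; exact: (@lin_span_in R^o).
  rewrite /ideal_gen; elim: (xs) => [_|x ys IHx hx].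
    exists [::]; split=> // a /(@lin_span_nil R^o R^o) ->.
    by exists 0, 0; split; [exact/lin_span_nil| exact: submod0 (submodule_span g)|
       rewrite scale0r addr0].
  have [|k [kA Hk]] := IHx; first by move=> y hy; apply: hx; rewrite in_cons hy orbT.
  have [w wg wA] := hx x (mem_head _ _).
  exists ((x *: u + w) :: k); split.
    by move=> v; rewrite in_cons => /orP[/eqP->|/kA].
  move=> a /(@lin_span_cons R^o R^o) [b [c [/Hk[v [w' [vk wg' ev]]] ->]]].
  exists (b *: (x *: u + w) + v), (b *: w + w'); split.
  - by apply/lin_span_cons; exists b, v.
  - by apply: submodL => //; exact: submodule_span.
  - by rewrite ev scalerDr scalerA addrACA -scalerDl.
exists (k ++ h); rewrite lin_span_cat; apply/seteqP; split.
  move=> w hw; have /lin_span_cons[a [v [vg ew]]] := Ag _ hw.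
  have [|v' [w' [vk wg ev]]] := Hk a.
    by rewrite -Ixs; exists v => //; rewrite -ew.
  have Av' : A v' by exact: (lin_span_min hA kA).
  exists v', (w - v'); split=> //; last by rewrite addrC subrK.
  rewrite -hh; split; first exact: submodB.
  by rewrite ew ev opprD addrACA subrr add0r; apply: submodB => //; exact: submodule_span.
apply: addS_min => //; first exact: lin_span_min.
by rewrite -hh => ? [].
Qed.

Lemma noeth_acc (c : nat -> set V) g :
  noetherian R -> (forall i, submodule (c i)) -> (forall i, c i `<=` lin_span g) ->
  (forall i, c i `<=` c i.+1) -> exists n, forall m, c m `<=` c n.
Proof.
move=> hR hc cg cc.
have cm i j : (i <= j)%N -> c i `<=` c j.
  elim: j => [|j IH]; first by rewrite leqn0 => /eqP->.
  by rewrite leq_eqVlt => /orP[/eqP->//|/IH h]; exact: subset_trans (cc j).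
pose U : set V := [set u | exists i, c i u].
have hU : submodule U.
  apply/submoduleP; split; first by exists 0%N; exact: submod0.
  move=> a u v [i hi] [j hj]; exists (maxn i j); apply: submodL => //.
    by apply: cm hi; exact: leq_maxl.
  by apply: cm hj; exact: leq_maxr.
have [|h eU] := @noeth_sub U g hR hU; first by move=> u [i /cg].
have : {in h, forall u, U u} by move=> u /lin_span_in; rewrite -eU.
have [n hn] : exists n, {in h, forall u, U u} -> {in h, forall u, c n u}.
  elim: (h) => [|u k [n hn]]; first by exists 0%N.
  have [[i hi]|nU] := pselect (U u); last first.
    by exists 0%N => /(_ u (mem_head _ _)).
  exists (maxn i n) => hk v; rewrite in_cons => /orP[/eqP->|vk].
    by apply: cm hi; exact: leq_maxl.
  apply: (cm n); first exact: leq_maxr.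
  by apply: hn => // w wk; apply: hk; rewrite in_cons wk orbT.
move=> /hn {}hn; exists n => m u hu.
have : U u by exists m.
by rewrite eU; exact: lin_span_min.
Qed.

Lemma noeth_max (F : set (set V)) A0 g :
  noetherian R -> F A0 -> (forall A, F A -> submodule A /\ A `<=` lin_span g) ->
  exists A, F A /\ forall B, F B -> A `<=` B -> B = A.
Proof.
move=> hR FA0 hF; apply: contrapT => nex.
have /choice[f hf] : forall A : {A : set V | F A}, exists B : {B : set V | F B},
    sval A `<=` sval B /\ sval B <> sval A.
  move=> [A FA]; apply: contrapT => nB; apply: nex; exists A; split=> // B FB AB.
  by apply: contrapT => ne; apply: nB; exists (exist _ B FB).
pose c n := sval (iter n f (exist _ A0 FA0)).
have [n hn] : exists n, forall m, c m `<=` c n.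
  apply: (@noeth_acc _ g hR) => i.
  - by rewrite /c; case: (iter _ _ _) => A /= /hF[].
  - by rewrite /c; case: (iter _ _ _) => A /= /hF[].
  - by rewrite /c /=; case: (hf (iter i f (exist _ A0 FA0))).
case: (hf (iter n f (exist _ A0 FA0))) => _; apply.
by apply/seteqP; split; [exact: (hn n.+1)|case: (hf (iter n f (exist _ A0 FA0)))].
Qed.

End Noetherian.

(** * Ideals, local rings and Nakayama *)

Section Ideals.
Variable (R : comNzRingType).
Implicit Types (I J P : set R) (a b c x y : R).

Lemma idealP I : ideal I <-> I 0 /\ forall a u v, I u -> I v -> I (a * u + v).
Proof. exact: (@submoduleP R R^o). Qed.

Lemma ideal0 I : ideal I -> I 0.
Proof. exact: (@submod0 R R^o). Qed.

Lemma idealD I x y : ideal I -> I x -> I y -> I (x + y).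
Proof. exact: (@submodD R R^o). Qed.

Lemma idealB I x y : ideal I -> I x -> I y -> I (x - y).
Proof. exact: (@submodB R R^o). Qed.

Lemma ideal_mull I a x : ideal I -> I x -> I (a * x).
Proof. exact: (@submodZ R R^o). Qed.

Lemma ideal_mulr I a x : ideal I -> I x -> I (x * a).
Proof. by rewrite mulrC; exact: ideal_mull. Qed.

Lemma ideal_sum I (J : Type) (r : seq J) (Q : pred J) (F : J -> R) :
  ideal I -> (forall i, Q i -> I (F i)) -> I (\sum_(i <- r | Q i) F i).
Proof. exact: (@submod_sum R R^o). Qed.

Lemma ideal_gen_nil x : ideal_gen ([::] : seq R) x <-> x = 0.
Proof. exact: (@lin_span_nil R R^o). Qed.

Lemma ideal_gen_cons y xs x :
  ideal_gen (y :: xs) x <-> exists a v, ideal_gen xs v /\ x = a * y + v.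
Proof. exact: (@lin_span_cons R R^o). Qed.

Lemma ideal_ideal_gen xs : ideal (ideal_gen xs : set R).
Proof. exact: (@submodule_span R R^o). Qed.

Lemma ideal_gen_min I xs : ideal I -> {in xs, forall x, I x} -> ideal_gen xs `<=` I.
Proof. exact: (@lin_span_min R R^o). Qed.

Lemma ideal_gen_in xs x : x \in xs -> ideal_gen xs x.
Proof. exact: (@lin_span_in R R^o). Qed.

Lemma ideal_genT : ideal_gen [:: 1 : R] = setT.
Proof.
apply/seteqP; split=> // x _; apply/ideal_gen_cons; exists x, 0.
by rewrite mulr1 addr0; split=> //; exact/ideal_gen_nil.
Qed.

Lemma ideal1T I : ideal I -> I 1 -> I = setT.
Proof.
by move=> hI I1; apply/seteqP; split=> // x _; rewrite -[x]mulr1; exact: ideal_mull.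
Qed.

Lemma noeth_max_ideal (F : set (set R)) I0 :
  noetherian R -> F I0 -> (forall I, F I -> ideal I) ->
  exists I, F I /\ forall J, F J -> I `<=` J -> J = I.
Proof.
move=> hR FI hF; apply: (@noeth_max R R^o F I0 [:: 1]) => // I FI'.
by split; [exact: hF | move=> x _; rewrite -/(ideal_gen _) ideal_genT].
Qed.

(* Working form of [noetherian_local]: the non-units form the ideal [m]. *)
Definition local_noeth (m : set R) : Prop :=
  [/\ noetherian R, ideal m, ~ m 1 & forall a, ~ m a -> exists b, b * a = 1].

Lemma local_noethP m : noetherian_local m <-> local_noeth m.
Proof.
split=> [[hR [[hm mT mmax] muniq]]|[hR hm m1 mu]].
  split=> //; first by move=> /(ideal1T hm).
  move=> a ma; apply: contrapT => nb.
  pose Ia : set R := [set x | exists b, x = b * a].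
  have hIa : ideal Ia.
    apply/idealP; split; first by exists 0; rewrite mul0r.
    by move=> c _ _ [b ->] [d ->]; exists (c * b + d); ring.
  have [||I [[hI AI I1] Imax]] := @noeth_max_ideal
    [set J | [/\ ideal J, Ia `<=` J & ~ J 1]] Ia hR.
  - by split=> // -[b eb]; apply: nb; exists b.
  - by move=> I [].
  suff Im : I = m by apply: ma; rewrite -Im; apply: AI; exists 1; rewrite mul1r.
  apply: muniq; split=> //; first by move=> IT; apply: I1; rewrite IT.
  move=> J hJ IJ; have [J1|J1] := pselect (J 1); first by right; exact: ideal1T.
  by left; apply: Imax => //; split=> //; exact: subset_trans IJ.
have sub n : ideal n -> n <> setT -> n `<=` m.
  move=> hn nT x nx; apply: contrapT => /mu[b bx]; apply: nT; apply: ideal1T => //.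
  by rewrite -bx; exact: ideal_mull.
split=> //; split; first split=> //.
- by move=> mT; apply: m1; rewrite mT.
- move=> I hI mI; have [IT|IT] := pselect (I = setT); first by right.
  by left; apply/seteqP; split=> //; exact: sub.
- move=> n [hn nT nmax].
  have [->//|mT] := nmax m hm (sub _ hn nT).
  by case: m1; rewrite mT.
Qed.

Lemma local_sub m I : local_noeth m -> ideal I -> ~ I 1 -> I `<=` m.
Proof.
move=> [_ _ _ mu] hI I1 x Ix; apply: contrapT => /mu[b bx].
by apply: I1; rewrite -bx; exact: ideal_mull.
Qed.

Lemma local_unit1B m a : local_noeth m -> m a -> exists b, b * (1 - a) = 1.
Proof.
move=> [_ hm m1 mu] ma; apply: mu => h; apply: m1.
by rewrite -[1](subrK a); exact: idealD.
Qed.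

Lemma prime_idealP P : prime_ideal P <->
  [/\ ideal P, ~ P 1 & forall x y, P (x * y) -> P x \/ P y].
Proof.
rewrite /prime_ideal /idealr_closed /prime_idealr_closed; split.
  move=> [[P0 P1 PL] PM]; split; last 1 first.
  - by move=> x y /mem_set /PM /orP[] /set_mem; [left|right].
  - apply/idealP; split; first exact: set_mem P0.
    by move=> a x y /mem_set hx /mem_set hy; apply: set_mem; exact: PL.
  - by move=> /mem_set h; move: P1; rewrite h.
move=> [hP P1 PM]; split; first split.
- by apply/mem_set; exact: ideal0.
- by apply/negP => /set_mem.
- move=> a x y /set_mem hx /set_mem hy; apply/mem_set.
  by apply: idealD => //; exact: ideal_mull.
- by move=> x y /set_mem/PM[] h; apply/orP; [left|right]; exact/mem_set.
Qed.

Lemma prime_idealX P x n : prime_ideal P -> P (x ^+ n) -> P x.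
Proof.
move=> /prime_idealP[hP P1 PM]; elim: n => [|n IH]; first by rewrite expr0.
by rewrite exprS => /PM[].
Qed.

Lemma prime_ideal_ideal P : prime_ideal P -> ideal P.
Proof. by move=> /prime_idealP[]. Qed.

(* An ideal maximal among those disjoint from a multiplicative set is prime. *)
Lemma prime_avoiding I (T : set R) :
  noetherian R -> ideal I -> T 1 -> (forall a b, T a -> T b -> T (a * b)) ->
  (forall a, T a -> ~ I a) ->
  exists P, [/\ prime_ideal P, I `<=` P & forall a, T a -> ~ P a].
Proof.
move=> hR hI T1 TM TI.
have [||P [[hP IP TP] Pmax]] := @noeth_max_ideal
    [set J | [/\ ideal J, I `<=` J & forall a, T a -> ~ J a]] I hR.
- by split.
- by move=> J [].
exists P; split=> //; apply/prime_idealP; split=> //; first exact: TP.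
move=> x y Pxy; apply: contrapT => /not_orP[nx ny].
(* By maximality of [P], the ideal P + Rz meets [T]. *)
have key z : ~ P z -> exists s a p, [/\ T s, P p & s = a * z + p].
  move=> nz; apply: contrapT => ns; apply: nz.
  pose J : set R := [set w | exists a p, P p /\ w = a * z + p].
  have JP : P `<=` J by move=> p Pp; exists 0, p; rewrite mul0r add0r.
  have <- : J = P.
    apply: Pmax => //; split.
    - apply/idealP; split; first by apply: JP; exact: ideal0.
      move=> c _ _ [a1 [p1 [h1 ->]]] [a2 [p2 [h2 ->]]].
      exists (c * a1 + a2), (c * p1 + p2); split; last by ring.
      by apply: idealD => //; exact: ideal_mull.
    - exact: subset_trans JP.
    - by move=> s Ts [a [p [Pp es]]]; apply: ns; exists s, a, p.
  by exists 1, 0; split; [exact: ideal0 | ring].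
have [s [a [p [Ts Pp es]]]] := key _ nx.
have [t [b [q [Tt Pq et]]]] := key _ ny.
apply: (TP (s * t)); first exact: TM.
have -> : s * t = (a * b) * (x * y) + ((a * x + p) * q + (b * y) * p) by rewrite es et; ring.
by repeat (apply: idealD || apply: ideal_mull) => //.
Qed.

End Ideals.

Section Nakayama.
Variables (R : comNzRingType) (V : lmodType R).
Implicit Types (A B C : set V) (u v w : V) (g : seq V) (xs : seq R).

Fixpoint smul xs A : set V :=
  if xs is x :: xs' then addS [set x *: u | u in A] (smul xs' A) else [set 0].

Lemma submodule_scale x A : submodule A -> submodule [set x *: u | u in A].
Proof.
move=> hA; apply/submoduleP; split; first by exists 0; [exact: submod0|rewrite scaler0].
move=> a _ _ [u hu <-] [v hv <-]; exists (a *: u + v); first exact: submodL.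
by rewrite scalerDr !scalerA mulrC.
Qed.

Lemma submodule_smul xs A : submodule A -> submodule (smul xs A).
Proof.
move=> hA; elim: xs => [|x xs IH] /=; first exact: submodule_set0.
by apply: submodule_addS => //; exact: submodule_scale.
Qed.

Lemma smul_in xs A x u : submodule A -> x \in xs -> A u -> smul xs A (x *: u).
Proof.
move=> hA; elim: xs => // y xs IH; rewrite in_cons => /orP[/eqP<-|hx] hu.
  by apply: addSl; [exact: submodule_smul | exists u].
by apply: addSr; [exact: submodule_scale | exact: IH].
Qed.

Lemma smul_min xs A B : submodule B ->
  (forall x u, x \in xs -> A u -> B (x *: u)) -> smul xs A `<=` B.
Proof.
move=> hB; elim: xs => [|x xs IH] h /=; first by move=> _ ->; exact: submod0.
apply: addS_min => //; first by move=> _ [u hu <-]; apply: h; rewrite ?mem_head.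
by apply: IH => y u hy; apply: h; rewrite in_cons hy orbT.
Qed.

Lemma smul_sub xs A : submodule A -> smul xs A `<=` A.
Proof. by move=> hA; apply: smul_min => // x u _; exact: submodZ. Qed.

Lemma smulS xs A B : A `<=` B -> smul xs A `<=` smul xs B.
Proof. by move=> AB; elim: xs => //= x xs IH; apply: addSS => //; exact: image_subset. Qed.

Lemma smul_cat xs ys A : submodule A -> smul (xs ++ ys) A = addS (smul xs A) (smul ys A).
Proof.
move=> hA; apply/seteqP; split.
  apply: smul_min; first by apply: submodule_addS; exact: submodule_smul.
  by move=> x u; rewrite mem_cat => /orP[] hx hu; [apply: addSl|apply: addSr];
    (exact: submodule_smul || exact: smul_in).
by apply: addS_min; first exact: submodule_smul;
   apply: smul_min; (try exact: submodule_smul) => x u hx hu;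
   apply: smul_in => //; rewrite mem_cat hx ?orbT.
Qed.

(** For an ideal m this is m times the span of [g], with one coefficient per generator so that
    Nakayama's lemma can eliminate generators one at a time. *)
Fixpoint mspan (m : set R) g : set V :=
  if g is u :: g' then [set w | exists a v, [/\ m a, mspan m g' v & w = a *: u + v]]
  else [set 0].

Lemma submodule_mspan m g : ideal m -> submodule (mspan m g).
Proof.
move=> hm; elim: g => [|u g IH] /=; first exact: submodule_set0.
apply/submoduleP; split.
  by exists 0, 0; split; [exact: ideal0|exact: submod0|rewrite scale0r addr0].
move=> c _ _ [a [v [ha hv ->]]] [b [w [hb hw ->]]].
exists (c * a + b), (c *: v + w); split; [|exact: submodL|].
  by apply: idealD => //; exact: ideal_mull.
by rewrite scalerDr scalerA addrACA scalerDl.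
Qed.

Lemma mspan_sub m g : mspan m g `<=` lin_span g.
Proof.
elim: g => [|u g IH] /=; first by move=> _ ->; exact/lin_span_nil.
by move=> _ [a [v [_ /IH hv ->]]]; apply/lin_span_cons; exists a, v.
Qed.

Lemma mspan_scale m g x w : ideal m -> m x -> lin_span g w -> mspan m g (x *: w).
Proof.
move=> hm mx; elim: g w => [|u g IH] w /=.
  by move=> /lin_span_nil ->; rewrite scaler0.
move=> /lin_span_cons[a [v [hv ->]]]; exists (x * a), (x *: v); split.
- exact: ideal_mulr.
- exact: IH.
- by rewrite scalerDr scalerA.
Qed.

(** In the relation for [u0] its own coefficient a lies in m, so 1 - a is invertible and [u0] can be
    solved for and substituted into the other relations. *)
Lemma nakayama_span m B g : local_noeth m -> submodule B ->
  {in g, forall u, addS B (mspan m g) u} -> {in g, forall u, B u}.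
Proof.
move=> hm hB; have [_ im _ _] := hm; elim: g => // u0 g IH H.
have [b [_ [Bb [a [w [ma wg ->]] eu]]]] := H u0 (mem_head _ _).
have [c hc] := local_unit1B hm ma.
have eu0 : u0 = c *: b + c *: w.
  rewrite -scalerDr.
  have -> : b + w = (1 - a) *: u0 by rewrite scalerBl scale1r {1}eu addrCA addrAC subrr add0r.
  by rewrite scalerA hc scale1r.
have Bg : {in g, forall u, B u}.
  apply: IH => v vg.
  have [|b' [_ [Bb' [a' [w' [ma' wg' ->]] ev]]]] := H v; first by rewrite in_cons vg orbT.
  exists (b' + a' *: (c *: b)), (a' *: (c *: w) + w'); split.
  - by apply: submodD => //; do 2 apply: submodZ => //.
  - by apply: submodL => //; [exact: submodule_mspan | apply: submodZ => //;
      exact: submodule_mspan].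
  - by rewrite ev {1}eu0 scalerDr !addrA.
have Bw : B w by apply: (lin_span_min hB Bg); exact: mspan_sub wg.
move=> u; rewrite in_cons => /orP[/eqP->|/Bg//].
by rewrite eu0; apply: submodD => //; exact: submodZ.
Qed.

Lemma nakayama m A B xs : local_noeth m -> fgs A -> submodule B ->
  {in xs, forall x, m x} -> A `<=` addS B (smul xs A) -> A `<=` B.
Proof.
move=> hm [g ->] hB mx AB; have [_ im _ _] := hm.
apply: lin_span_min => //; apply: (nakayama_span hm hB) => u /lin_span_in /AB.
apply: addSS => //; apply: smul_min; first exact: submodule_mspan.
by move=> x w /mx; exact: mspan_scale.
Qed.

End Nakayama.

(** * Length *)

(** Maps between submodules are functions on the ambient modules with arbitrary values outside [U];
    they can then be defined by choice, without passing to subtypes. *)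
Definition linear_on (R : comNzRingType) (V W : lmodType R) (U : set V) (q : V -> W) :=
  forall a u v, U u -> U v -> q (a *: u + v) = a *: q u + q v.

Section LinearOn.
Variables (R : comNzRingType) (V W : lmodType R) (U : set V) (q : V -> W).
Hypotheses (hU : submodule U) (hq : linear_on U q).

Lemma linear_onD u v : U u -> U v -> q (u + v) = q u + q v.
Proof. by move=> hu hv; rewrite -[u]scale1r hq // !scale1r. Qed.

Lemma linear_on0 : q 0 = 0.
Proof.
have := linear_onD (submod0 hU) (submod0 hU).
by rewrite addr0 => /eqP; rewrite -[X in X == _]addr0 (inj_eq (addrI _)) => /eqP/esym.
Qed.

Lemma linear_onZ a u : U u -> q (a *: u) = a *: q u.
Proof.
by move=> hu; rewrite -[_ *: u]addr0 hq ?linear_on0 ?addr0 //; exact: submod0.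
Qed.

Lemma linear_onN u : U u -> q (- u) = - q u.
Proof. by move=> hu; rewrite -scaleN1r linear_onZ // scaleN1r. Qed.

Lemma linear_onB u v : U u -> U v -> q (u - v) = q u - q v.
Proof. by move=> hu hv; rewrite linear_onD ?linear_onN //; exact: submodN. Qed.

Lemma submodule_image : submodule (q @` U).
Proof.
apply/submoduleP; split; first by exists 0; [exact: submod0 | exact: linear_on0].
by move=> a _ _ [u hu <-] [v hv <-]; exists (a *: u + v); [exact: submodL | exact: hq].
Qed.

Lemma submodule_preimage D : submodule D -> submodule (U `&` q @^-1` D).
Proof.
move=> hD; apply/submoduleP; split.
  by split; [exact: submod0 | rewrite /preimage /= linear_on0; exact: submod0].
move=> a u v [? ?] [? ?]; split; first exact: submodL.
by rewrite /preimage /= hq //; exact: submodL.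
Qed.

End LinearOn.

Lemma linear_onS (R : comNzRingType) (V W : lmodType R) (U U' : set V) (q : V -> W) :
  U' `<=` U -> linear_on U q -> linear_on U' q.
Proof. by move=> UU h a u v /UU hu /UU hv; exact: h. Qed.

Section Length.
Variables (R : comNzRingType) (V : lmodType R).
Implicit Types (A B C T : set V).

(** The last term is exactly the third argument, while the first one only has to contain [A]; this
    slack lets chains be concatenated and widened freely. *)
Inductive chain A : nat -> set V -> Prop :=
| chain0 B : submodule B -> A `<=` B -> chain A 0 B
| chainS n B C : chain A n B -> submodule C -> B `<=` C -> ~ (C `<=` B) ->
    chain A n.+1 C.

Lemma chain_top A n B : chain A n B -> submodule B /\ A `<=` B.
Proof.
by elim=> [//|{}n {}B C _ [hB AB] hC BC _]; split=> //; exact: subset_trans BC.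
Qed.

Lemma chain_widen A n B C : chain A n B -> submodule C -> B `<=` C -> chain A n C.
Proof.
case=> [{}B hB AB hC BC|{}n {}B B' h hB' BB' nB hC BC].
  by apply: chain0 => //; exact: subset_trans BC.
by apply: (chainS h) => //; [exact: subset_trans BC|move=> CB; apply: nB;
  exact: subset_trans CB].
Qed.

Lemma chain_cat A B C n p : chain A n B -> chain B p C -> chain A (n + p) C.
Proof.
move=> hn; elim=> [{}C hC BC|{}p C1 {}C _ IH hC C1C nC].
  by rewrite addn0; exact: chain_widen BC.
by rewrite addnS; exact: chainS IH _ _ _.
Qed.

(** By the modular law, a strict inclusion B < C stays strict after intersecting with [T] or after
    adding [T], so every step is counted on at least one side. *)
Lemma chain_merge A T n B : submodule T -> A `<=` T -> chain A n B ->
  exists p q, [/\ (n <= p + q)%N, chain A p (B `&` T) & chain T q (addS B T)].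
Proof.
move=> hT AT; elim=> [{}B hB AB|{}n {}B C hBn [p [q [npq hp hq]]] hC BC nC].
  exists 0%N, 0%N; split=> //; apply: chain0.
  - exact: submoduleI.
  - by move=> u hu; split; [exact: AB|exact: AT].
  - exact: submodule_addS.
  - exact: addSr.
have [hB _] := chain_top hBn.
have hI : submodule (C `&` T) by exact: submoduleI.
have hS : submodule (addS C T) by exact: submodule_addS.
have hIs : B `&` T `<=` C `&` T by move=> u [/BC].
have hSs : addS B T `<=` addS C T by exact: addSS.
have [e|ne] := pselect (C `&` T `<=` B `&` T); last first.
  exists p.+1, q; split; [by rewrite addSn|exact: chainS hp _ _ _|exact: chain_widen hq _ _].
exists p, q.+1; split; [by rewrite addnS|exact: chain_widen hp _ _|].
apply: chainS hq _ _ _ => // h; apply: nC => c hc.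
have [b [t [hb ht ec]]] := h c (addSl hT hc).
rewrite ec; apply: submodD => //; apply: (proj1 (e t _)); split=> //.
by apply: (submod_addl hC (BC _ hb)); rewrite addrC -ec.
Qed.

Definition lenle A B b := forall n, chain A n B -> (n <= b)%N.

Lemma lenle_add A T B a b : submodule T -> submodule B -> A `<=` T -> T `<=` B ->
  lenle A T a -> lenle T B b -> lenle A B (a + b).
Proof.
move=> hT hB AT TB ha hb n /(chain_merge hT AT)[p [q [npq hp hq]]].
apply: leq_trans npq _; apply: leq_add.
  by apply: ha; apply: chain_widen hp _ _ => // u [].
by apply: hb; apply: chain_widen hq _ _ => //; exact: addS_min.
Qed.

Lemma lenle0 A B : B `<=` A -> lenle A B 0.
Proof.
move=> BA n h; case: h BA => // k C D hC _ CD nD DA; exfalso.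
by apply: nD; apply: subset_trans DA _; case: (chain_top hC).
Qed.

(** The length of B/A, expressed without the quotient module. *)
Definition len A B a := chain A a B /\ lenle A B a.

Lemma len_ex A B b : submodule B -> A `<=` B -> lenle A B b -> exists a, len A B a.
Proof.
move=> hB AB hb.
have ex : exists n, `[< chain A n B >] by exists 0%N; apply/asboolP; exact: chain0.
have [|a /asboolP ha amax] := @ex_maxnP (fun n => `[< chain A n B >]) b ex.
  by move=> n /asboolP; exact: hb.
by exists a; split=> // n hn; apply: amax; exact/asboolP.
Qed.

Lemma len_uniq A B a b : len A B a -> len A B b -> a = b.
Proof. by move=> [h1 h2] [h3 h4]; apply/eqP; rewrite eqn_leq h4 // h2. Qed.

Lemma len_add A T B a b : len A T a -> len T B b -> len A B (a + b).
Proof.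
move=> [h1 h2] [h3 h4]; split; first exact: chain_cat h3.
have [? ?] := chain_top h1; have [? ?] := chain_top h3.
exact: (@lenle_add A T B).
Qed.

End Length.

Section LengthMap.
Variables (R : comNzRingType) (V W : lmodType R) (q : V -> W).
Variables (U A : set V) (U' A' : set W).
Hypotheses (hU : submodule U) (hq : linear_on U q).
Hypotheses (hU' : submodule U') (hA' : submodule A') (AU' : A' `<=` U').
Hypothesis qU : forall u, U u -> U' (q u).
Hypothesis qsurj : forall w, U' w -> exists u v, [/\ U u, A' v & w = q u + v].
Hypothesis AE : forall u, A u <-> U u /\ A' (q u).

(** The hypotheses say that [q] induces an isomorphism from U/A onto U'/A'. Chains are carried over
    by image plus [A'] and back by preimage. *)
Lemma len_map n : len A U n <-> len A' U' n.
Proof.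
have to p C : chain A p C -> C `<=` U -> chain A' p (addS (q @` C) A').
  elim=> [{}C hC AC|{}p B {}C hB IH hC BC nC] CU.
    apply: chain0; first by apply: submodule_addS => //; apply: submodule_image hC _;
      exact: linear_onS hq.
    by apply: addSr; apply: submodule_image hC _; exact: linear_onS hq.
  have hqC : submodule (q @` C) by apply: submodule_image hC _; exact: linear_onS hq.
  apply: chainS (IH _) _ _ _; first exact: subset_trans CU.
  - exact: submodule_addS.
  - by apply: addSS => //; exact: image_subset.
  move=> h; apply: nC => c hc.
  have [_ [v [[b hb <-] hv ec]]] : addS (q @` B) A' (q c) by apply: h; apply: addSl => //;
    exists c.
  have [hBs AB] := chain_top hB.
  have Ub := CU _ (BC _ hb); have Uc := CU _ hc.
  rewrite -(subrK b c); apply: submodD => //; apply: AB; apply/AE; split; first exact: submodB.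
  by rewrite (linear_onB hU hq) // ec addrC addKr.
have from p D : chain A' p D -> D `<=` U' -> chain A p (U `&` q @^-1` D).
  elim=> [{}D hD AD|{}p B {}D hB IH hD BD nD] DU.
    apply: chain0; first exact: submodule_preimage.
    by move=> u /AE[? ?]; split=> //; exact: AD.
  apply: chainS (IH _) _ _ _; first exact: subset_trans DU.
  - exact: submodule_preimage.
  - by move=> u [? ?]; split=> //; exact: BD.
  move=> h; apply: nD => w hw.
  have [u [v [hu hv ew]]] := qsurj (DU _ hw).
  have [hBs AB] := chain_top hB.
  have Bq : (U `&` q @^-1` B) u.
    apply: h; split=> //; rewrite /preimage /=; apply: (submod_addl hD (BD _ (AB _ hv))).
    by rewrite -ew.
  by rewrite ew; apply: submodD => //; [case: Bq | exact: AB].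
have e p : chain A p U <-> chain A' p U'.
  split=> [h|h].
    apply: chain_widen (to _ _ h (@subset_refl _ _)) hU' _.
    by apply: addS_min => // _ [u hu <-]; exact: qU.
  by apply: chain_widen (from _ _ h (@subset_refl _ _)) hU _ => u [].
by rewrite /len /lenle; split=> -[h1 h2]; (split; first exact/e) => p /e; exact: h2.
Qed.

End LengthMap.

(** The second isomorphism theorem: U/(U ∩ A) is isomorphic to (U + A)/A. *)
Lemma len_capadd (R : comNzRingType) (V : lmodType R) (A U : set V) n :
  submodule A -> submodule U -> len (U `&` A) U n <-> len A (addS U A) n.
Proof.
move=> hA hU; apply: (@len_map R V V id) => //.
- exact: submodule_addS.
- exact: addSr.
- exact: addSl.
Qed.

Section FiniteLength.
Variables (R : comNzRingType) (V : lmodType R) (m : set R).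
Hypothesis hm : local_noeth m.
Implicit Types (A B U : set V) (g : seq V).

Lemma lenle_span1 A u : submodule A -> (forall x, m x -> A (x *: u)) ->
  lenle A (addS A (lin_span [:: u])) 1.
Proof.
move=> hA mu [|[|n]] // h; exfalso; have [_ _ _ munit] := hm.
inversion h as [|? B C hB hC BC nC]; subst.
inversion hB as [|? B' B'' hB' hB'' BB' nB]; subst.
have [hB's AB'] := chain_top hB'.
apply: nB => b Bb; have [a [v [Aa]]] := BC _ Bb.
move=> /lin_span_cons[x [w [/lin_span_nil->]]]; rewrite addr0 => -> eb.
(* If the coefficient x is a unit, then [u] lies in the middle term [B], which is therefore already
   the top; otherwise b lies in [A]. *)
have [mx|/munit[y yx]] := pselect (m x).
  by apply: AB'; rewrite eb; apply: submodD => //; exact: mu.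
case: nC; apply: addS_min => //; first by apply: subset_trans BB'.
apply: lin_span_min => // _ /[1!inE] /eqP ->.
have -> : u = y *: (b - a) by rewrite eb addrAC subrr add0r scalerA yx scale1r.
by apply: submodZ => //; apply: submodB => //; exact/BB'/AB'.
Qed.

Lemma lenle_span A g : submodule A -> {in g, forall u x, m x -> A (x *: u)} ->
  lenle A (addS A (lin_span g)) (size g).
Proof.
move=> hA; elim: g => [|u g IH] mg.
  apply: lenle0; apply: addS_min => //.
  by move=> _ /lin_span_nil ->; exact: submod0.
have hs (h : seq V) := submodule_addS hA (submodule_span h).
have {}IH : lenle A (addS A (lin_span g)) (size g).
  by apply: IH => v vg; apply: mg; rewrite in_cons vg orbT.
have h1 : lenle (addS A (lin_span g)) (addS (addS A (lin_span g)) (lin_span [:: u])) 1.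
  apply: lenle_span1 => // x mx; apply: addSl; first exact: submodule_span.
  by apply: mg; rewrite ?mem_head.
rewrite /= -addn1; apply: (lenle_add (hs g)) => //.
- by apply: addSl; exact: submodule_span.
- by apply: addSS => //; apply: lin_spanS => v vg; rewrite in_cons vg orbT.
move=> n hn; apply: h1; apply: chain_widen hn _ _.
  by apply: submodule_addS => //; exact: submodule_span.
apply: addS_min; first by apply: submodule_addS => //; exact: submodule_span.
  by apply: subset_trans (addSl (submodule_span _)); exact: addSl (submodule_span _).
apply: lin_span_min; first by apply: submodule_addS => //; exact: submodule_span.
move=> v; rewrite in_cons => /orP[/eqP->|vg].
  by apply: addSr => //; apply: lin_span_in; rewrite mem_head.
by apply: addSl; [exact: submodule_span|apply: addSr => //; exact: lin_span_in].
Qed.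

(** Entries of [ys] kill U/A, those of [xs] do so after raising to the power k. Filter by A + x^j U:
    each factor is killed by x, so x moves from [xs] to [ys]. When [xs] is empty, all of m kills U/A
    and generators bound its length. *)
Lemma finite_length_aux k ys xs g A U : m `<=` ideal_gen (ys ++ xs) ->
  submodule A -> submodule U -> A `<=` U -> U `<=` lin_span g ->
  {in ys, forall y u, U u -> A (y *: u)} ->
  {in xs, forall x u, U u -> A (x ^+ k *: u)} -> exists b, lenle A U b.
Proof.
have [hR _ _ _] := hm.
elim: xs ys A U => [|x xs IH] ys A U mI hA hU AU Ug hys hxs.
  have [h eU] := noeth_sub hR hU Ug.
  have [e|ne] := pselect (addS A (lin_span h) = U); last first.
    case: ne; rewrite -eU; apply/seteqP; split; last exact: addSr.
    exact: addS_min.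
  exists (size h); rewrite -e; apply: lenle_span => // u uh z mz.
  pose J : set R := [set z | A (z *: u)].
  have hJ : ideal J.
    apply/idealP; split; first by rewrite /J /= scale0r; exact: submod0.
    move=> a c d h1 h2; rewrite /J /= scalerDl -scalerA.
    by apply: submodL.
  move: (mI z mz); rewrite cats0; apply: (ideal_gen_min hJ) => y hy.
  by apply: hys => //; rewrite eU; exact: lin_span_in.
have hxU j : submodule (addS A [set x ^+ j *: u | u in U]).
  by apply: submodule_addS => //; exact: submodule_scale.
have hxUU j : addS A [set x ^+ j *: u | u in U] `<=` U.
  by apply: addS_min => // _ [u hu <-]; exact: submodZ.
have step j : exists b, lenle (addS A [set x ^+ j *: u | u in U]) U b.
  elim: j => [|j [b hb]].
    exists 0%N; apply: lenle0 => u hu; apply: addSr => //.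
    by exists u => //; rewrite expr0 scale1r.
  have sub : addS A [set x ^+ j.+1 *: u | u in U] `<=` addS A [set x ^+ j *: u | u in U].
    apply: addSS => // _ [u hu <-]; exists (x *: u); first exact: submodZ.
    by rewrite scalerA -exprSr.
  have [||||c hc] := IH (x :: ys) (addS A [set x ^+ j.+1 *: u | u in U])
      (addS A [set x ^+ j *: u | u in U]) _ (hxU _) (hxU _) sub.
  - move=> z /mI; apply: ideal_gen_min; first exact: ideal_ideal_gen.
    move=> w; rewrite mem_cat in_cons => hw; apply: ideal_gen_in.
    by move: hw; rewrite mem_cat in_cons => /or3P[->|->|->]; rewrite ?orbT.
  - exact: subset_trans Ug.
  - move=> y; rewrite in_cons => /orP[/eqP->|hy] u hu.
      case: hu => [a [_ [Aa [w Uw <-] ->]]]; rewrite scalerDr scalerA -exprS.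
      apply: submodD => //; last by apply: addSr => //; exists w.
      by apply: addSl; [exact: submodule_scale|exact: submodZ].
    by apply: addSl; [exact: submodule_scale|apply: hys => //; exact: hxUU hu].
  - move=> y hy u hu; apply: addSl; first exact: submodule_scale.
    by apply: hxs; [rewrite in_cons hy orbT|exact: hxUU hu].
  by exists (c + b)%N; apply: lenle_add hc hb.
have [b hb] := step k; exists b => n hn; apply: hb.
move: hn; have -> // : addS A [set x ^+ k *: u | u in U] = A.
apply/seteqP; split; last by apply: addSl; exact: submodule_scale.
by apply: addS_min => // _ [u hu <-]; apply: hxs; rewrite ?mem_head.
Qed.

Lemma finite_length k xs g A U : m = ideal_gen xs ->
  submodule A -> submodule U -> A `<=` U -> U `<=` lin_span g ->
  {in xs, forall x u, U u -> A (x ^+ k *: u)} -> exists a, len A U a.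
Proof.
move=> mE hA hU AU Ug hxs.
have [||b] := @finite_length_aux k [::] xs g A U _ hA hU AU Ug _ hxs => //.
  by rewrite mE.
exact: len_ex.
Qed.

End FiniteLength.

(** * Krull's intersection theorem and powers of row modules *)

Lemma addSA (R : comNzRingType) (V : lmodType R) (A B C : set V) :
  addS A (addS B C) = addS (addS A B) C.
Proof.
apply/seteqP; split=> w.
  move=> [a [_ [ha [b [c [hb hc ->]]] ->]]]; exists (a + b), c; split=> //.
    by exists a, b.
  by rewrite addrA.
move=> [_ [c [[a [b [ha hb ->]]] hc ->]]]; exists a, (b + c); split=> //.
  by exists b, c.
by rewrite addrA.
Qed.

Section Krull.
Variables (R : comNzRingType) (V : lmodType R) (m : set R) (xs : seq R).
Hypotheses (hm : local_noeth m) (mE : m = ideal_gen xs).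

(** The ideals generated by t-th powers of generators replace the powers of m. Let W be the
    intersection, and L maximal with L ∩ W = A + mW. By maximality some power of each generator
    sends U into L, so W lies in L, W = A + mW, and Nakayama applies. *)
Lemma krull_intersection (A U : set V) g u :
  submodule A -> submodule U -> A `<=` U -> U `<=` lin_span g ->
  (forall t, addS A (smul [seq x ^+ t | x <- xs] U) u) -> A u.
Proof.
move=> hA hU AU Ug hu; have [hR him _ _] := hm.
have hsm t := submodule_smul [seq x ^+ t | x <- xs] hU.
pose W : set V := [set u | forall t, addS A (smul [seq x ^+ t | x <- xs] U) u].
have hW : submodule W.
  apply/submoduleP; split; first by move=> t; apply: submod0; exact: submodule_addS.
  by move=> a v w hv hw t; apply: submodL => //; exact: submodule_addS.
have WU : W `<=` U.
  by move=> w /(_ 0%N); apply: addS_min => //; exact: smul_sub.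
have AW : A `<=` W by move=> w Aw t; exact: addSl.
pose B := addS A (smul xs W).
have hB : submodule B by apply: submodule_addS => //; exact: submodule_smul.
have BW : B `<=` W by apply: addS_min => //; exact: smul_sub.
have AB : A `<=` B by apply: addSl; exact: submodule_smul.
have [||L [[hL LU LW] Lmax]] := @noeth_max _ _
  [set L | [/\ submodule L, L `<=` U & L `&` W = B]] B g hR.
- split=> //; first exact: subset_trans WU.
  by apply/seteqP; split=> [? []//|w hw]; split=> //; exact: BW.
- by move=> L [hL LU _]; split=> //; exact: subset_trans Ug.
have BL : B `<=` L by rewrite -LW => ? [].
have pow x : x \in xs -> exists k, forall v, U v -> L (x ^+ k *: v).
  move=> xin.
  pose c j : set V := [set v | U v /\ L (x ^+ j *: v)].
  have [|||n hn] := @noeth_acc _ _ c g hR.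
  - move=> j; apply/submoduleP; split.
      by split; [exact: submod0|rewrite scaler0; exact: submod0].
    move=> a v w [h1 h2] [h3 h4]; split; first exact: submodL.
    by rewrite scalerDr scalerA mulrC -scalerA; exact: submodL.
  - by move=> j v [/Ug].
  - by move=> j v [h1 h2]; split=> //; rewrite exprS -scalerA; exact: submodZ.
  exists n.
  have hxU := submodule_scale (x ^+ n) hU.
  have LL : L `<=` addS L [set x ^+ n *: v | v in U] by exact: addSl.
  (* For w = l + x^n v in W, both xw and xl lie in [L], hence so does x^(n+1) v; as the chain [c] is
     stable from n on, x^n v already lies in [L]. *)
  have <- : addS L [set x ^+ n *: v | v in U] = L.
    apply: Lmax => //; split; first exact: submodule_addS.
      by apply: addS_min => // _ [v hv <-]; exact: submodZ.
    apply/seteqP; split; last by move=> w hw; split; [exact/LL/BL|exact: BW].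
    move=> w [[l [_ [hl [v hv <-] ew]]] hw]; rewrite -LW; split=> //; rewrite ew.
    apply: submodD => //.
    have [] : c n v; last by [].
    apply: (hn n.+1); split=> //.
    have -> : x ^+ n.+1 *: v = x *: w - x *: l.
      by rewrite ew scalerDr addrAC subrr add0r scalerA -exprS.
    apply: submodB => //; last exact: submodZ.
    by apply: BL; apply: addSr => //; exact: smul_in.
  by move=> v hv; apply: addSr => //; exists v.
have [k hk] : exists k, forall x v, x \in xs -> U v -> L (x ^+ k *: v).
  elim: (xs) pow => [_|x ys IH hp]; first by exists 0%N.
  have [|k1 h1] := IH; first by move=> y hy; apply: hp; rewrite in_cons hy orbT.
  have [k2 h2] := hp x (mem_head _ _).
  exists (k1 + k2)%N => y v; rewrite in_cons => /orP[/eqP->|hy] hv.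
    by rewrite exprD -scalerA; apply: submodZ => //; exact: h2.
  by rewrite addnC exprD -scalerA; apply: submodZ => //; exact: h1.
have WL : W `<=` L.
  move=> w /(_ k); apply: addS_min => //; first exact: subset_trans BL.
  by apply: smul_min => // _ v /mapP[x hx ->] hv; exact: hk.
have fW : fgs W by apply: noeth_sub hR hW _; exact: subset_trans Ug.
suff /(_ u hu) : W `<=` A by [].
apply: (nakayama hm fW hA (xs := xs)).
  by move=> x hx; rewrite mE; exact: ideal_gen_in.
by rewrite -/B -LW => w hw; split=> //; exact: WL.
Qed.

End Krull.

(** * Tensor products with finitely presented modules, in terms of matrices *)

Section RowModules.
Variable R : comNzRingType.

Lemma mx_span k n : exists g : seq 'M[R]_(k, n), lin_span g = setT.
Proof.
exists [seq delta_mx ij.1 ij.2 | ij <- enum ({: 'I_k * 'I_n})].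
apply/seteqP; split=> // X _; rewrite (matrix_sum_delta X).
have h := submodule_span [seq delta_mx ij.1 ij.2 : 'M[R]_(k, n) | ij <- enum ({: 'I_k * 'I_n})].
apply: submod_sum => // i _; apply: submod_sum => // j _; apply: submodZ => //.
by apply: lin_span_in; apply/mapP; exists (i, j); rewrite ?mem_enum.
Qed.

Lemma lin_span_rowmx n (g : seq 'rV[R]_n) u :
  lin_span g u <-> exists c, u = c *m (\matrix_(i < size g) g`_i).
Proof.
split=> [[a ->]|[c ->]].
  exists (\row_i a i); rewrite mulmx_sum_row.
  by apply: eq_bigr => i _; rewrite mxE rowK.
exists (fun i => c 0 i); rewrite mulmx_sum_row.
by apply: eq_bigr => i _; rewrite rowK.
Qed.

Lemma row_generators n (U : set 'rV[R]_n) : noetherian R -> submodule U ->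
  exists l (B : 'M_(l, n)), forall u, U u <-> exists c, u = c *m B.
Proof.
move=> hR hU; have [g hg] := mx_span 1 n.
have [h eU] : fgs U by apply: (noeth_sub (g := g) hR hU); rewrite hg.
by exists (size h), (\matrix_(i < size h) h`_i) => u; rewrite eU lin_span_rowmx.
Qed.

Definition rowsin k n (U : set 'rV[R]_n) : set 'M[R]_(k, n) :=
  [set X | forall i, U (row i X)].

(** The quotient of [rowsin U] = U^k by this image of U^l is the tensor product of U with the
    cokernel of A : R^l -> R^k. *)
Definition mxact k l n (A : 'M_(k, l)) (U : set 'rV[R]_n) : set 'M[R]_(k, n) :=
  [set A *m X | X in rowsin U].

Lemma submodule_rowsin k n (U : set 'rV[R]_n) : submodule U -> submodule (@rowsin k n U).
Proof.
move=> hU; apply/submoduleP; split; first by move=> i; rewrite row0; exact: submod0.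
by move=> a X Y hX hY i; rewrite linearP; apply: submodL => //; [exact: hX|exact: hY].
Qed.

Lemma submodule_mxact k l n (A : 'M_(k, l)) (U : set 'rV[R]_n) :
  submodule U -> submodule (mxact A U).
Proof.
move=> hU; have h := submodule_rowsin l hU; apply/submoduleP; split.
  by exists 0; [exact: submod0|rewrite mulmx0].
move=> a _ _ [X hX <-] [Y hY <-]; exists (a *: X + Y); first exact: (submodL a h).
by rewrite mulmxDr scalemxAr.
Qed.

Lemma rowsin_mul k l n (A : 'M_(k, l)) (U : set 'rV[R]_n) X :
  submodule U -> rowsin U X -> rowsin U (A *m X).
Proof.
move=> hU hX i; rewrite row_mul mulmx_sum_row; apply: submod_sum => // j _.
by apply: submodZ => //; exact: hX.
Qed.

Lemma mxact_sub k l n (A : 'M_(k, l)) (U : set 'rV[R]_n) :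
  submodule U -> mxact A U `<=` @rowsin k n U.
Proof. by move=> hU _ [X hX <-]; exact: rowsin_mul. Qed.

Lemma rowsinS k n (U U' : set 'rV[R]_n) : U `<=` U' -> @rowsin k n U `<=` rowsin U'.
Proof. by move=> h X hX i; exact: h. Qed.

Lemma mxactS k l n (A : 'M_(k, l)) (U U' : set 'rV[R]_n) :
  U `<=` U' -> mxact A U `<=` mxact A U'.
Proof. by move=> h; apply: image_subset; exact: rowsinS. Qed.

(** Appending the columns of the scalar matrices x replaces coker A by coker A / (xs) coker A. The
    matrix is chosen before U, so that one matrix serves for all the modules to be compared. *)
Lemma mxact_augment k l (A : 'M_(k, l)) (xs : seq R) :
  exists l' (A' : 'M_(k, l')), forall n (U : set 'rV[R]_n), submodule U ->
    mxact A' U = addS (mxact A U) (smul xs (@rowsin k n U)).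
Proof.
elim: xs l A => [|x xs IH] l A.
  exists l, A => n U hU; apply/seteqP; split; first by apply: addSl; exact: submodule_set0.
  by apply: addS_min => //; [exact: submodule_mxact|move=> _ ->; apply: submod0;
    exact: submodule_mxact].
have [l' [A' hA']] := IH _ (row_mx A (x%:M)); exists l', A' => n U hU.
rewrite hA' //= addSA; congr addS; apply/seteqP; split.
  move=> _ [X hX <-]; exists (A *m usubmx X), (x *: dsubmx X); split.
  - by exists (usubmx X) => // i; rewrite row_usubmx; exact: hX.
  - by exists (dsubmx X) => // i; rewrite row_dsubmx; exact: hX.
  - by rewrite -{1}[X]vsubmxK mul_row_col mul_scalar_mx.
move=> _ [_ [_ [[X hX <-] [Y hY <-] ->]]]; exists (col_mx X Y).
  move=> i; rewrite -[i]splitK; case: split => j /=.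
    by rewrite rowKu; exact: hX.
  by rewrite rowKd; exact: hY.
by rewrite mul_row_col mul_scalar_mx.
Qed.

Section MapRows.
Variables (n n' : nat) (U : set 'rV[R]_n) (q : 'rV[R]_n -> 'rV[R]_n').
Hypotheses (hU : submodule U) (hq : linear_on U q).

Definition mapr k (X : 'M[R]_(k, n)) : 'M[R]_(k, n') := \matrix_i q (row i X).

Lemma row_mapr k (X : 'M[R]_(k, n)) i : row i (mapr X) = q (row i X).
Proof. exact: rowK. Qed.

Lemma linear_on_sum I (r : seq I) (a : I -> R) (F : I -> 'rV[R]_n) :
  (forall i, U (F i)) ->
  q (\sum_(i <- r) a i *: F i) = \sum_(i <- r) a i *: q (F i).
Proof.
move=> hF; elim: r => [|i r IH]; first by rewrite !big_nil (linear_on0 hU hq).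
rewrite !big_cons hq ?IH //; apply: submod_sum => // j _; exact: submodZ.
Qed.

Lemma mapr_linear k : linear_on (@rowsin k n U) (@mapr k).
Proof.
move=> a X Y hX hY; apply/row_matrixP => i.
by rewrite [RHS]linearP /= !row_mapr linearP /= hq.
Qed.

Lemma mapr_mul k l (A : 'M_(k, l)) X : rowsin U X -> mapr (A *m X) = A *m mapr X.
Proof.
move=> hX; apply/row_matrixP => i.
rewrite row_mapr !row_mul !mulmx_sum_row linear_on_sum //.
by apply: eq_bigr => j _; rewrite row_mapr.
Qed.

Lemma mapr_row l (c : 'rV_l) (X : 'M_(l, n)) : rowsin U X -> q (c *m X) = c *m mapr X.
Proof.
move=> hX; rewrite -mapr_mul //; apply/rowP => j.
by rewrite mxE; congr (q _ 0 j); apply/rowP => i; rewrite !mxE.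
Qed.

(** Right exactness of the tensor product with coker A, applied to ker q -> U -> q(U) -> 0. *)
Lemma len_mapr k l (A : 'M_(k, l)) a :
  len (addS (rowsin (U `&` q @^-1` [set 0])) (mxact A U)) (@rowsin k n U) a <->
  len (mxact A (q @` U)) (rowsin (q @` U)) a.
Proof.
have hqU : submodule (q @` U) by exact: submodule_image.
have lift k' (Y : 'M_(k', n')) : rowsin (q @` U) Y -> exists2 X, rowsin U X & mapr X = Y.
  move=> hY; have /choice[f hf] : forall i, exists u, U u /\ q u = row i Y.
    by move=> i; have [u ? ?] := hY i; exists u.
  exists (\matrix_i f i); first by move=> i; rewrite rowK; case: (hf i).
  by apply/row_matrixP => i; rewrite row_mapr rowK; case: (hf i).
apply: (@len_map _ _ _ (@mapr k)).
- exact: submodule_rowsin.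
- exact: mapr_linear.
- exact: submodule_rowsin.
- exact: submodule_mxact.
- exact: mxact_sub.
- by move=> X hX i; rewrite row_mapr; exists (row i X).
- move=> Y /lift[X hX <-]; exists X, 0; split=> //; last by rewrite addr0.
  by apply: submod0; exact: submodule_mxact.
move=> X; split.
  move=> [Y [_ [hY [Z hZ <-] ->]]]; have hYU : rowsin U Y by move=> i; case: (hY i).
  have hAZ := rowsin_mul A hU hZ; split.
    by exact: (submodD (submodule_rowsin k hU) hYU hAZ).
  rewrite (linear_onD (@mapr_linear k)) // mapr_mul //.
  have -> : mapr Y = 0 by apply/row_matrixP => i; rewrite row_mapr row0; case: (hY i).
  by rewrite add0r; exists (mapr Z) => // i; rewrite row_mapr; exists (row i Z).
move=> [hX [_ /lift[Z hZ <-] e]]; have hAZ := rowsin_mul A hU hZ.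
exists (X - A *m Z), (A *m Z); split; [|by exists Z|by rewrite subrK].
have hB : rowsin U (X - A *m Z) by exact: (submodB (submodule_rowsin k hU) hX hAZ).
move=> i; split=> //=; rewrite /preimage /=.
have : mapr (X - A *m Z) = 0.
  by rewrite (linear_onB (submodule_rowsin k hU) (@mapr_linear k)) // mapr_mul // e subrr.
by move=> /(congr1 (row i)); rewrite row_mapr row0.
Qed.

End MapRows.

Definition iso_on n n' (U : set 'rV[R]_n) (U' : set 'rV[R]_n') : Prop :=
  exists q, [/\ linear_on U q, q @` U = U' & forall u, U u -> q u = 0 -> u = 0].

Lemma len_iso n n' (U : set 'rV[R]_n) (U' : set 'rV[R]_n') k l (A : 'M_(k, l)) a :
  submodule U -> iso_on U U' ->
  len (mxact A U) (@rowsin k n U) a <-> len (mxact A U') (rowsin U') a.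
Proof.
move=> hU [q [hq <- qinj]]; rewrite -(len_mapr hU hq).
have -> : U `&` q @^-1` [set 0] = [set 0].
  apply/seteqP; split=> [u [? ?]|_ ->]; first exact: qinj.
  by split; [exact: submod0|rewrite /preimage /= (linear_on0 hU hq)].
suff -> : addS (rowsin [set 0]) (mxact A U) = mxact A U by [].
apply/seteqP; split.
  apply: addS_min => //; first exact: submodule_mxact.
  move=> X hX; have -> : X = 0 by apply/row_matrixP => i; rewrite row0; exact: hX.
  by apply: submod0; exact: submodule_mxact.
by apply: addSr; apply: submodule_rowsin; exact: submodule_set0.
Qed.

Lemma len_dsum n (U1 U2 : set 'rV[R]_n) k l (A : 'M_(k, l)) a1 a2 :
  submodule U1 -> submodule U2 -> (forall u, U1 u -> U2 u -> u = 0) ->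
  len (mxact A U1) (@rowsin k n U1) a1 -> len (mxact A U2) (@rowsin k n U2) a2 ->
  len (mxact A (addS U1 U2)) (@rowsin k n (addS U1 U2)) (a1 + a2).
Proof.
move=> hU1 hU2 h0 h1 h2; set Y := addS U1 U2.
have hY : submodule Y by exact: submodule_addS.
have split_rows k' (X : 'M_(k', n)) : rowsin Y X ->
    exists X1 X2, [/\ rowsin U1 X1, rowsin U2 X2 & X = X1 + X2].
  move=> hX.
  have /choice[f hf] : forall i, exists uv :
    'rV_n * 'rV_n, [/\ U1 uv.1, U2 uv.2 & row i X = uv.1 + uv.2].
    by move=> i; have [u [v [? ? ?]]] := hX i; exists (u, v).
  exists (\matrix_i (f i).1), (\matrix_i (f i).2); split.
  - by move=> i; rewrite rowK; case: (hf i).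
  - by move=> i; rewrite rowK; case: (hf i).
  - by apply/row_matrixP => i; rewrite linearD /= !rowK; case: (hf i).
have uniq k' (X1 X2 : 'M_(k', n)) : rowsin U1 X1 -> rowsin U2 X2 -> X1 = X2 -> X1 = 0.
  move=> r1 r2 e; apply/row_matrixP => i; rewrite row0; apply: h0; first exact: r1.
  by rewrite e; exact: r2.
have hr1 k' := submodule_rowsin k' hU1; have hr2 k' := submodule_rowsin k' hU2.
have hA := submodule_mxact A hY.
have Y1 : U1 `<=` Y by exact: addSl.
have Y2 : U2 `<=` Y by exact: addSr.
(* An intermediate term: by the second isomorphism theorem the factors below and above [T] are the
   tensor products of coker A with [U1] and with [U2]. *)
pose T := addS (@rowsin k n U1) (mxact A Y).
apply: (@len_add _ _ _ T).
  apply/(len_capadd _ hA (hr1 k)).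
  suff -> : rowsin U1 `&` mxact A Y = mxact A U1 by [].
  apply/seteqP; split; last by move=> X hX; split; [exact: mxact_sub hX|exact: mxactS Y1 _ hX].
  move=> X [hX1 [Z /split_rows[Z1 [Z2 [hZ1 hZ2 ->]]] eX]].
  have e : X - A *m Z1 = A *m Z2 by rewrite -eX mulmxDr addrAC subrr add0r.
  exists Z1 => //; apply/esym/eqP; rewrite -subr_eq0; apply/eqP; apply: uniq e.
    exact: (submodB (hr1 k) hX1 (rowsin_mul A hU1 hZ1)).
  exact: rowsin_mul.
have hT : submodule T by exact: submodule_addS.
have -> : rowsin Y = addS (@rowsin k n U2) T.
  apply/seteqP; split.
    move=> X /split_rows[X1 [X2 [hX1 hX2 ->]]]; exists X2, X1; split=> //;
      last by rewrite addrC.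
    exact: addSl.
  apply: addS_min; [exact: submodule_rowsin|exact: rowsinS|].
  apply: addS_min; [exact: submodule_rowsin|exact: rowsinS|exact: mxact_sub].
apply/(len_capadd _ hT (hr2 k)).
suff -> : rowsin U2 `&` T = mxact A U2 by [].
apply/seteqP; split; last first.
  move=> X hX; split; first exact: mxact_sub hX.
  by apply: addSr => //; exact: mxactS Y2 _ hX.
move=> X [hX2 [X1 [_ [hX1 [Z /split_rows[Z1 [Z2 [hZ1 hZ2 ->]]] <-] eX]]]].
exists Z2 => //.
have e : X1 + A *m Z1 = X - A *m Z2 by rewrite eX mulmxDr addrA addrK.
have /eqP : X1 + A *m Z1 = 0.
  apply: uniq e; first exact: (submodD (hr1 k) hX1 (rowsin_mul A hU1 hZ1)).
  exact: (submodB (hr2 k) hX2 (rowsin_mul A hU2 hZ2)).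
by rewrite e subr_eq0 => /eqP.
Qed.

End RowModules.

(** * Miyata's theorem *)

Section Miyata.
Variables (R : comNzRingType) (m : set R).
Hypothesis hm : local_noeth m.

Lemma ideal_gens : exists xs, m = ideal_gen xs.
Proof. by have [hR im _ _] := hm; exact: hR. Qed.

Variable xs : seq R.
Hypothesis mE : m = ideal_gen xs.

Lemma len_mxact_ex n (U : set 'rV[R]_n) k t B :
  submodule U -> submodule B ->
  smul [seq x ^+ t | x <- xs] (@rowsin R k n U) `<=` B -> B `<=` @rowsin R k n U ->
  exists a, len B (@rowsin R k n U) a.
Proof.
move=> hU hB tB BU; have [g hg] := mx_span R k n.
apply: (finite_length (k := t) hm mE (g := g)) => //; first exact: submodule_rowsin.
  by rewrite hg.
move=> x hx X hX; apply: tB; apply: smul_in => //; first exact: submodule_rowsin.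
by apply/mapP; exists x.
Qed.

Section Split.
Variables (a b : nat) (Y U1 U2 : set 'rV[R]_a) (q : 'rV[R]_a -> 'rV[R]_b).
Hypotheses (hY : submodule Y) (hq : linear_on Y q).
Local Notation K := (Y `&` q @^-1` [set 0]).
Local Notation X := (q @` Y).
Hypotheses (hU1 : submodule U1) (hU2 : submodule U2).
Hypotheses (YE : Y = addS U1 U2) (U12 : forall u, U1 u -> U2 u -> u = 0).
Hypotheses (iso1 : iso_on U1 X) (iso2 : iso_on U2 K).

Lemma submodule_ker : submodule K.
Proof. by apply: submodule_preimage => //; exact: submodule_set0. Qed.

(* An exact sequence 0 -> K -> Y -> X -> 0 with Y isomorphic to X + K is pure:
   modulo any power of the maximal ideal this is a comparison of lengths. *)
Lemma dsum_pure k l (A : 'M_(k, l)) (Z : 'M_(k, a)) :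
  rowsin K Z -> mxact A Y Z -> mxact A K Z.
Proof.
move=> hZK hZA; have hK := submodule_ker.
have [g hg] := mx_span R k a.
apply: (krull_intersection hm mE (U := rowsin K) (g := g)).
- exact: submodule_mxact.
- exact: submodule_rowsin.
- exact: mxact_sub.
- by rewrite hg.
(* [B] presents coker A modulo t-th powers of the generators of m, which has finite length, so
   lengths can be compared. *)
move=> t; have [l' [B hB]] := mxact_augment A [seq x ^+ t | x <- xs].
rewrite -hB //.
have hBt n (U : set 'rV[R]_n) : submodule U ->
    smul [seq x ^+ t | x <- xs] (@rowsin R k n U) `<=` mxact B U.
  by move=> hU; rewrite hB //; apply: addSr; exact: submodule_mxact.
have hlen n (U : set 'rV[R]_n) : submodule U -> exists c, len (mxact B U) (@rowsin R k n U) c.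
  move=> hU; apply: (len_mxact_ex (t := t)) => //;
    [exact: submodule_mxact|exact: hBt|exact: mxact_sub].
have [c1 h1] := hlen _ _ hU1; have [c2 h2] := hlen _ _ hU2.
have h12 := len_dsum hU1 hU2 U12 h1 h2; rewrite -YE in h12.
have hc := h2; rewrite (len_iso _ _ hU2 iso2) in hc.
have h1X := h1; rewrite (len_iso _ _ hU1 iso1) -(len_mapr hY hq) in h1X.
pose C := rowsin K `&` mxact B Y.
have sBY : submodule (mxact B Y) by exact: submodule_mxact.
have srK : submodule (@rowsin R k a K) by exact: submodule_rowsin.
have sC : submodule C by exact: submoduleI.
have BC : mxact B K `<=` C.
  by move=> W hW; split; [exact: mxact_sub hW|apply: mxactS hW => u []].
have [|e he] := @len_mxact_ex _ K k t C hK sC _ (@subIsetl _ _ _).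
  by apply: subset_trans BC; exact: hBt.
have he' : len (mxact B Y) (addS (rowsin K) (mxact B Y)) e by apply/len_capadd.
(* [e] is the length of the image of K in Y after tensoring. The tensor product with Y has length e
   + c1 by right exactness and c1 + c2 by the decomposition. Hence the image is as long as the
   tensor product with K itself, and an element of the kernel would give too long a chain. *)
have ec2 : e = c2.
  by apply/eqP; rewrite -(eqn_add2r c1) (len_uniq (len_add he' h1X) h12) addnC.
apply: contrapT => nZ.
suff h : chain (mxact B K) (1 + e) (rowsin K).
  have [_ /(_ _ h)] := hc; by rewrite ec2 ltnn.
apply: chain_cat (proj1 he).
apply: (@chainS _ _ _ _ (mxact B K)) => //; first apply: chain0 => //;
  try exact: submodule_mxact.
move=> CB; apply: nZ; apply: CB; split=> //.
by rewrite hB //; apply: addSl => //; apply: submodule_smul; exact: submodule_rowsin.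
Qed.

(** Purity splits the sequence since X is finitely presented. [A] holds the relations between the
    images in X of the generators [Ym] of Y, so [A *m Ym] has rows in K; purity writes it as
    [A *m N] with the rows of [N] in K, and the retraction sends [Ym] to [N]. *)
Lemma dsum_retraction : exists rho : 'rV[R]_a -> 'rV[R]_a,
  [/\ linear_on Y rho, forall y, Y y -> K (rho y) & forall y, K y -> rho y = y].
Proof.
have [hR _ _ _] := hm; have hK := submodule_ker.
have [l [Ym YmE]] := row_generators hR hY.
have rYm : rowsin Y Ym.
  by move=> i; apply/YmE; exists (delta_mx 0 i); rewrite -rowE.
pose Z := mapr q Ym.
have cZ (c : 'rV_l) : q (c *m Ym) = c *m Z by exact: (mapr_row hY hq).
have Yc (c : 'rV_l) : Y (c *m Ym) by apply/YmE; exists c.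
have [|k [A AE]] := @row_generators _ l [set c | c *m Z = 0] hR.
  apply/submoduleP; split; first by rewrite /= mul0mx.
  by move=> c u v /= hu hv; rewrite mulmxDl -scalemxAl hu hv scaler0 addr0.
have [||N hN eN] := @dsum_pure k l A (A *m Ym).
- move=> i; rewrite row_mul; split=> //=.
  rewrite /preimage /= cZ; have /= -> // := proj2 (AE (row i A)).
  by exists (delta_mx 0 i); rewrite -rowE.
- by exists Ym.
have wd (c : 'rV_l) : c *m Z = 0 -> c *m Ym = c *m N.
  by move=> /AE[e ->]; rewrite -!mulmxA eN.
have /choice[f hf] : forall y, exists c : 'rV_l, Y y -> y = c *m Ym.
  move=> y; have [/YmE[c ->]|nY] := pselect (Y y); first by exists c.
  by exists 0.
have fN c y : Y y -> y = c *m Ym -> f y *m N = c *m N.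
  move=> hy ey; apply/eqP; rewrite -subr_eq0 -mulmxBl; apply/eqP.
  have e : (f y - c) *m Ym = 0 by rewrite mulmxBl -hf // -ey subrr.
  by rewrite -wd // -cZ e (linear_on0 hY hq).
exists (fun y => f y *m N); split.
- move=> c u v hu hv; rewrite (@fN (c *: f u + f v)).
  + by rewrite mulmxDl scalemxAl.
  + exact: submodL.
  + by rewrite mulmxDl -scalemxAl -!hf.
- move=> y hy; have := rowsin_mul (f y) hK hN => /(_ 0).
  by congr (K _); apply/rowP => j; rewrite mxE.
- move=> y [hy qy]; rewrite -wd; first by rewrite -hf.
  by rewrite -cZ -hf.
Qed.

End Split.
End Miyata.

(** * Regular sequences and depth *)

Section SubLmodule.
Variables (R : comNzRingType) (V : lmodType R) (A : set V) (hA : submodule A).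

(* The proof of closure is a phantom argument, from which instances are inferred. *)
Definition subm_mem of submodule A : pred V := fun x => x \in A.

Record subm := Subm { subm_val : V; _ : subm_mem hA subm_val }.

HB.instance Definition _ := [isSub for subm_val].
HB.instance Definition _ := [Choice of subm by <:].

Lemma subm_mem_closed : GRing.submod_closed (subm_mem hA).
Proof. exact: hA. Qed.

HB.instance Definition _ := GRing.isSubmodClosed.Build R V (subm_mem hA) subm_mem_closed.
HB.instance Definition _ := [SubChoice_isSubLmodule of subm by <:].

Lemma submP (u : subm) : A (val u).
Proof. by case: u => v /= /set_mem. Qed.

Lemma submK (v : V) : A v -> exists u : subm, val u = v.
Proof. by move=> /mem_set hv; exists (Subm hv). Qed.

Lemma val_linear_on (U : set subm) : linear_on U (val : subm -> V).
Proof. by move=> a u v _ _; exact: linearP. Qed.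

Lemma image_val : (val : subm -> V) @` setT = A.
Proof.
by apply/seteqP; split=> [_ [u _ <-]|v /submK[u <-]]; [exact: submP | exists u].
Qed.

End SubLmodule.

Section WeaklyRegular.
Variable R : comNzRingType.
Implicit Types xs : seq R.

Lemma seq_mulE (V : lmodType R) xs : seq_mul V xs = smul xs [set: V].
Proof.
elim: xs => [|x xs IH].
  apply/seteqP; split=> w; first by move=> [v ->]; rewrite big_ord0.
  by move=> ->; exists (fun _ => 0); rewrite big_ord0.
apply/seteqP; split=> w /=; rewrite -IH.
  move=> [v ->]; exists (x *: v ord0), (\sum_(i < size xs) xs`_i *: v (lift ord0 i)).
  split; [by exists (v ord0)|by exists (fun i => v (lift ord0 i))|by rewrite big_ord_recl].
move=> [_ [_ [[u _ <-] [v ->] ->]]].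
exists (fun i => if unlift ord0 i is Some j then v j else u).
rewrite big_ord_recl unlift_none; congr (_ + _).
by apply: eq_bigr => i _; rewrite liftK.
Qed.

(* The part of [regular_seq] concerning zero divisors, for submodules. *)
Definition wreg (V : lmodType R) xs (A : set V) : Prop :=
  forall i, (i < size xs)%N -> forall u, A u ->
    smul (take i xs) A (xs`_i *: u) -> smul (take i xs) A u.

Lemma smul_map (V W : lmodType R) xs (A : set V) (B : set W) q u :
  submodule A -> submodule B -> linear_on A q -> (forall v, A v -> B (q v)) ->
  smul xs A u -> smul xs B (q u).
Proof.
move=> hA hB hq AB; elim: xs u => [|x xs IH] u /=.
  by move=> ->; exact: (linear_on0 hA hq).
move=> [_ [w [[v hv <-] hw ->]]]; exists (x *: q v), (q w); split.
- by exists (q v); first exact: AB.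
- exact: IH.
- by rewrite hq //; exact: smul_sub hw.
Qed.

Lemma smul_image (V W : lmodType R) xs (A : set V) (q : V -> W) :
  submodule A -> linear_on A q -> smul xs (q @` A) = q @` smul xs A.
Proof.
move=> hA hq; apply/seteqP; split; last first.
  move=> _ [u hu <-]; apply: (smul_map hA _ hq _ hu); first exact: submodule_image.
  by move=> v hv; exists v.
apply: smul_min.
  apply: submodule_image; first exact: submodule_smul.
  by apply: linear_onS hq; exact: smul_sub.
move=> x _ hx [u hu <-]; exists (x *: u); first exact: smul_in.
by rewrite (linear_onZ hA hq).
Qed.

Lemma wreg_image (V W : lmodType R) xs (A : set V) (q : V -> W) :
  submodule A -> linear_on A q -> (forall u, A u -> q u = 0 -> u = 0) ->
  wreg xs A <-> wreg xs (q @` A).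
Proof.
move=> hA hq qinj.
have E ys u : A u -> smul ys (q @` A) (q u) <-> smul ys A u.
  move=> hu; rewrite smul_image //; split; last by exists u.
  move=> [v hv e]; have Av := smul_sub hA hv.
  suff -> : u = v by [].
  apply/eqP; rewrite -subr_eq0; apply/eqP; apply: qinj; first exact: submodB.
  by rewrite (linear_onB hA hq) // e subrr.
split=> h i hi u.
  move=> [v hv <-]; rewrite -(linear_onZ hA hq) // !E //; first exact: h.
  exact: submodZ.
move=> hu; rewrite -(E _ u) // -(E _ (_ *: u)); last exact: submodZ.
by rewrite (linear_onZ hA hq) //; apply: h => //; exists u.
Qed.

Lemma regular_subm (V : lmodType R) xs (A : set V) (hA : submodule A) :
  regular_seq (subm hA) xs <-> wreg xs A /\ ~ (A `<=` smul xs A).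
Proof.
have hT := submodule_setT (subm hA).
have inj (u : subm hA) : setT u -> val u = 0 -> u = 0.
  by move=> _ e; apply: val_inj; rewrite e linear0.
have E : smul xs A = val @` smul xs [set: subm hA].
  by rewrite -(smul_image _ hT (val_linear_on (U := setT))) image_val.
have := wreg_image xs hT (val_linear_on (U := setT)) inj.
rewrite image_val => <-.
rewrite /regular_seq; split=> -[h1 h2]; split.
- by move=> i hi u _; rewrite -seq_mulE; exact: h1.
- move=> h; apply: h2; apply/seteqP; split=> // u _; rewrite seq_mulE.
  have := h _ (submP u); rewrite E.
  by move=> [v hv /val_inj <-].
- by move=> i hi u; rewrite seq_mulE; exact: h1.
- move=> e; apply: h2 => v /(submK hA)[u <-].
  rewrite E.
  by exists u => //; rewrite -seq_mulE e.
Qed.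

Lemma wreg_take (V : lmodType R) xs (A : set V) i : wreg xs A -> wreg (take i xs) A.
Proof.
move=> h j; rewrite size_take_min leq_min => /andP[ji jx] u hu.
by rewrite nth_take // take_takel ?(ltnW ji) //; exact: h.
Qed.

Lemma wreg_rcons (V : lmodType R) xs x (A : set V) :
  wreg (rcons xs x) A <->
  wreg xs A /\ forall u, A u -> smul xs A (x *: u) -> smul xs A u.
Proof.
split=> [h|[h1 h2] i].
  split.
    by have := wreg_take (i := size xs) h; rewrite -cats1 take_size_cat.
  have := h (size xs); rewrite size_rcons ltnS leqnn nth_rcons ltnn eqxx.
  by rewrite -cats1 take_size_cat // => /(_ isT).
rewrite size_rcons ltnS leq_eqVlt nth_rcons -cats1 => /orP[/eqP->|hi] u hu.
  by rewrite ltnn eqxx take_size_cat //; exact: h2.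
by rewrite hi takel_cat ?(ltnW hi) //; exact: h1.
Qed.

Lemma smul_rcons (V : lmodType R) xs x (A : set V) : submodule A ->
  smul (rcons xs x) A = addS (smul xs A) [set x *: u | u in A].
Proof.
move=> hA; rewrite -cats1 smul_cat //=; congr addS; apply/seteqP; split.
  apply: addS_min => //; first exact: submodule_scale.
  by move=> _ ->; apply: submod0; exact: submodule_scale.
by apply: addSl; exact: submodule_set0.
Qed.

Section Exact.
Variables (V W : lmodType R) (X : set V) (q : V -> W).
Hypotheses (hX : submodule X) (hq : linear_on X q).
Local Notation N := (X `&` q @^-1` [set 0]).
Local Notation M := (q @` X).

Let hN : submodule N.
Proof. by apply: submodule_preimage => //; exact: submodule_set0. Qed.

(* Tor_1(R/(xs), M) = 0. *)
Lemma wreg_smulI xs u : wreg xs M -> N u -> smul xs X u -> smul xs N u.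
Proof.
elim/last_ind: xs u => [//|xs x IH] u /wreg_rcons[h1 h2] hu.
rewrite !smul_rcons // => -[v [_ [hv [w hw <-] eu]]].
have Xv := smul_sub hX hv.
have : (q @` smul xs X) (q w).
  rewrite -smul_image //; apply: h2; first by exists w.
  rewrite smul_image //; exists (- v); first by apply: submodN => //; exact: submodule_smul.
  have [_] := hu; rewrite /preimage /= eu (linear_onD hq) //; last exact: submodZ.
  rewrite (linear_onZ hX hq) // => /eqP; rewrite addrC addr_eq0 => /eqP ->.
  by rewrite (linear_onN hX hq).
move=> [w' hw' ew]; have Xw' := smul_sub hX hw'.
have Nn : N (w - w').
  by split; [exact: submodB|rewrite /preimage /= (linear_onB hX hq) // ew subrr].
exists (v + x *: w'), (x *: (w - w')); split.
- apply: IH => //; last by apply: submodD (submodule_smul _ hX) hv (submodZ _ (submodule_smul _ hX) hw').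
  have -> : v + x *: w' = u - x *: (w - w') by rewrite eu scalerBr opprB addrA addrAC addrK addrC.
  by apply: submodB => //; exact: submodZ.
- by exists (w - w').
- by rewrite eu -addrA -scalerDr addrCA subrr addr0.
Qed.

(** By [wreg_smulI] the sequence N -> X -> M stays exact on the left modulo [xs], so a
    nonzerodivisor on both ends is one in the middle. *)
Lemma wreg_extension xs : wreg xs N -> wreg xs M -> wreg xs X.
Proof.
elim/last_ind: xs => [//|xs x IH] /wreg_rcons[n1 n2] /wreg_rcons[m1 m2].
apply/wreg_rcons; split; first exact: IH.
move=> u hu hxu.
have : (q @` smul xs X) (q u).
  rewrite -smul_image //; apply: m2; first by exists u.
  by rewrite smul_image //; exists (x *: u) => //; rewrite (linear_onZ hX hq).
move=> [w hw ew]; have Xw := smul_sub hX hw.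
have Nn : N (u - w).
  by split; [exact: submodB|rewrite /preimage /= (linear_onB hX hq) // ew subrr].
rewrite -(subrK w u); apply: submodD => //; first exact: submodule_smul.
apply: (@smulS _ _ _ N); first by move=> ? [].
apply: n2 => //; apply: wreg_smulI => //; first exact: submodZ.
rewrite scalerBr; apply: submodB => //; first exact: submodule_smul.
by apply: submodZ => //; exact: submodule_smul.
Qed.

(** Depth grows by one at each syzygy. If x u lies in (x_1, ..., x_i)N, regularity on X puts u into
    (x_1, ..., x_i)X, and [wreg_smulI] returns it to (x_1, ..., x_i)N using only the first i <= k
    terms on M. *)
Lemma wreg_syzygy xs k : wreg xs X -> wreg (take k xs) M -> wreg (take k.+1 xs) N.
Proof.
move=> hx hm i; rewrite size_take_min leq_min ltnS => /andP[ik ix] u hu.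
rewrite nth_take // take_takel; last exact: leqW.
move=> h; apply: wreg_smulI => //.
  by have := wreg_take (i := i) hm; rewrite take_takel.
case: hu => hu _; apply: hx => //.
by apply: smulS h => ? [].
Qed.

End Exact.

Lemma wreg_summand (V : lmodType R) xs (A B : set V) :
  submodule A -> submodule B -> (forall u, A u -> B u -> u = 0) ->
  wreg xs (addS A B) -> wreg xs A.
Proof.
move=> hA hB AB h i hi u hu hxu.
have hS := submodule_addS hA hB.
have : smul (take i xs) (addS A B) u.
  by apply: h => //; [exact: addSl|apply: smulS hxu; exact: addSl].
have : smul (take i xs) (addS A B) `<=` addS (smul (take i xs) A) (smul (take i xs) B).
  apply: smul_min; first by apply: submodule_addS; exact: submodule_smul.
  move=> x _ hx [a [b [ha hb ->]]]; exists (x *: a), (x *: b).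
  by split; [exact: smul_in|exact: smul_in|rewrite scalerDr].
move=> sub /sub[a [b [ha hb eu]]].
suff -> : u = a by [].
have b0 : b = 0.
  apply: AB; last exact: smul_sub hb.
  have -> : b = u - a by rewrite eu addrAC subrr add0r.
  by apply: submodB => //; exact: smul_sub ha.
by rewrite eu b0 addr0.
Qed.

Lemma wreg_free n xs : wreg xs [set: R^o] -> wreg xs [set: 'rV[R]_n].
Proof.
move=> h i hi u _.
have hT := @submodule_setT R R^o.
have hTn := @submodule_setT R 'rV[R]_n.
have hs := submodule_smul (take i xs) hTn.
move=> hxu; rewrite [u]row_sum_delta; apply: submod_sum => // j _.
apply: (@smul_map R^o _ _ setT setT (fun a : R^o => a *: delta_mx 0 j)) => //.
  by move=> a x y _ _; rewrite scalerDl scalerA.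
apply: h => //.
have := @smul_map _ R^o (take i xs) setT setT (fun v : 'rV[R]_n => v 0 j) _ hTn hT _ _ hxu.
rewrite mxE; apply=> //.
by move=> a x y _ _; rewrite !mxE.
Qed.

End WeaklyRegular.

(** * Depth is at most the dimension of the ring *)

Section DepthBound.
Variables (R : comNzRingType) (m : set R).
Hypothesis hm : local_noeth m.

Lemma prime_chain_cons n (P : nat -> set R) (P0 : set R) :
  prime_ideal P0 -> P0 `<` P 0%N ->
  (forall i, (i <= n)%N -> prime_ideal (P i)) ->
  (forall i, (i < n)%N -> P i `<` P i.+1) ->
  let P' i := if i is j.+1 then P j else P0 in
  (forall i, (i <= n.+1)%N -> prime_ideal (P' i)) /\
  (forall i, (i < n.+1)%N -> P' i `<` P' i.+1).
Proof. by move=> h0 h1 h2 h3; split=> -[|i] //=; [exact: h2|exact: h3]. Qed.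

(* The primes are found from the top: the next one is a maximal element among
   the annihilators of localised elements of M/(x_1, ..., x_i)M. *)
Lemma regular_prime_chain (M : lmodType R) xs :
  {in xs, forall x, m x} -> regular_seq M xs -> prime_chain R (size xs).
Proof.
move=> mx [hreg hne]; have [hR im m1 munit] := hm.
have hsub i := submodule_smul (take i xs) (@submodule_setT R M).
have [u0 hu0] : exists u, ~ seq_mul M xs u.
  by apply: contrapT => h; apply: hne; apply/seteqP; split=> // u _; apply: contrapT => nu;
    apply: h; exists u.
have hm_prime : prime_ideal m.
  apply/prime_idealP; split=> // x y mxy;
    apply: contrapT => /not_orP[/munit[a ax] /munit[b yb]].
  apply: m1; rewrite -[1]mulr1 -{1}ax -yb.
  have -> : a * x * (b * y) = a * b * (x * y) by ring.
  exact: ideal_mull.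
(* [T i Q] says that M/(x_1, ..., x_i)M does not vanish after localisation at Q. *)
pose T i (Q : set R) := exists u, forall s, ~ Q s -> ~ smul (take i xs) [set: M] (s *: u).
have step i Q : (i < size xs)%N -> prime_ideal Q -> T i.+1 Q ->
    exists Q', [/\ prime_ideal Q', Q' `<` Q & T i Q'].
  move=> hi /prime_idealP[iQ Q1 QM] [u hu].
  (* The contraction to R of the annihilator of v in the localisation at Q of M/(x_1, ..., x_i)M;
     [good v] says that v is nonzero there. *)
  pose I v : set R := [set a | exists2 s, ~ Q s & smul (take i xs) [set: M] ((s * a) *: v)].
  pose good v := forall s, ~ Q s -> ~ smul (take i xs) [set: M] (s *: v).
  have hI v : ideal (I v).
    apply/idealP; split; first by exists 1 => //; rewrite mulr0 scale0r; exact: submod0.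
    move=> a b c [s ns hs] [t nt ht]; exists (s * t); first by move=> /QM[].
    have -> : s * t * (a * b + c) = (t * a) * (s * b) + s * (t * c) by ring.
    rewrite scalerDl -(scalerA (t * a)) -(scalerA s (t * c)).
    exact: (submodD (hsub i) (submodZ _ (hsub i) hs) (submodZ _ (hsub i) ht)).
  have takeS : take i.+1 xs = rcons (take i xs) xs`_i by rewrite (take_nth 0).
  have gu : good u.
    move=> s ns h; apply: (hu s ns); rewrite takeS smul_rcons; last exact: submodule_setT.
    by apply: addSl => //; apply: submodule_scale; exact: submodule_setT.
  have [||_ [[v gv ->] vmax]] := @noeth_max_ideal _ [set J | exists2 v, good v & J = I v] (I u) hR.
  - by exists u.
  - by move=> _ [v _ ->].
  have IQ : I v `<=` Q.
    move=> a [s ns h]; apply: contrapT => na; apply: (gv (s * a)) => //.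
    by move=> /QM[].
  have Iv1 : ~ I v 1 by move=> /IQ.
  (* The new term kills the next quotient, which is nonzero at Q, so it lies in Q. Being a
     nonzerodivisor modulo the earlier terms, it does not lie in [I v]; this makes the inclusion of
     [I v] in Q strict. *)
  have xiQ : Q xs`_i.
    apply: contrapT => nx; apply: (hu _ nx); rewrite takeS smul_rcons;
      last exact: submodule_setT.
    by apply: addSr => //; exists u.
  exists (I v); split.
  - apply/prime_idealP; split=> // a b [s ns hab].
    have [?|na] := pselect (I v a); [by left|right].
    have ga : good (a *: v) by move=> t nt h; apply: na; exists t => //; rewrite -scalerA.
    have <- : I (a *: v) = I v.
      apply: vmax; first by exists (a *: v).
      move=> c [t nt h]; exists t => //.
      by rewrite scalerA mulrC -scalerA; exact: submodZ.
    by exists s => //; rewrite scalerA -mulrA (mulrC b).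
  - split=> // QI; have [s ns] := QI _ xiQ.
    rewrite mulrC -scalerA -seq_mulE => /(hreg i hi).
    by rewrite seq_mulE; exact: gv.
  - exists v => s ns h; apply: ns; exists 1 => //.
    by rewrite mul1r.
have chainP i : (i <= size xs)%N -> exists P : nat -> set R,
    [/\ forall j, (j <= i)%N -> prime_ideal (P j),
        forall j, (j < i)%N -> P j `<` P j.+1 & T (size xs - i)%N (P 0%N)].
  elim: i => [_|i IH hi].
    exists (fun _ => m); split=> //; exists u0 => s /munit[b bs].
    rewrite subn0 take_size -seq_mulE => h; apply: hu0.
    rewrite -[u0]scale1r -bs -scalerA seq_mulE; apply: submodZ.
      by apply: submodule_smul; exact: submodule_setT.
    by rewrite -seq_mulE.
  have [P [P1 P2 P3]] := IH (ltnW hi).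
  have [||Q' [q1 q2 q3]] := step (size xs - i.+1)%N (P 0%N) _ (P1 _ (leq0n _)).
  - by rewrite -subSn // subSS leq_subr.
  - by rewrite -subSn.
  have [h1 h2] := prime_chain_cons q1 q2 P1 P2.
  by exists (fun i => if i is j.+1 then P j else Q').
have [P [P1 P2 _]] := chainP _ (leqnn _).
by exists P.
Qed.

(** Nakayama turns a weakly regular sequence on a nonzero finitely generated module into a regular
    one, and no regular sequence is longer than dim R because it yields a chain of primes of its
    length. *)
Lemma subm_mcm (V : lmodType R) (A : set V) (hA : submodule A) xs g :
  krull_dim R (size xs) -> {in xs, forall x, m x} -> wreg xs A ->
  A `<=` lin_span g -> (exists2 u, A u & u <> 0) ->
  maximal_cohen_macaulay m (subm hA).
Proof.
move=> hd mx hw Ag [u Au u0]; have [hR im _ _] := hm.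
have fA := noeth_sub hR hA Ag.
split.
  have [h eA] := fA.
  have [k hk] : exists k : seq (subm hA), map val k = h.
    have : {in h, forall v, A v} by move=> v hv; rewrite eA; exact: lin_span_in.
    elim: (h) => [|v h' IH] hh; first by exists [::].
    have [|k <-] := IH; first by move=> w hw'; apply: hh; rewrite in_cons hw' orbT.
    have [w <-] := submK hA (hh v (mem_head _ _)).
    by exists (w :: k).
  exists k; apply/seteqP; split=> // v _.
  have : lin_span h (val v) by rewrite -eA; exact: submP.
  rewrite -hk; elim: (k) v => [|w k' IH] v /=.
    by move=> /lin_span_nil e; apply/lin_span_nil; apply: val_inj; rewrite linear0; exact: e.
  move=> /lin_span_cons[a [z [hz ev]]]; apply/lin_span_cons.
  exists a, (v - a *: w).
  have ez : z = val (v - a *: w).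
    apply: (@addrI _ (a *: val w)); rewrite -[LHS]ev.
    have <- : val (a *: w + (v - a *: w)) = a *: val w + val (v - a *: w) by exact: linearP.
    by rewrite addrC subrK.
  by split; [apply: IH; rewrite -ez|rewrite addrC subrK].
exists (size xs); split=> //; split.
  exists xs; split=> //; apply/regular_subm; split=> // h.
  suff /(_ _ Au) : A `<=` [set 0] by [].
  apply: (nakayama hm fA (@submodule_set0 _ _) mx).
  by apply: subset_trans h _; apply: addSr; exact: submodule_set0.
move=> n [ys [<- my hy]]; case: hd => _; apply.
exact: regular_prime_chain hy.
Qed.

End DepthBound.

(** * Decomposition into indecomposables *)

Section Decomposition.
Variable R : comNzRingType.

Definition indec (V : lmodType R) (A : set V) : Prop :=
  (exists2 u, A u & u <> 0) /\
  forall N1 N2, submodule N1 -> submodule N2 -> A = addS N1 N2 ->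
    (forall u, N1 u -> N2 u -> u = 0) -> N1 `<=` [set 0] \/ N2 `<=` [set 0].

Lemma indec_subm (V : lmodType R) (A : set V) (hA : submodule A) :
  indec A -> indecomposable (subm hA).
Proof.
move=> [[u Au u0] Aind]; split.
  by have [v ev] := submK hA Au; exists v => v0; apply: u0; rewrite -ev v0 linear0.
move=> N1 N2 h1 h2 hsum h12.
have hv (N : set (subm hA)) := @val_linear_on R V A hA N.
have inj0 (N : set (subm hA)) : submodule N -> val @` N `<=` [set 0] -> N = [set 0].
  move=> hN h; apply/seteqP; split=> w; last by move=> ->; exact: submod0.
  by move=> hw; apply: val_inj; rewrite linear0; apply: h; exists w.
have [||||h|h] := Aind (val @` N1) (val @` N2); [..|by left; exact: inj0|by right; exact: inj0].
- exact: submodule_image.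
- exact: submodule_image.
- apply/seteqP; split.
    move=> w /(submK hA)[v <-]; have [v1 [v2 [hv1 hv2 ->]]] := hsum v.
    by exists (val v1), (val v2); split; [exists v1|exists v2|exact: linearD].
  by move=> _ [_ [_ [[v1 _ <-] [v2 _ <-] ->]]]; apply: submodD => //; exact: submP.
- move=> _ [v1 hv1 <-] [v2 hv2 /val_inj e].
  have : (N1 `&` N2) v1 by split; rewrite // -e.
  by rewrite h12 => ->; rewrite linear0.
Qed.

Definition iso_label (V W : lmodType R) (A : set V) : Prop :=
  exists f : V -> W, [/\ linear_on A f, forall z, exists2 u, A u & f u = z &
    forall u, A u -> f u = 0 -> u = 0].

Lemma mod_iso_label (V W : lmodType R) (A : set V) (hA : submodule A) :
  mod_iso (subm hA) W -> iso_label W A.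
Proof.
move=> [f [g fK gK]].
have /choice[F hF] : forall v : V, exists z, forall u : subm hA, val u = v -> z = f u.
  move=> v; have [/(submK hA)[u <-]|nv] := pselect (A v).
    by exists (f u) => w /val_inj ->.
  by exists 0 => u e; case: nv; rewrite -e; exact: submP.
have FE u : F (val u) = f u by exact: hF.
exists F; split.
- move=> a _ _ /(submK hA)[u <-] /(submK hA)[v <-].
  have <- : val (a *: u + v) = a *: val u + val v by exact: linearP.
  by rewrite !FE linearP.
- by move=> z; exists (val (g z)); [exact: submP|rewrite FE gK].
- move=> _ /(submK hA)[u <-]; rewrite FE => e.
  by rewrite -(fK u) e -(linear0 f) fK linear0.
Qed.

Variables (c : nat) (L : 'I_c -> lmodType R).

(** Equal lists of labels give isomorphic modules, which is what the pigeonhole argument uses; a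
    module may admit several lists. *)
Inductive decomposes n : set 'rV[R]_n -> seq 'I_c -> Prop :=
| DecNil : decomposes [set 0] [::]
| DecCons A B i s : submodule A -> iso_label (L i) A -> decomposes B s ->
    (forall u, A u -> B u -> u = 0) -> decomposes (addS A B) (i :: s).

Lemma decomposes_submodule n (X : set 'rV_n) s : decomposes X s -> submodule X.
Proof.
elim=> [|A B i {}s hA _ _ hB _]; first exact: submodule_set0.
exact: submodule_addS.
Qed.

Lemma decomposes_cat n (X Y : set 'rV_n) s t : decomposes X s -> decomposes Y t ->
  (forall u, X u -> Y u -> u = 0) -> decomposes (addS X Y) (s ++ t).
Proof.
move=> hX hY; have sY := decomposes_submodule hY.
elim: hX => [|A B i {}s hA hl hB IH AB] XY.
  suff -> : addS [set 0] Y = Y by [].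
  apply/seteqP; split; last by apply: addSr; exact: submodule_set0.
  by apply: addS_min => // _ ->; exact: submod0.
have sB := decomposes_submodule hB.
rewrite -addSA /=; apply: DecCons => //.
  by apply: IH => u hu; apply: XY; exact: addSr.
move=> a ha [b [y [hb hy ea]]].
have y0 : y = 0.
  apply: XY => //; have -> : y = a - b by rewrite ea addrAC subrr add0r.
  by exists a, (- b); split=> //; exact: submodN.
by apply: AB => //; rewrite ea y0 addr0.
Qed.

Lemma decomposes_iso n n' (X : set 'rV_n) (X' : set 'rV_n') s :
  decomposes X s -> decomposes X' s -> iso_on X X'.
Proof.
move=> hX; elim: hX X' => [|A B i {}s hA [f [fl fs fi]] hB IH AB] X' hX'.
  inversion hX' as [e|]; subst; exists (fun=> 0); split=> //.
    by move=> a u v _ _; rewrite scaler0 addr0.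
  by apply/seteqP; split=> [_ [_ _ <-]|_ ->] //; exists 0.
inversion hX' as [|A' B' i' s' hA' [f' [fl' fs' fi']] hB' AB']; subst.
have [q [ql qs qi]] := IH _ hB'.
have sB := decomposes_submodule hB; have sB' := decomposes_submodule hB'.
have qB u : B u -> B' (q u) by move=> hu; rewrite -qs; exists u.
have /choice[g hg] : forall u, exists u', A u -> A' u' /\ f' u' = f u.
  by move=> u; have [u' ? ?] := fs' (f u); exists u'.
have f'inj u v : A' u -> A' v -> f' u = f' v -> u = v.
  move=> hu hv e; apply/eqP; rewrite -subr_eq0; apply/eqP; apply: fi'; first exact: submodB.
  by rewrite (linear_onB hA' fl') // e subrr.
have gl : linear_on A g.
  move=> a u v hu hv; have [h1 h2] := hg u hu; have [h3 h4] := hg v hv.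
  have [h5 h6] := hg _ (submodL a hA hu hv).
  apply: f'inj => //; first exact: submodL.
  by rewrite h6 fl' // h2 h4 fl.
have gi u : A u -> g u = 0 -> u = 0.
  move=> hu e; apply: fi => //; have [_ <-] := hg u hu.
  by rewrite e (linear_on0 hA' fl').
have /choice[ab hab] : forall u, exists p : 'rV[R]_n * 'rV[R]_n, addS A B u ->
    [/\ A p.1, B p.2 & u = p.1 + p.2].
  move=> u; have [[a [b [? ? ?]]]|nu] := pselect (addS A B u); first by exists (a, b).
  by exists (0, 0).
have abE a b : A a -> B b -> ab (a + b) = (a, b).
  move=> ha hb; have [|h1 h2 e] := hab (a + b); first by exists a, b.
  have e' : a - (ab (a + b)).1 = (ab (a + b)).2 - b.
    by apply/eqP; rewrite subr_eq addrAC eq_sym subr_eq addrC -e.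
  have z : a - (ab (a + b)).1 = 0.
    by apply: AB; [exact: submodB|rewrite e'; exact: submodB].
  have /eqP := z; rewrite subr_eq0 => /eqP ea.
  have /eqP := z; rewrite e' subr_eq0 => /eqP eb.
  by rewrite [LHS]surjective_pairing -ea eb.
have qE a b : A a -> B b -> (fun u => g (ab u).1 + q (ab u).2) (a + b) = g a + q b.
  by move=> ha hb /=; rewrite abE.
exists (fun u => g (ab u).1 + q (ab u).2); split.
- move=> t _ _ [a1 [b1 [h1 h2 ->]]] [a2 [b2 [h3 h4 ->]]].
  have -> : t *: (a1 + b1) + (a2 + b2) = (t *: a1 + a2) + (t *: b1 + b2).
    by rewrite scalerDr addrACA.
  rewrite !qE //; try exact: submodL.
  by rewrite gl // ql // scalerDr addrACA.
- apply/seteqP; split.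
    move=> _ [_ [a [b [ha hb ->]]] <-]; rewrite qE //.
    by exists (g a), (q b); split=> //; [case: (hg a ha)|exact: qB].
  move=> _ [a' [b' [ha' hb' ->]]].
  have [a ha ea] := fs (f' a').
  have [b hb eb] : (q @` B) b' by rewrite qs.
  exists (a + b); first by exists a, b.
  rewrite qE // eb; congr (_ + _); have [? e] := hg a ha.
  by apply: f'inj => //; rewrite e.
- move=> _ [a [b [ha hb ->]]]; rewrite qE // => e.
  have ga : A' (g a) by case: (hg a ha).
  have z : g a = 0.
    apply: AB' => //; have -> : g a = - q b by apply/eqP; rewrite -addr_eq0 e.
    by apply: submodN => //; exact: qB.
  have z' : q b = 0 by move: e; rewrite z add0r.
  by rewrite (gi a) // (qi b) // addr0.
Qed.

Variable m : set R.
Hypothesis hm : local_noeth m.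
Variables (ms : seq R).
Hypothesis mE : m = ideal_gen ms.

Lemma rowsin1 n (U : set 'rV[R]_n) : rowsin (k := 1) U = U.
Proof.
apply/seteqP; split=> u; first by move=> /(_ 0); rewrite row_id.
by move=> hu i; rewrite ord1 row_id.
Qed.

(** Presents the residue field by a one-row matrix, so that additivity of length applies to U/mU. *)
Lemma smul_mxact : exists l (B : 'M[R]_(1, l)), forall n (U : set 'rV[R]_n),
  submodule U -> mxact B U = smul ms U.
Proof.
have [l [B hB]] := mxact_augment (0 : 'M[R]_(1, 0)) ms.
exists l, B => n U hU; rewrite hB // rowsin1.
apply/seteqP; split; last by apply: addSr; exact: submodule_mxact.
apply: addS_min => //; first exact: submodule_smul.
by move=> _ [X _ <-]; rewrite mul0mx; apply: submod0; exact: submodule_smul.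
Qed.

Lemma nonzero_len n (U : set 'rV[R]_n) a : submodule U -> ~ U `<=` [set 0] ->
  len (smul ms U) U a -> (0 < a)%N.
Proof.
move=> hU nU [_]; apply; have [hR _ _ _] := hm.
have sU := submodule_smul ms hU.
apply: (chainS (@chain0 _ _ _ _ sU _)) => //; first exact: smul_sub.
move=> h; apply: nU; have [g hg] := mx_span R 1 n.
apply: (nakayama hm (xs := ms)).
- by apply: (noeth_sub (g := g) hR hU); rewrite hg.
- exact: submodule_set0.
- by move=> x hx; rewrite mE; exact: ideal_gen_in.
- by apply: subset_trans h _; apply: addSr; exact: submodule_set0.
Qed.

(** U/mU is killed by m, so its length is bounded by the number of generators; this will bound the
    number of indecomposable summands. *)
Lemma len_smul_ex n (U : set 'rV[R]_n) g : submodule U -> U = lin_span g ->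
  exists2 a, len (smul ms U) U a & (a <= size g)%N.
Proof.
move=> hU eU; have sU := submodule_smul ms hU.
have hl : lenle (smul ms U) U (size g).
  move=> k hk; apply: (lenle_span hm (A := smul ms U)) (chain_widen hk _ _) => //.
  - move=> u ug x; rewrite mE => hx.
    pose J : set R := [set z | smul ms U (z *: u)].
    have hJ : ideal J.
      apply/idealP; split; first by rewrite /J /= scale0r; exact: submod0.
      by move=> a y z h1 h2; rewrite /J /= scalerDl -scalerA; exact: submodL.
    apply: (ideal_gen_min hJ) hx => y hy; apply: smul_in => //.
    by rewrite eU; exact: lin_span_in.
  - by apply: submodule_addS => //; exact: submodule_span.
  - by rewrite {1}eU; exact: addSr.
have [a ha] := len_ex hU (@smul_sub _ _ ms _ hU) hl.
by exists a => //; case: ha => h _; exact: hl.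
Qed.

(* [P] is a property of modules inherited by summands, such as being MCM. *)
Lemma decomposition (P : forall n, set 'rV[R]_n -> Prop) n (X : set 'rV[R]_n) a :
  (forall n (A B : set 'rV[R]_n), submodule A -> submodule B ->
    (forall u, A u -> B u -> u = 0) -> P n (addS A B) -> P n A) ->
  (forall n (A : set 'rV[R]_n), submodule A -> indec A -> P n A ->
    exists i, iso_label (L i) A) ->
  submodule X -> P n X -> len (smul ms X) X a ->
  exists2 s, (size s <= a)%N & decomposes X s.
Proof.
(* Induction on the length of X/mX: it is additive on direct sums and positive on nonzero modules,
   so both parts of a proper decomposition are smaller. *)
move=> Psum Plab; elim/ltn_ind: a X => a IH X hX PX ha.
have [X0|X0] := pselect (X `<=` [set 0]).
  exists [::] => //; have -> : X = [set 0]; last exact: DecNil.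
  by apply/seteqP; split=> // _ ->; exact: submod0.
have a0 := nonzero_len hX X0 ha.
have [Xi|nXi] := pselect (indec X).
  have [i hi] := Plab _ _ hX Xi PX.
  exists [:: i] => //.
  have -> : X = addS X [set 0].
    apply/seteqP; split; first by apply: addSl; exact: submodule_set0.
    by apply: addS_min => // _ ->; exact: submod0.
  by apply: DecCons => //; exact: DecNil.
have [N1 [N2 [h1 h2 eX [N12 n1 n2]]]] : exists N1 N2, [/\ submodule N1, submodule N2,
    X = addS N1 N2 & [/\ forall u, N1 u -> N2 u -> u = 0,
      ~ N1 `<=` [set 0] & ~ N2 `<=` [set 0]]].
  apply: contrapT => nex; apply: nXi; split.
    apply: contrapT => nu; apply: X0 => u hu /=; apply: contrapT => u0.
    by apply: nu; exists u.
  move=> N1 N2 h1 h2 eX N12; apply: contrapT => /not_orP[n1 n2].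
  by apply: nex; exists N1, N2.
have [hR _ _ _] := hm; have [g hg] := mx_span R 1 n.
have lenN (N : set 'rV_n) : submodule N -> exists b, len (smul ms N) N b.
  move=> hN; have [k ek] : fgs N by apply: (noeth_sub (g := g) hR hN); rewrite hg.
  by have [b hb _] := len_smul_ex hN ek; exists b.
have [b1 hb1] := lenN _ h1; have [b2 hb2] := lenN _ h2.
have eab : a = (b1 + b2)%N.
  have [l [B hB]] := smul_mxact.
  apply: len_uniq ha _; rewrite eX.
  have := @len_dsum _ _ N1 N2 _ _ B b1 b2 h1 h2 N12.
  rewrite !rowsin1 !hB //; last exact: submodule_addS.
  exact.
have p1 := nonzero_len h1 n1 hb1; have p2 := nonzero_len h2 n2 hb2.
have [||s1 l1 d1] := IH b1 _ N1 h1 _ hb1.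
- by rewrite eab -addn1 leq_add2l.
- by apply: (Psum _ N1 N2) => //; rewrite -eX.
have [||s2 l2 d2] := IH b2 _ N2 h2 _ hb2.
- by rewrite eab -add1n leq_add2r.
- apply: (Psum _ N2 N1) => //; first by move=> u ? ?; exact: N12.
  suff -> : addS N2 N1 = X by [].
  by rewrite eX; apply/seteqP; split=> _ [u [v [? ? ->]]]; exists v, u; rewrite addrC.
exists (s1 ++ s2); first by rewrite size_cat eab leq_add.
by rewrite eX; exact: decomposes_cat.
Qed.

End Decomposition.

(** * Extensions of finite Cohen-Macaulay type *)

(** The kernels of the iterates of [phi] stabilise, say from k on; write an element of the kernel of
    [phi] as a k-th iterate. *)
Lemma surjective_injective (R : comNzRingType) (V : lmodType R) (N : set V) g (phi : V -> V) :
  noetherian R -> submodule N -> N `<=` lin_span g -> linear_on N phi ->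
  phi @` N = N -> forall u, N u -> phi u = 0 -> u = 0.
Proof.
move=> hR hN Ng hl hs.
have phiN u : N u -> N (phi u) by move=> hu; rewrite -hs; exists u.
have itN j u : N u -> N (iter j phi u) by move=> hu; elim: j => //= j; exact: phiN.
pose c j : set V := [set u | N u /\ iter j phi u = 0].
have [|||k hk] := @noeth_acc _ _ c g hR.
- elim=> [|j IH]; apply/submoduleP; split.
  + by split=> //; exact: submod0.
  + by move=> a u v [h1 h2] [h3 h4]; split; [exact: submodL|rewrite /= in h2 h4 *;
      rewrite h2 h4 scaler0 addr0].
  + split; first exact: submod0.
    by rewrite iterSr (linear_on0 hN hl); case: (submod0 IH).
  + move=> a u v [h1 h2] [h3 h4]; split; first exact: submodL.
    rewrite iterSr hl //; rewrite !iterSr in h2 h4.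
    have i1 : c j (phi u) by split=> //; exact: phiN.
    have i2 : c j (phi v) by split=> //; exact: phiN.
    by case: (submodL a IH i1 i2).
- by move=> j u [/Ng].
- by move=> j u [h1 h2]; split=> //=; rewrite h2 (linear_on0 hN hl).
have its j u : N u -> exists2 w, N w & iter j phi w = u.
  elim: j u => [|j IH] u hu; first by exists u.
  have [w hw ew] : (phi @` N) u by rewrite hs.
  have [v hv ev] := IH w hw.
  by exists v => //=; rewrite ev.
move=> u hu e; have [w hw ew] := its k u hu.
have [_] : c k w by apply: (hk k.+1); split=> //=; rewrite ew.
by rewrite ew.
Qed.

Section Extensions.
Variables (R : comNzRingType) (m : set R).
Hypothesis hm : local_noeth m.
Variables (n p l : nat) (D : 'M[R]_(n, p)) (B : 'M[R]_(l, n)).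
Hypothesis BE : forall u : 'rV_n, u *m D = 0 <-> exists c, u = c *m B.

Local Notation N := [set u : 'rV[R]_n | u *m D = 0].

(* The middle term of s times the class of 0 -> ker D -> R^n -> im D -> 0: it is
   the pushout of R^n along s : ker D -> ker D, embedded in R^n + R^p. *)
Definition pushout (s : R) : set 'rV[R]_(n + p) :=
  [set w | exists f v : 'rV_n, v *m D = 0 /\ w = row_mx (s *: f + v) (f *m D)].

Lemma submodule_kermx : submodule N.
Proof.
apply/submoduleP; split=> [|a u v hu hv] /=; first exact: mul0mx.
by rewrite mulmxDl -scalemxAl hu hv scaler0 addr0.
Qed.

Lemma submodule_pushout s : submodule (pushout s).
Proof.
apply/submoduleP; split.
  by exists 0, 0; rewrite mul0mx scaler0 addr0 row_mx0.
move=> a _ _ [f [v [hv ->]]] [f' [v' [hv' ->]]].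
exists (a *: f + f'), (a *: v + v'); split; first exact: (submodL a submodule_kermx).
rewrite scale_row_mx add_row_mx mulmxDl -scalemxAl; congr row_mx.
by rewrite !scalerDr !scalerA addrACA mulrC.
Qed.

Lemma pushoutP s y z : pushout s (row_mx y z) <->
  exists f v : 'rV_n, [/\ v *m D = 0, y = s *: f + v & z = f *m D].
Proof.
split=> [[f [v [hv /eq_row_mx[-> ->]]]]|[f [v [hv -> ->]]]]; first by exists f, v.
by exists f, v.
Qed.

Lemma pushout0P s y : pushout s (row_mx y 0) <-> y *m D = 0.
Proof.
split=> [/pushoutP[f [v [hv -> e]]]|hy].
  by rewrite mulmxDl -scalemxAl -e hv scaler0 addr0.
by apply/pushoutP; exists 0, y; rewrite scaler0 add0r mul0mx.
Qed.

(** The images of the basis of R^n and the rows of [B] generate. Their number is the same for all s,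
    which bounds all the lists of labels at once. *)
Lemma pushout_gens s : exists2 g, pushout s = lin_span g & size g = (n + l)%N.
Proof.
pose G := codom (fun i : 'I_n => row_mx (s *: delta_mx 0 i) (row i D)) ++
  codom (fun i : 'I_l => row_mx (row i B) 0) : seq 'rV[R]_(n + p).
exists G; last by rewrite size_cat !size_codom !card_ord.
have sG := submodule_span G.
apply/seteqP; split.
  move=> _ [f [v [/BE[c ->] ->]]].
  have -> : row_mx (s *: f + c *m B) (f *m D) =
      \sum_i f 0 i *: row_mx (s *: delta_mx 0 i) (row i D) +
      \sum_i c 0 i *: (row_mx (row i B) 0 : 'rV_(n + p)).
    rewrite (mulmx_sum_row f D) (mulmx_sum_row c B) {1}[f]row_sum_delta scaler_sumr.
    have lin k (h : 'I_k -> R) (F1 : 'I_k -> 'rV[R]_n) (F2 : 'I_k -> 'rV[R]_p) :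
        \sum_i h i *: row_mx (F1 i) (F2 i) = row_mx (\sum_i h i *: F1 i) (\sum_i h i *: F2 i).
      elim/big_rec3: _ => [|i y1 y2 y3 _ ->]; first by rewrite row_mx0.
      by rewrite scale_row_mx add_row_mx.
    rewrite !lin add_row_mx; congr row_mx.
      by congr (_ + _); apply: eq_bigr => i _; rewrite !scalerA mulrC.
    by rewrite [X in _ = _ + X]big1 ?addr0 // => i _; rewrite scaler0.
  apply: submodD => //; apply: submod_sum => // i _; apply: submodZ => //;
    apply: lin_span_in; rewrite mem_cat; apply/orP; [left|right].
    exact: (codom_f (fun i : 'I_n => row_mx (s *: delta_mx 0 i) (row i D))).
  exact: (codom_f (fun i : 'I_l => row_mx (row i B) 0 : 'rV[R]_(n + p))).
apply: lin_span_min; first exact: submodule_pushout.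
move=> u; rewrite mem_cat => /orP[] /codomP[i ->].
  by apply/pushoutP; exists (delta_mx 0 i), 0; rewrite mul0mx addr0 -rowE.
by apply/pushout0P/BE; exists (delta_mx 0 i); rewrite -rowE.
Qed.

Lemma kermx_gens : exists g, N = lin_span g.
Proof.
have [hR _ _ _] := hm; have [g hg] := mx_span R 1 n.
by apply: (noeth_sub (g := g) hR submodule_kermx); rewrite hg.
Qed.

(* By Miyata's theorem ker D splits off pushout s (+) ker D, with quotient
   pushout (s * t); the retraction restricts to 1 + t g on ker D, which is
   invertible since t lies in m. *)
Lemma pushout_iso_split s t : m t -> iso_on (pushout s) (pushout (s * t)) ->
  exists C : 'M_(n, l), B *m C *m B = s *: B.
Proof.
move=> mt [th [thl ths thi]]; have [hR im m1 munit] := hm.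
have sN := submodule_kermx; have sX := submodule_pushout s.
pose a := (n + p + n)%N.
pose lw (y : 'rV[R]_a) : 'rV[R]_(n + p) := lsubmx y.
pose rv (y : 'rV[R]_a) : 'rV[R]_n := rsubmx y.
(* The second pushout is itself the pushout of the first along t; [q] is the resulting map from
   pushout s (+) ker D. Its kernel consists of the elements ((v, 0), -tv) with v in ker D,
   parametrised by [kk]. *)
pose q (y : 'rV[R]_a) : 'rV[R]_(n + p) :=
  row_mx (t *: lsubmx (lw y) + rv y) (rsubmx (lw y)).
have lwl c u v : lw (c *: u + v) = c *: lw u + lw v by exact: linearP.
have rvl c u v : rv (c *: u + v) = c *: rv u + rv v by exact: linearP.
have ql c u v : q (c *: u + v) = c *: q u + q v.
  rewrite /q lwl rvl !linearP /= scale_row_mx add_row_mx; congr row_mx.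
  by rewrite scalerDr addrACA.
pose Y : set 'rV[R]_a := [set y | pushout s (lw y) /\ N (rv y)].
pose U1 : set 'rV[R]_a := [set y | pushout s (lw y) /\ rv y = 0].
pose U2 : set 'rV[R]_a := [set y | lw y = 0 /\ N (rv y)].
have lw0 : lw 0 = 0 by exact: linear0.
have rv0 : rv 0 = 0 by exact: linear0.
have sY : submodule Y.
  apply/submoduleP; split; first by rewrite /Y /= lw0 rv0; split;
    [exact: submod0|exact: (submod0 sN)].
  by move=> c u v [h1 h2] [h3 h4]; split; rewrite ?lwl ?rvl;
    [exact: submodL|exact: (submodL c sN h2 h4)].
have s1 : submodule U1.
  apply/submoduleP; split; first by rewrite /U1 /= lw0 rv0; split=> //; exact: submod0.
  by move=> c u v [h1 h2] [h3 h4]; split; rewrite ?lwl ?rvl;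
    [exact: submodL|rewrite h2 h4 scaler0 addr0].
have s2 : submodule U2.
  apply/submoduleP; split; first by rewrite /U2 /= lw0 rv0; split=> //; exact: (submod0 sN).
  by move=> c u v [h1 h2] [h3 h4]; split; rewrite ?lwl ?rvl;
    [rewrite h1 h3 scaler0 addr0|exact: (submodL c sN h2 h4)].
have lwE x y : lw (row_mx x y) = x by exact: row_mxKl.
have rvE x y : rv (row_mx x y) = y by exact: row_mxKr.
have yE y : y = row_mx (lw y) (rv y) by rewrite hsubmxK.
have YE : Y = addS U1 U2.
  apply/seteqP; split.
    move=> y [h1 h2]; exists (row_mx (lw y) 0), (row_mx 0 (rv y)).
    by rewrite /U1 /U2 /= !lwE !rvE add_row_mx addr0 add0r -yE.
  move=> _ [u [v [[h1 h2] [h3 h4] ->]]].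
  have lwD : lw (u + v) = lw u + lw v by exact: linearD.
  have rvD : rv (u + v) = rv u + rv v by exact: linearD.
  by split; rewrite ?lwD ?rvD ?h2 ?h3 ?addr0 ?add0r.
have U12 u : U1 u -> U2 u -> u = 0.
  by move=> [_ h1] [h2 _]; rewrite (yE u) h1 h2 row_mx0.
have qY : q @` Y = pushout (s * t).
  apply/seteqP; split.
    move=> _ [y [[f [v [hv e]]] hr] <-]; apply/pushoutP.
    exists f, (t *: v + rv y); rewrite e row_mxKl row_mxKr; split=> //.
      exact: (submodL t sN hv hr).
    by rewrite scalerDr scalerA mulrC addrA.
  move=> _ [f [v [hv ->]]].
  exists (row_mx (row_mx (s *: f) (f *m D)) v).
    split; rewrite ?lwE ?rvE //; apply/pushoutP; exists f, 0.
    by rewrite mul0mx addr0.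
  by rewrite /q lwE rvE row_mxKl row_mxKr scalerA mulrC.
have i1 : iso_on U1 (q @` Y).
  rewrite qY; exists (th \o lw); split.
  - by move=> c u v [h1 _] [h2 _] /=; rewrite lwl thl.
  - rewrite -ths; apply/seteqP; split.
      by move=> _ [u [h1 _] <-]; exists (lw u).
    by move=> _ [w hw <-]; exists (row_mx w 0); rewrite /= ?lwE //; split; rewrite ?lwE ?rvE.
  - by move=> u [h1 h2] /= /thi h; rewrite (yE u) h2 h // row_mx0.
pose kk (v : 'rV[R]_n) : 'rV[R]_a := row_mx (row_mx v 0) (- (t *: v)).
have i2 : iso_on U2 (Y `&` q @^-1` [set 0]).
  exists (kk \o rv); split.
  - move=> c u v _ _; rewrite /= /kk rvl !scale_row_mx !add_row_mx; congr row_mx.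
      by rewrite scaler0 addr0.
    by rewrite scalerDr opprD scalerN !scalerA (mulrC t).
  - apply/seteqP; split.
      move=> _ [u [h1 h2] <-] /=; split; first split; rewrite /= ?lwE ?rvE.
      + exact/pushout0P.
      + by apply: (submodN sN); exact: (submodZ t sN h2).
      + by rewrite /preimage /= /q lwE rvE row_mxKl row_mxKr subrr row_mx0.
    move=> y [[h1 h2]]; rewrite /preimage /= /q -[X in _ = X]row_mx0 => /eq_row_mx[e1 e2].
    have e : lw y = row_mx (lsubmx (lw y)) 0 by rewrite -[LHS]hsubmxK e2.
    have hl : N (lsubmx (lw y)) by apply/(pushout0P s); rewrite -e.
    exists (row_mx 0 (lsubmx (lw y))); first by split; rewrite ?lwE ?rvE.
    rewrite /= rvE /kk [RHS]yE -e; congr row_mx.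
    by apply/eqP; rewrite eq_sym -addr_eq0 addrC e1.
  - move=> u [h1 h2] /=; rewrite /kk -[X in _ = X]row_mx0 => /eq_row_mx[].
    rewrite -[X in _ = X]row_mx0 => /eq_row_mx[e _] _.
    by rewrite (yE u) h1 e row_mx0.
have [ms mE] := ideal_gens hm.
have hq : linear_on Y q by move=> c u v _ _; exact: ql.
have [rho [rl rK rid]] := dsum_retraction hm mE sY hq s1 s2 YE U12 i1 i2.
pose pr (y : 'rV[R]_a) : 'rV[R]_n := lsubmx (lw y).
have prl c u v : pr (c *: u + v) = c *: pr u + pr v by rewrite /pr lwl linearP.
have prN y : (Y `&` q @^-1` [set 0]) y -> N (pr y).
  move=> [[h1 h2]]; rewrite /preimage /= /q -[X in _ = X]row_mx0 => /eq_row_mx[e1 e2].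
  by apply/(pushout0P s); rewrite /pr -e2 hsubmxK.
pose F (w : 'rV[R]_(n + p)) := pr (rho (row_mx w 0)).
have YF w : pushout s w -> Y (row_mx w 0).
  by move=> hw; split; rewrite ?lwE ?rvE //; exact: (submod0 sN).
have Fl : linear_on (pushout s) F.
  move=> c u v hu hv; rewrite /F -prl -rl; [|exact: YF|exact: YF].
  by rewrite scale_row_mx add_row_mx scaler0 addr0.
have FN w : pushout s w -> N (F w) by move=> hw; apply: prN; apply: rK; exact: YF.
pose phi v := F (row_mx v 0).
have Xv v : N v -> pushout s (row_mx v 0) by move=> hv; exact/pushout0P.
have phil : linear_on N phi.
  move=> c u v hu hv; rewrite /phi -Fl; [|exact: Xv|exact: Xv].
  by rewrite scale_row_mx add_row_mx scaler0 addr0.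
have phiN v : N v -> N (phi v) by move=> hv; apply: FN; exact: Xv.
have Y2 v : N v -> Y (row_mx 0 v).
  by move=> hv; split; rewrite ?lwE ?rvE //; exact: submod0.
(* The retraction fixes [kk v] = ((v, 0), 0) - t (0, v); this is the [pr] component of that
   equation. *)
have phiE v : N v -> phi v = v + t *: pr (rho (row_mx 0 v)).
  move=> hv.
  have hk : (Y `&` q @^-1` [set 0]) (kk v).
    split; first by split; rewrite /kk ?lwE ?rvE; [exact: Xv|apply: (submodN sN);
      exact: (submodZ t sN hv)].
    by rewrite /preimage /= /q lwE rvE row_mxKl row_mxKr subrr row_mx0.
  have ek : kk v = (- t) *: row_mx 0 v + row_mx (row_mx v 0) 0.
    by rewrite scale_row_mx add_row_mx scaler0 add0r addr0 scaleNr.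
  have := rid _ hk; rewrite {1}ek rl; [|exact: Y2|exact: YF (Xv _ hv)].
  move=> /(congr1 pr); rewrite prl -/(F _) -/(phi v) => e.
  rewrite [pr (kk v)](_ : _ = v) in e; last by rewrite /pr /kk lwE row_mxKl.
  by apply/eqP; rewrite -subr_eq -scaleNr addrC e.
have [gN eN] := kermx_gens.
have Nsub : N `<=` phi @` N.
  apply: (nakayama hm (xs := [:: t])).
  - by exists gN.
  - exact: submodule_image.
  - by move=> x /[1!inE] /eqP ->.
  - move=> v hv; exists (phi v), (- (t *: pr (rho (row_mx 0 v)))); split.
    + by exists v.
    + rewrite -scaleNr scaleNr -scalerN; apply: smul_in => //; first by rewrite inE.
      by apply: (submodN sN); apply: prN; apply: rK; exact: Y2.
    + by rewrite phiE // addrK.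
have phis : phi @` N = N by apply/seteqP; split=> // _ [v hv <-]; exact: phiN.
have phii : forall v, N v -> phi v = 0 -> v = 0.
  by apply: (surjective_injective hR sN _ phil phis (g := gN)); rewrite -eN.
have /choice[h hh] : forall w, exists v, N w -> N v /\ phi v = w.
  move=> w; have [hw|nw] := pselect (N w); last by exists 0.
  by have [v ? ?] := Nsub _ hw; exists v.
have phinj u v : N u -> N v -> phi u = phi v -> u = v.
  move=> hu hv e; apply/eqP; rewrite -subr_eq0; apply/eqP; apply: phii;
    first exact: (submodB sN hu hv).
  by rewrite (linear_onB sN phil) // e subrr.
have hl : linear_on N h.
  move=> c u v hu hv; have [h1 e1] := hh _ hu; have [h2 e2] := hh _ hv.
  have [h3 e3] := hh _ (submodL c sN hu hv).
  apply: phinj => //; first exact: (submodL c sN h1 h2).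
  by rewrite e3 phil // e1 e2.
(* [h] inverts [phi] on ker D, so [Phi] is a map R^n -> ker D that restricts to multiplication by s
   on ker D. Lifting the images of the basis through [B] turns it into the matrix C B. *)
pose Phi (f : 'rV[R]_n) := h (F (row_mx (s *: f) (f *m D))).
have XPhi f : pushout s (row_mx (s *: f) (f *m D)).
  by apply/pushoutP; exists f, 0; rewrite mul0mx addr0.
have Phil c u v : Phi (c *: u + v) = c *: Phi u + Phi v.
  rewrite /Phi -hl; [|exact: FN|exact: FN]; rewrite -Fl //; congr (h (F _)).
  rewrite scale_row_mx add_row_mx mulmxDl -scalemxAl; congr row_mx.
  by rewrite scalerDr !scalerA mulrC.
have PhiN f : N (Phi f) by case: (hh _ (FN _ (XPhi f))).
have Phiv v : N v -> Phi v = s *: v.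
  move=> hv; apply: phinj; [exact: PhiN|exact: (submodZ s sN hv)|].
  rewrite /Phi (proj2 (hh _ (FN _ (XPhi v)))) /phi; congr F; congr row_mx; exact: hv.
have /choice[cc hcc] : forall i : 'I_n, exists c, Phi (delta_mx 0 i) = c *m B.
  by move=> i; apply/BE; exact: PhiN.
exists (\matrix_i cc i).
have PhiE f : Phi f = f *m ((\matrix_i cc i) *m B).
  have PhiL : linear_on setT Phi by move=> c u v _ _; exact: Phil.
  rewrite {1}[f]row_sum_delta (linear_on_sum (@submodule_setT _ _) PhiL) // mulmx_sum_row.
  by apply: eq_bigr => i _; rewrite hcc row_mul rowK.
apply/row_matrixP => i; rewrite -mulmxA row_mul -PhiE linearZ /= Phiv //.
by apply/BE; exists (delta_mx 0 i); rewrite -rowE.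
Qed.

(** For every s the pushout is an extension of im D by ker D. *)
Lemma pushout_wreg xs s : wreg xs N -> wreg xs [set u *m D | u in [set: 'rV[R]_n]] ->
  wreg xs (pushout s).
Proof.
move=> hN hM; have sN := submodule_kermx; have sX := submodule_pushout s.
have ql U : linear_on U (rsubmx : 'rV[R]_(n + p) -> 'rV_p) by move=> a u v _ _; exact: linearP.
apply: (wreg_extension sX (ql _)).
  have -> : pushout s `&` rsubmx @^-1` [set 0] = (fun v => row_mx v 0) @` N.
    apply/seteqP; split.
      move=> w [hw]; rewrite /preimage /= => e; exists (lsubmx w).
        by apply/(pushout0P s); rewrite -e hsubmxK.
      by rewrite -e hsubmxK.
    move=> _ [v hv <-]; split; first exact/pushout0P.
    by rewrite /preimage /= row_mxKr.
  apply: (proj1 (wreg_image xs sN _ _)) hN.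
    by move=> a u v _ _; rewrite scale_row_mx add_row_mx scaler0 addr0.
  by move=> u _; rewrite -[X in _ = X]row_mx0 => /eq_row_mx[].
suff -> : (rsubmx : 'rV[R]_(n + p) -> 'rV_p) @` pushout s =
    [set u *m D | u in [set: 'rV[R]_n]] by [].
apply/seteqP; split.
  by move=> _ [_ [f [v [_ ->]]] <-]; rewrite row_mxKr; exists f.
move=> _ [f _ <-]; exists (row_mx (s *: f + 0) (f *m D)); last by rewrite row_mxKr.
by exists f, 0; rewrite mul0mx.
Qed.

Lemma finite_type_split xs r : krull_dim R (size xs) -> {in xs, forall x, m x} ->
  finite_cm_type m -> wreg xs N -> wreg xs [set u *m D | u in [set: 'rV[R]_n]] ->
  m r -> exists j (C : 'M_(n, l)), B *m C *m B = r ^+ j *: B.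
Proof.
move=> hd mx [c [L hL]] hN hM mr.
have [ms mE] := ideal_gens hm.
have lab k (A : set 'rV[R]_k) : submodule A -> indec A -> wreg xs A ->
    exists i, iso_label (L i) A.
  move=> hA iA wA; have [g hg] := mx_span R 1 k.
  have [i hi] : exists i, mod_iso (subm hA) (L i).
    apply: hL; last exact: indec_subm.
    by apply: (subm_mcm hm hA hd mx wA (g := g)); [rewrite hg|case: iA].
  by exists i; exact: mod_iso_label hi.
(* Lists of labels of length at most n + l form a finite type, whatever the exponent j. *)
have types j : exists s : {bseq (n + l) of 'I_c}, decomposes L (pushout (r ^+ j)) s.
  have [g eg sg] := pushout_gens (r ^+ j).
  have sX := submodule_pushout (r ^+ j).
  have [a ha la] := len_smul_ex hm mE sX eg.
  have [||s ls ds] := @decomposition R c L m hm ms mE (fun k A => wreg xs A) _ _ a _ lab sX _ ha.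
  - by move=> k A A' h1 h2 h3; exact: wreg_summand.
  - exact: pushout_wreg.
  have hs : (size s <= n + l)%N by rewrite (leq_trans ls) // -sg.
  by exists (Bseq hs).
have /choice[f hf] := types.
have [i [j [ij e]]] : exists i j, (i < j)%N /\ f i = f j.
  apply: contrapT => nex.
  have inj : injective (fun i : 'I_#|{bseq (n + l) of 'I_c}|.+1 => f i).
    move=> i j /= e; apply/val_inj/eqP; apply: contrapT => /negP; rewrite neq_ltn => /orP[] h.
      by apply: nex; exists i, j.
    by apply: nex; exists j, i.
  by have := leq_card _ inj; rewrite card_ord ltnn.
have [||C hC] := @pushout_iso_split (r ^+ i) (r ^+ (j - i)).
- have [_ im _ _] := hm; rewrite -(subnSK ij) exprS.
  exact: ideal_mulr.
- rewrite -exprD subnKC ?(ltnW ij) //; apply: decomposes_iso (hf i) _.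
  by rewrite e.
by exists i, C.
Qed.

End Extensions.

(** * Quotients and localizations *)

Section QuotientRing.
Variables (R : comNzRingType) (I : set R) (hI : ideal I) (I1 : ~ I 1).

(** The two proofs are phantom arguments from which instance inference recovers the ideal
    structure. *)
Definition ideal_mem of ideal I & ~ I 1 : pred R := fun x => x \in I.

Lemma ideal_mem_closed : idealr_closed (ideal_mem hI I1).
Proof.
split; first by apply/mem_set; exact: ideal0.
  by apply/negP => /set_mem.
move=> a x y /set_mem hx /set_mem hy; apply/mem_set.
by apply: idealD => //; exact: ideal_mull.
Qed.

HB.instance Definition _ := isIdealr.Build R (ideal_mem hI I1) ideal_mem_closed.

End QuotientRing.

Definition is_quotient (R Q : comNzRingType) (I : set R) (f : {rmorphism R -> Q}) : Prop :=
  (forall y, exists x, y = f x) /\ forall x, f x = 0 <-> I x.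

Lemma quotient_ring (R : comNzRingType) (I : set R) : ideal I -> ~ I 1 ->
  exists (Q : comNzRingType) (f : {rmorphism R -> Q}), is_quotient I f.
Proof.
move=> hI I1; pose J : idealr R := ideal_mem hI I1.
exists {ideal_quot J}, (\pi_{ideal_quot J} : {rmorphism _ -> _}); split.
  by move=> y; exists (repr y); exact: (esym (reprK y)).
move=> x; split=> [|Ix].
  rewrite -(rmorph0 (\pi_{ideal_quot J})) => /eqP.
  by rewrite -Quotient.idealrBE subr0 => /set_mem.
rewrite -(rmorph0 (\pi_{ideal_quot J})); apply/eqP.
by rewrite -Quotient.idealrBE subr0; exact/mem_set.
Qed.

(** Units, fractions and kernel characterise the map R -> R_p, so later proofs never open the type
    of fractions. *)
Definition is_localization (R S : comNzRingType) (p : set R) (f : {rmorphism R -> S}) : Prop :=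
  [/\ forall s, ~ p s -> exists u, u * f s = 1,
      forall y, exists a s, ~ p s /\ y * f s = f a &
      forall a, f a = 0 <-> exists2 s, ~ p s & s * a = 0].

Section LocalizationMap.
Variables (R : comNzRingType) (p : set R) (hp : prime_ideal p).
Let q := PrimePt hp.

Definition loc_map (a : R) : localization hp :=
  \pi_(loc_type q) (loc_mk (q := q) a (compl1 q)).

Lemma loc_map_zmod : zmod_morphism loc_map.
Proof.
move=> a b; rewrite /loc_map.
have -> : - \pi_(loc_type q) (loc_mk b (compl1 q)) = loc_opp (\pi_(loc_type q) (loc_mk b (compl1 q))) by [].
rewrite -loc_pi_opp.
have -> : forall x y : loc_type q, (x : localization hp) + y = loc_add x y by [].
rewrite -loc_pi_add; apply: loc_pi_eq1.
by rewrite /loc_addf /loc_oppf /loc_mk /loc_num /loc_den /=; ring.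
Qed.

Lemma loc_map_monoid : monoid_morphism loc_map.
Proof.
split=> // a b; rewrite /loc_map.
have -> : forall x y : loc_type q, (x : localization hp) * y = loc_mul x y by [].
rewrite -loc_pi_mul; apply: loc_pi_eq1.
by rewrite /loc_mulf /loc_mk /loc_num /loc_den /=; ring.
Qed.

HB.instance Definition _ := GRing.isZmodMorphism.Build R (localization hp) loc_map loc_map_zmod.
HB.instance Definition _ := GRing.isMonoidMorphism.Build R (localization hp) loc_map loc_map_monoid.

Lemma loc_mapP : is_localization p (loc_map : {rmorphism R -> localization hp}).
Proof.
have mulE (x y : loc_type q) : (x : localization hp) * y = loc_mul x y by [].
have oneE : (1 : localization hp) = \pi_(loc_type q) (loc_mk 1 (compl1 q)) by [].
have notin s : ~ p s -> s \notin p by move=> ns; apply/negP => /set_mem.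
split.
- move=> s /notin ns; exists (\pi_(loc_type q) (@loc_mk R q 1 s ns)).
  rewrite /= /loc_map mulE -loc_pi_mul oneE; apply: loc_pi_eq1.
  by rewrite /loc_mulf /loc_mk /loc_num /loc_den /=; ring.
- elim/quotW => -[[a s] hs]; exists a, s; split; first by move: hs => /= /negP h /mem_set.
  rewrite /= /loc_map mulE -loc_pi_mul; apply: loc_pi_eq1.
  by rewrite /loc_mulf /loc_mk /loc_num /loc_den /=; ring.
- move=> a; rewrite -(rmorph0 (loc_map : {rmorphism R -> localization hp})) /= /loc_map.
  split=> [/eqmodP /asboolP[u up]|[s ns e]].
    rewrite /loc_num /loc_den /= !mulr1 mulr0 => e.
    by exists u => // /mem_set; exact/negP.
  apply/loc_pi_eq/asboolP; exists s; first exact: notin.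
  by rewrite /loc_num /loc_den /= !mulr1 mulr0.
Qed.

End LocalizationMap.

Section RingMaps.
Variables (R S : comNzRingType) (f : {rmorphism R -> S}).

Lemma ideal_preimage (J : set S) : ideal J -> ideal (f @^-1` J).
Proof.
move=> hJ; apply/idealP; split; first by rewrite /preimage /= rmorph0; exact: ideal0.
by move=> a x y hx hy; rewrite /preimage /= rmorphD rmorphM; apply: idealD => //;
  exact: ideal_mull.
Qed.

Lemma prime_preimage (J : set S) : prime_ideal J -> prime_ideal (f @^-1` J).
Proof.
move=> /prime_idealP[hJ J1 JM]; apply/prime_idealP; split.
- exact: ideal_preimage.
- by rewrite /preimage /= rmorph1.
- by move=> x y; rewrite /preimage /= rmorphM; exact: JM.
Qed.

Lemma ideal_gen_map xs x : ideal_gen xs x -> ideal_gen (map f xs) (f x).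
Proof.
elim: xs x => [|y xs IH] x /=.
  by move=> /ideal_gen_nil->; rewrite rmorph0; apply/ideal_gen_nil.
move=> /ideal_gen_cons[a [v [/IH hv ->]]]; apply/ideal_gen_cons.
by exists (f a), (f v); rewrite rmorphD rmorphM.
Qed.

Section Quotient.
Variables (I : set R) (fq : is_quotient I f).

Lemma quotient_eq x y : f x = f y <-> I (x - y).
Proof.
have [_ f0] := fq; rewrite -f0 rmorphB; split=> [->|/eqP]; first by rewrite subrr.
by rewrite subr_eq0 => /eqP.
Qed.

Lemma quotient_noetherian : noetherian R -> noetherian S.
Proof.
move=> hR J hJ; have [fs f0] := fq.
have [xs e] := hR _ (ideal_preimage hJ).
exists (map f xs); apply/seteqP; split.
  by move=> y hy; have [x ex] := fs y; rewrite ex; apply: ideal_gen_map;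
    rewrite -e /preimage /= -ex.
apply: ideal_gen_min => // y /mapP[x hx ->].
by have /= : (f @^-1` J) x by rewrite e; exact: ideal_gen_in.
Qed.

Lemma ideal_image (P : set R) : ideal P -> ideal (f @` P).
Proof.
move=> hP; have [fs f0] := fq; apply/idealP; split.
  by exists 0; [exact: ideal0|exact: rmorph0].
move=> a _ _ [x hx <-] [y hy <-]; have [b ->] := fs a.
by exists (b * x + y); [apply: idealD => //; exact: ideal_mull|rewrite rmorphD rmorphM].
Qed.

Lemma quotient_image_mem (P : set R) x : ideal P -> I `<=` P -> (f @` P) (f x) <-> P x.
Proof.
move=> hP IP; split=> [[y hy /esym/quotient_eq/IP h]|hx]; last by exists x.
by rewrite -(subrK y x); exact: idealD.
Qed.

Lemma prime_image (P : set R) : prime_ideal P -> I `<=` P -> prime_ideal (f @` P).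
Proof.
move=> /prime_idealP[hP P1 PM] IP; have [fs f0] := fq.
apply/prime_idealP; split; first exact: ideal_image.
  by rewrite -(rmorph1 f) quotient_image_mem.
move=> y z; have [a ->] := fs y; have [b ->] := fs z.
by rewrite -rmorphM !quotient_image_mem //; exact: PM.
Qed.

Lemma quotient_local m : local_noeth m -> I `<=` m -> local_noeth (f @` m).
Proof.
move=> [hR im m1 mu] Im; have [fs f0] := fq; split.
- exact: quotient_noetherian.
- exact: ideal_image.
- by rewrite -(rmorph1 f) quotient_image_mem.
- move=> y; have [a ->] := fs y; rewrite quotient_image_mem // => /mu[b ba].
  by exists (f b); rewrite -rmorphM ba rmorph1.
Qed.

End Quotient.

Section Localization.
Variables (p : set R) (hp : prime_ideal p) (fl : is_localization p f).

Definition extension (P : set R) : set S :=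
  [set y | exists a s, [/\ P a, ~ p s & y * f s = f a]].

Lemma localization_ideal_gen (J : set S) xs : ideal J -> f @^-1` J = ideal_gen xs ->
  J = ideal_gen (map f xs).
Proof.
move=> hJ e; have [fu fs f0] := fl; apply/seteqP; split.
  move=> y hy; have [a [s [ns ey]]] := fs y.
  have [u hu] := fu s ns.
  have -> : y = u * f a by rewrite -ey mulrCA hu mulr1.
  apply: ideal_mull; first exact: ideal_ideal_gen.
  by apply: ideal_gen_map; rewrite -e /preimage /= -ey; exact: ideal_mulr.
apply: ideal_gen_min => // y /mapP[x hx ->].
by have /= : (f @^-1` J) x by rewrite e; exact: ideal_gen_in.
Qed.

Lemma localization_noetherian : noetherian R -> noetherian S.
Proof.
move=> hR J hJ; have [xs e] := hR _ (ideal_preimage hJ).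
by exists (map f xs); exact: localization_ideal_gen.
Qed.

Lemma extension_mem P a : prime_ideal P -> P `<=` p -> extension P (f a) <-> P a.
Proof.
move=> /prime_idealP[hP P1 PM] Pp; have /prime_idealP[hp1 p1 pM] := hp; have [fu fs f0] := fl.
split=> [[b [s [Pb ns]]]|Pa]; last first.
  by exists a, 1; rewrite rmorph1 mulr1.
rewrite -rmorphM => /eqP; rewrite -subr_eq0 -rmorphB => /eqP/f0[t nt e].
have [] // := PM (t * s) a.
  have -> : t * s * a = t * b by apply/eqP; rewrite -subr_eq0 -e; apply/eqP; ring.
  exact: ideal_mull.
by move=> /Pp /pM[].
Qed.

Lemma extension_prime P : prime_ideal P -> P `<=` p -> prime_ideal (extension P).
Proof.
move=> hPp Pp; have /prime_idealP[hP P1 PM] := hPp.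
have /prime_idealP[hp' p1 pM] := hp; have [fu fs f0] := fl.
have hE : ideal (extension P).
  apply/idealP; split; first by exists 0, 1; rewrite mul0r rmorph0; split=> //; exact: ideal0.
  move=> c y z [a [s [Pa ns ey]]] [b [t [Pb nt ez]]]; have [d [w [nw ec]]] := fs c.
  exists (d * a * t + b * s * w), (w * s * t); split.
  - by apply: idealD => //; apply: ideal_mulr => //; [exact: ideal_mull|exact: ideal_mulr].
  - by move=> /pM[/pM[]|].
  - by rewrite rmorphD !rmorphM -ec -ey -ez; ring.
apply/prime_idealP; split=> //; first by rewrite -(rmorph1 f) extension_mem.
move=> y z; have [a [s [ns ey]]] := fs y; have [b [t [nt ez]]] := fs z.
move=> hyz; have : extension P (f (a * b)).
  by rewrite rmorphM -ey -ez mulrACA; exact: ideal_mulr.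
rewrite extension_mem // => /PM[h|h]; [left; exists a, s|right; exists b, t]; by [].
Qed.

Lemma localization_local : noetherian R -> local_noeth (extension p).
Proof.
move=> hR; have hE := extension_prime hp (@subset_refl _ p).
have /prime_idealP[iE E1 _] := hE; have [fu fs f0] := fl.
split=> //; first exact: localization_noetherian.
move=> y ny; have [a [s [ns ey]]] := fs y.
have [|u hu] := fu a; first by move=> pa; apply: ny; exists a, s.
by exists (u * f s); rewrite -mulrA (mulrC (f s)) ey.
Qed.

Lemma preimage_sub (J : set S) : ideal J -> ~ J 1 -> f @^-1` J `<=` p.
Proof.
move=> hJ J1 a Ja; apply: contrapT => na; have [fu _ _] := fl.
by have [u hu] := fu a na; apply: J1; rewrite -hu; exact: ideal_mull.
Qed.

End Localization.
End RingMaps.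

(** * Principal ideal theorem and dimension *)

Section PrincipalIdealTheorem.
Variables (R : comNzRingType).
Implicit Types (P Q m : set R) (x : R).

(* Krull's principal ideal theorem: with z in P1 \ P0, the preimages J j of
   z ^ j (R/P0)_P1 stabilise modulo x, hence stabilise by Nakayama. *)
Lemma prime_between_local m P0 P1 x : local_noeth m -> prime_ideal P0 -> prime_ideal P1 ->
  P0 `<` P1 -> P1 `<` m -> m x ->
  exists Q, [/\ prime_ideal Q, P0 `<` Q, Q `<` m & Q x].
Proof.
move=> hm hP0 hP1 [P01 nP01] [P1m nP1m] mx; apply: contrapT => nex.
have nx1 : ~ P1 x by move=> h; apply: nex; exists P1.
have nx0 : ~ P0 x by move=> /P01.
have [hR im m1 mu] := hm.
have /prime_idealP[i0 p01 p0M] := hP0; have /prime_idealP[i1 p11 p1M] := hP1.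
have [z P1z nP0z] : exists2 z, P1 z & ~ P0 z.
  by apply: contrapT => h; apply: nP01 => z hz; apply: contrapT => nz; apply: h; exists z.
pose V : set R := [set w | exists p c, P0 p /\ w = p + c * x].
have hV : ideal V.
  apply/idealP; split; first by exists 0, 0; rewrite mul0r addr0; split=> //; exact: ideal0.
  move=> a _ _ [p [c [hp ->]]] [q [d [hq ->]]]; exists (a * p + q), (a * c + d); split;
    last by ring.
  by apply: idealD => //; exact: ideal_mull.
have P0V : P0 `<=` V by move=> p hp; exists p, 0; rewrite mul0r addr0.
have Vx : V x by exists 0, 1; rewrite mul1r add0r; split=> //; exact: ideal0.
(* Otherwise some prime containing V = P0 + (x) avoids the powers of a. It lies strictly between P0
   and m and contains x, contrary to [nex]. Consequently R/V has finite length. *)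
have pow a : m a -> exists k, V (a ^+ k).
  move=> ma; apply: contrapT => nk.
  have [|||Q [hQ VQ TQ]] := @prime_avoiding R V [set b | exists k, b = a ^+ k] hR hV.
  - by exists 0%N.
  - by move=> _ _ [k ->] [l ->]; exists (k + l)%N; rewrite exprD.
  - by move=> _ [k ->] h; apply: nk; exists k.
  have /prime_idealP[iQ Q1 _] := hQ; apply: nex; exists Q; split=> //.
  - by split; [exact: subset_trans VQ|move=> h; apply: nx0; apply: h; exact: VQ].
  - split; first exact: local_sub hm iQ Q1.
    by move=> h; apply: (TQ a); [exists 1%N|exact: h].
  - exact: VQ.
have [xs mE] := ideal_gens hm.
have [k hk] : exists k, forall y, y \in xs -> V (y ^+ k).
  have : {in xs, forall y, m y} by move=> y hy; rewrite mE; exact: ideal_gen_in.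
  elim: (xs) => [_|y ys IH hy]; first by exists 0%N.
  have [|k1 h1] := IH; first by move=> w hw; apply: hy; rewrite in_cons hw orbT.
  have [k2 h2] := pow y (hy y (mem_head _ _)).
  exists (k1 + k2)%N => w; rewrite in_cons exprD => /orP[/eqP->|hw].
    exact: ideal_mull.
  by apply: ideal_mulr => //; exact: h1.
have [a0 ha0] : exists a, @len R R^o V setT a.
  apply: (@finite_length R R^o m hm k xs [:: 1]) => //.
  - exact: submodule_setT.
  - by rewrite -/(ideal_gen _) ideal_genT.
  - by move=> y hy u _; apply: ideal_mulr => //; exact: hk.
pose J j : set R := [set a | exists s p b, [/\ ~ P1 s, P0 p & s * a = p + b * z ^+ j]].
have hJ j : ideal (J j).
  apply/idealP; split.
    by exists 1, 0, 0; split=> //; [exact: ideal0|rewrite mulr0 mul0r addr0].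
  move=> c a b [s [p [d [ns hp e]]]] [t [q [d' [nt hq e']]]].
  exists (s * t), (c * t * p + s * q), (c * t * d + s * d'); split.
  - by move=> /p1M[].
  - by apply: idealD => //; exact: ideal_mull.
  - have -> : s * t * (c * a + b) = c * t * (s * a) + s * (t * b) by ring.
    by rewrite e e'; ring.
have JS j : J j.+1 `<=` J j.
  by move=> a [s [p [b [ns hp e]]]]; exists s, p, (b * z); rewrite e exprS mulrA.
have P0J j : P0 `<=` J j.
  by move=> p hp; exists 1, p, 0; rewrite mul1r mul0r addr0.
pose VJ j : set R^o := addS (V : set R^o) (J j).
have hVJ j : submodule (VJ j) by exact: (@submodule_addS R R^o V (J j) hV (hJ j)).
(* If every inclusion were strict, a chain of length [a0.+1] would exist above V, although R/V has
   length [a0]. *)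
have [j hj] : exists j, VJ j `<=` VJ j.+1.
  apply: contrapT => nj.
  have ch n : chain (VJ n) n (VJ 0%N).
    elim: n => [|n IH]; first exact: chain0.
    rewrite -add1n; apply: chain_cat IH.
    apply: chainS (@chain0 _ _ (VJ n.+1) (VJ n.+1) (hVJ _) _) (hVJ _) _ _ => //.
      exact: addSS.
    by move=> h; apply: nj; exists n.
  have [_ /(_ a0.+1)] := ha0; rewrite ltnn => h; suff : false by []; apply: h.
  have c1 : chain (V : set R^o) 0 (VJ a0.+1) by apply: chain0 => //;
    exact: (@addSl R R^o V (J _) (hJ _)).
  by apply: chain_widen (chain_cat c1 (ch _)) (@submodule_setT _ _) _.
(* Write a in [J j] as p + cx + b with p in P0 and b in [J j.+1]. Then cx lies in [J j], hence so
   does c because x is outside P1; thus J j = J (j+1) + x J j. *)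
have JJ : J j `<=` J j.+1.
  have fJ : @fgs R R^o (J j) by exact: hR.
  apply: (nakayama hm fJ (hJ j.+1) (xs := [:: x])).
    by move=> y /[1!inE] /eqP->.
  move=> a ha; have [_ [b [[p [c [hp ->]]] hb ea]]] := hj a (@addSr R R^o V (J j) hV _ ha).
  have hcx : J j (c * x).
    have -> : c * x = a - (p + b) by rewrite ea; ring.
    by apply: (idealB (hJ j) ha); exact: (idealD (hJ j) (P0J _ _ hp) (JS _ _ hb)).
  have hc : J j c.
    have [s [q [d [ns hq e]]]] := hcx; exists (s * x), q, d; split=> //.
      by move=> /p1M[].
    by rewrite -e; ring.
  exists (p + b), (x *: (c : R^o)); split.
  - exact: (idealD (hJ _) (P0J _ _ hp) hb).
  - by apply: (@smul_in R R^o); [exact: hJ|rewrite inE|].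
  - by rewrite ea [x *: _]mulrC; ring.
have [s [p [b [ns hp e]]]] : J j.+1 (z ^+ j).
  by apply: JJ; exists 1, 0, 1; split=> //; [exact: ideal0|rewrite add0r].
(* The first case puts z into P0, the second puts s into P1; both are excluded. *)
have [h|h] : P0 (z ^+ j) \/ P0 (s - b * z).
- by apply: p0M; have -> : z ^+ j * (s - b * z) = p by rewrite mulrBr mulrC e exprS; ring.
- exact: nP0z (prime_idealX hP0 h).
- apply: ns; rewrite -(subrK (b * z) s); apply: idealD => //; first exact: P01.
  exact: ideal_mull.
Qed.

End PrincipalIdealTheorem.

Section PrimeChains.
Variables (R : comNzRingType).
Implicit Types (P Q m : set R) (x : R).

(** Says that P2 is not minimal over P0 + (x) when it has height at least two over P0. Localising at
    P2 makes it the maximal ideal. *)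
Lemma prime_between P0 P1 P2 x : noetherian R -> prime_ideal P0 -> prime_ideal P1 ->
  prime_ideal P2 -> P0 `<` P1 -> P1 `<` P2 -> P2 x ->
  exists Q, [/\ prime_ideal Q, P0 `<` Q, Q `<` P2 & Q x].
Proof.
move=> hR h0 h1 h2 [P01 n01] [P12 n12] P2x.
have fl := loc_mapP h2; set f := (X in is_localization _ X) in fl.
have P02 := subset_trans P01 P12.
have mem P a : prime_ideal P -> P `<=` P2 -> extension f P2 P (f a) <-> P a.
  by move=> hP PP; exact: extension_mem.
have extS P Q : P `<=` Q -> extension f P2 P `<=` extension f P2 Q.
  by move=> PQ y [a [s [ha ns e]]]; exists a, s; split=> //; exact: PQ.
have lt P Q : prime_ideal P -> prime_ideal Q -> Q `<=` P2 -> P `<=` Q -> ~ (Q `<=` P) ->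
    extension f P2 P `<` extension f P2 Q.
  move=> hP hQ QP PQ nQP; split; first exact: extS.
  move=> h; apply: nQP => a ha; apply/(mem P) => //; first exact: subset_trans QP.
  by apply: h; apply/(mem Q).
have [||||||Q [hQ [EQ nEQ] [QE nQE] Qx]] := @prime_between_local _ (extension f P2 P2)
    (extension f P2 P0) (extension f P2 P1) (f x).
- exact: localization_local.
- exact: extension_prime.
- exact: extension_prime.
- exact: lt.
- exact: lt.
- exact/mem.
have /prime_idealP[iQ Q1 QM] := hQ; have [fu fs f0] := fl.
exists (f @^-1` Q); split=> //; first exact: prime_preimage.
- split; first by move=> a ha; apply: EQ; exact/mem.
  move=> h; apply: nEQ => y hy; have [a [s [ns e]]] := fs y.
  by exists a, s; split=> //; apply: h; rewrite /preimage /= -e; exact: ideal_mulr.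
- split; first exact: preimage_sub iQ Q1.
  move=> h; apply: nQE => y [a [s [ha ns e]]]; have [u hu] := fu s ns.
  have -> : y = u * f a by rewrite -e mulrCA hu mulr1.
  by apply: ideal_mull => //; exact: h.
Qed.

Definition is_prime_chain n (C : nat -> set R) : Prop :=
  (forall i, (i <= n)%N -> prime_ideal (C i)) /\
  (forall i, (i < n)%N -> C i `<` C i.+1).

(** x is pushed down the chain: the prime just below the top is exchanged for one containing x, and
    the argument is repeated on the shorter chain ending there. *)
Lemma prime_chain_through l (P : nat -> set R) x : noetherian R -> is_prime_chain l.+1 P ->
  P l.+1 x ->
  exists P' : nat -> set R, [/\ is_prime_chain l.+1 P', P' 1%N x & P' l.+1 = P l.+1].
Proof.
move=> hR; elim: l P => [|l IH] P [h1 h2] Px; first by exists P.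
have [Q [hQ [PQ nPQ] QP Qx]] := @prime_between (P l) (P l.+1) (P l.+2) x hR
  (h1 _ (leqW (leqnSn l))) (h1 _ (leqnSn _)) (h1 _ (leqnn _))
  (h2 _ (leqnSn _)) (h2 _ (leqnn _)) Px.
pose P1 i := if (i <= l)%N then P i else Q.
have [||P' [[h1' h2'] P'x P'l]] := IH P1.
- split=> i; rewrite /P1.
    by case: (leqP i l) => // il _; apply: h1; rewrite (leq_trans il) // leqW.
  rewrite ltnS => il; rewrite il; case: (ltngtP i l) il => // [il|->] _.
    by apply: h2; rewrite ltnS leqW // ltnW.
  by [].
- by rewrite /P1 ltnn.
exists (fun i => if (i <= l.+1)%N then P' i else P l.+2); split=> //; last by rewrite ltnn.
split=> i.
  by case: (leqP i l.+1) => // il _; [exact: h1'|exact: h1].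
rewrite ltnS => il; rewrite il; case: (ltngtP i l.+1) il => // [il|->] _.
  by rewrite ?il; exact: h2'.
by rewrite ?ltnn P'l /P1 ltnn.
Qed.

End PrimeChains.

Section DimensionQuotient.
Variables (R Q : comNzRingType) (m : set R) (x : R) (f : {rmorphism R -> Q}).
Hypotheses (hm : local_noeth m) (mx : m x) (nzx : forall a, x * a = 0 -> a = 0).
Hypothesis fq : is_quotient (ideal_gen [:: x]) f.

Lemma ideal_gen1 a : ideal_gen [:: x] a <-> exists b, a = b * x.
Proof.
rewrite ideal_gen_cons; split=> [[b [v [/ideal_gen_nil-> ->]]]|[b ->]].
  by exists b; rewrite addr0.
by exists b, 0; rewrite addr0; split=> //; exact/ideal_gen_nil.
Qed.

Lemma krull_dim_quotient d : krull_dim Q d -> krull_dim R d.+1.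
Proof.
move=> [[P [hP1 hP2]] dmax]; have [hR im m1 mu] := hm; have [fs f0] := fq.
have fx : f x = 0 by apply/f0/ideal_gen1; exists 1; rewrite mul1r.
have xsub (P' : set R) : ideal P' -> P' x -> ideal_gen [:: x] `<=` P'.
  by move=> hP' Px a /ideal_gen1[b ->]; exact: ideal_mull.
split.
  pose P1 i := f @^-1` (P i).
  have P1p i : (i <= d)%N -> prime_ideal (P1 i) by move=> /hP1; exact: prime_preimage.
  have P1lt i : (i < d)%N -> P1 i `<` P1 i.+1.
    move=> /hP2[h nh]; split; first by move=> a; exact: h.
    move=> h'; apply: nh => y; have [a ->] := fs y; exact: h'.
  have hP0 := P1p 0%N (leq0n _); have /prime_idealP[i0 n1 pM] := hP0.
  have P1x : P1 0%N x by rewrite /P1 /preimage /= fx; apply: ideal0;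
    exact: prime_ideal_ideal (hP1 0%N (leq0n _)).
  have nz k a : a * x ^+ k = 0 -> a = 0.
    elim: k a => [|k IH] a; first by rewrite mulr1.
    by rewrite exprSr mulrA mulrC => /nzx/IH.
  (* A prime avoiding all s x^k, with s outside the bottom prime, lies inside that prime and omits
     x. Such products are nonzero since x is a nonzerodivisor. *)
  have [||||P0 [hP _ TP]] := @prime_avoiding R [set 0] [set a | exists s k, ~ P1 0%N s /\ a = s * x ^+ k] hR.
  - exact: (@submodule_set0 R R^o).
  - by exists 1, 0%N; rewrite mul1r.
  - move=> _ _ [s [k [ns ->]]] [t [l [nt ->]]]; exists (s * t), (k + l)%N; split.
      by move=> /pM[].
    by rewrite exprD mulrACA.
  - by move=> _ [s [k [ns ->]]] /nz e; apply: ns; rewrite e; exact: ideal0.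
  have P01 : P0 `<` P1 0%N.
    split=> [a Pa|h].
      apply: contrapT => na; apply: (TP a) => //.
      by exists a, 0%N; rewrite mulr1.
    by apply: (TP x); [exists 1, 1%N; rewrite mul1r|exact: h].
  have [h1 h2] := prime_chain_cons hP P01 P1p P1lt.
  by exists (fun i => if i is j.+1 then P1 j else P0).
move=> n [P1 hc].
(* If the top of the chain does not contain x, it is not m, and m can be appended. *)
have [n' [P2 [nn' hc2 P2x]]] : exists n' P2, [/\ (n <= n')%N, is_prime_chain n' P2 & P2 n' x].
  have [h|nh] := pselect (P1 n x); first by exists n, P1.
  have hPn := hc.1 n (leqnn _); have /prime_idealP[iP P11 _] := hPn.
  have Pm := local_sub hm iP P11.
  have mp : prime_ideal m.
    apply/prime_idealP; split=> // a b mab; apply: contrapT => /not_orP[/mu[c ca] nb].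
    by apply: nb; rewrite -[b]mul1r -ca -mulrA; exact: ideal_mull.
  exists n.+1, (fun i => if (i <= n)%N then P1 i else m); split=> //; last by rewrite ltnn.
  split=> i.
    by case: (leqP i n) => // il _; apply: hc.1.
  rewrite ltnS => il; rewrite il; case: (ltngtP i n) il => // [il|->] _.
    exact: hc.2.
  by split=> // h; apply: nh; exact: h.
apply: leq_trans nn' _; case: n' P2 hc2 P2x => // l P2 hc2 P2x.
have [P' [[h1 h2] P'x _]] := prime_chain_through hR hc2 P2x.
have hx i : (i <= l)%N -> P' i.+1 x.
  elim: i => // i IH il; have [h _] := h2 i.+1 il; apply: h; apply: IH; exact: ltnW.
have hid i : (i <= l)%N -> ideal (P' i.+1) by move=> il; apply: prime_ideal_ideal; exact: h1.
(* All primes of the chain except the lowest contain x; dropping that one accounts for the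
   difference of one in dimension. *)
apply: dmax; exists (fun i => f @` P' i.+1); split=> i il.
  by apply: (prime_image fq); [exact: h1|apply: xsub; [exact: hid|exact: hx]].
have [h nh] := h2 i.+1 il; split; first exact: image_subset.
move=> h'; apply: nh => a ha.
have xP := xsub _ (hid _ (ltnW il)) (hx _ (ltnW il)).
by have [+ _] := quotient_image_mem fq a (hid _ (ltnW il)) xP; apply; apply: h'; exists a.
Qed.

End DimensionQuotient.

(** * Projective dimension *)

Section ProjectiveDimension.
Variable R : comNzRingType.

Definition row_exact l k n (B : 'M[R]_(l, k)) (A : 'M[R]_(k, n)) : Prop :=
  forall u : 'rV_k, u *m A = 0 <-> exists c, u = c *m B.

(* [pd_le d A]: the module presented by A has projective dimension at most d. It
   is projective iff A has a generalised inverse. *)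
Fixpoint pd_le d k n (A : 'M[R]_(k, n)) : Prop :=
  if d is d'.+1 then exists l (B : 'M_(l, k)), row_exact B A /\ pd_le d' B
  else exists C, A *m C *m A = A.

Lemma row_exact0 l k n (B : 'M_(l, k)) (A : 'M_(k, n)) : row_exact B A -> B *m A = 0.
Proof.
move=> h; apply/row_matrixP => i; rewrite row_mul row0; apply/h.
by exists (delta_mx 0 i); rewrite -rowE.
Qed.

Lemma row_exact_lift l k n j (B : 'M_(l, k)) (A : 'M_(k, n)) (X : 'M_(j, k)) :
  row_exact B A -> X *m A = 0 -> exists Y, X = Y *m B.
Proof.
move=> h XA; have /choice[f hf] : forall i, exists c, row i X = c *m B.
  by move=> i; apply/h; rewrite -row_mul XA row0.
by exists (\matrix_i f i); apply/row_matrixP => i; rewrite row_mul rowK hf.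
Qed.

Lemma row_exact_ex k n (A : 'M_(k, n)) : noetherian R ->
  exists l (B : 'M_(l, k)), row_exact B A.
Proof. by move=> hR; exact: (row_generators hR (submodule_kermx A)). Qed.

(* The hypotheses say that the module presented by A' is, up to maps factoring
   through a free module (the term K L), a retract of the one presented by A. *)
Lemma pd_le_retract d k n (A : 'M_(k, n)) k' n' (A' : 'M_(k', n')) q
    F G P Q (K : 'M_(n', q)) L H :
  noetherian R -> A' *m F = P *m A -> A *m G = Q *m A' -> A' *m K = 0 ->
  F *m G = 1%:M + K *m L + H *m A' -> pd_le d A -> pd_le d A'.
Proof.
move=> hR; elim: d k n A k' n' A' q F G P Q K L H => [|d IH] k n A k' n' A' q F G P Q K L H.
  move=> e1 e2 e3 e4 [C eC]; exists (F *m C *m Q - H).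
  have : A' *m F *m G = A' + A' *m H *m A'.
    by rewrite -mulmxA e4 !mulmxDr mulmx1 !mulmxA e3 mul0mx addr0.
  rewrite e1 -eC => e; rewrite mulmxBr mulmxBl.
  have -> : A' *m (F *m C *m Q) *m A' = P *m (A *m C *m A) *m G.
    by rewrite !mulmxA e1 -!mulmxA -e2 !mulmxA.
  by rewrite e addrK.
move=> e1 e2 e3 e4 [l [B [hB dB]]].
have [l' [B' hB']] := row_exact_ex A' hR.
exists l', B'; split=> //.
have BA := row_exact0 hB; have BA' := row_exact0 hB'.
have [P1 h1] : exists Y, B' *m P = Y *m B.
  by apply: (row_exact_lift hB); rewrite -mulmxA -e1 mulmxA BA' mul0mx.
have [Q1 h2] : exists Y, B *m Q = Y *m B'.
  by apply: (row_exact_lift hB'); rewrite -mulmxA -e2 mulmxA BA mul0mx.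
(* On the syzygies the old homotopy reads P Q = 1 + A' H + H1 B'. So [A'] and [H] become the new K
   and L, with B' A' = 0. *)
have [H1 h3] : exists Y, P *m Q - 1%:M - A' *m H = Y *m B'.
  apply: (row_exact_lift hB').
  have e5 : P *m Q *m A' = A' + A' *m H *m A'.
    rewrite -mulmxA -e2 mulmxA -e1 -mulmxA e4 !mulmxDr mulmx1 !mulmxA e3.
    by rewrite mul0mx addr0.
  by rewrite !mulmxBl mul1mx e5 [A' + _]addrC addrK subrr.
apply: (IH _ _ B _ _ B' _ P Q P1 Q1 A' H H1 h1 h2 BA' _ dB); rewrite -h3.
by rewrite [RHS]addrC [1%:M + _]addrC addrA !subrK.
Qed.

End ProjectiveDimension.

Lemma lift_mx (R Q : comNzRingType) (I : set R) (f : {rmorphism R -> Q}) k n (Y :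
  'M[Q]_(k, n)) :
  is_quotient I f -> exists X, Y = map_mx f X.
Proof.
move=> [fs _]; have /choice[g hg] : forall ij : 'I_k * 'I_n, exists x, Y ij.1 ij.2 = f x.
  by move=> ij; exact: fs.
by exists (\matrix_(i, j) g (i, j)); apply/matrixP => i j; rewrite !mxE -hg.
Qed.

(** The module presented by [B] embeds in R^n through [A], so x is a nonzerodivisor on it and its
    resolution stays exact modulo x. *)
Lemma pd_le_quotient (R Q : comNzRingType) (x : R) (f : {rmorphism R -> Q}) d :
  is_quotient (ideal_gen [:: x]) f -> (forall a, x * a = 0 -> a = 0) ->
  forall k n (A : 'M[R]_(k, n)) l (B : 'M[R]_(l, k)),
  row_exact B A -> pd_le d B -> pd_le d (map_mx f B).
Proof.
move=> fq nzx; have [fs f0] := fq.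
have fx : f x = 0 by apply/f0/ideal_gen1; exists 1; rewrite mul1r.
elim: d => [|d IH] k n A l B hB.
  by move=> [C eC]; exists (map_mx f C); rewrite -!map_mxM eC.
move=> [l' [B2 [h2 d2]]]; exists l', (map_mx f B2); split; last exact: IH h2 d2.
move=> v; split=> [|[c ->]]; last by rewrite -mulmxA -map_mxM (row_exact0 h2) map_mx0 mulmx0.
have [u ->] := lift_mx v fq; rewrite -map_mxM => e.
have [w ew] : exists w : 'rV_k, u *m B = x *: w.
  have /choice[g hg] : forall j, exists b, (u *m B) 0 j = b * x.
    by move=> j; apply/ideal_gen1/f0; have := congr1 (fun M : 'rV__ => M 0 j) e; rewrite !mxE.
  by exists (\row_j g j); apply/rowP => j; rewrite hg !mxE mulrC.
have [c ec] : exists c, w = c *m B.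
  have e0 : x *: (w *m A) = 0.
    by rewrite scalemxAl -ew -mulmxA (row_exact0 hB) mulmx0.
  apply/hB; apply/rowP => j; rewrite [RHS]mxE; apply: nzx.
  by move/rowP/(_ j): e0; rewrite [LHS]mxE [RHS]mxE.
have [c' ec'] : exists c', u - x *: c = c' *m B2.
  by apply/h2; rewrite mulmxBl -scalemxAl -ec ew subrr.
exists (map_mx f c'); rewrite -map_mxM -ec' map_mxB map_mxZ fx scale0r subr0.
by [].
Qed.

Lemma residue_field (R : comNzRingType) (m : set R) : local_noeth m ->
  exists (F : fieldType) (f : {rmorphism R -> F}), is_quotient m f.
Proof.
move=> [hR im m1 mu]; have [Q [f [fs f0]]] := quotient_ring im m1.
have /choice[g hg] : forall y : Q, exists z, (y != 0 -> z * y = 1) /\ (y = 0 -> z = 0).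
  move=> y; have [->|y0] := eqVneq y 0; first by exists 0.
  have [x ex] := fs y; have [|b hb] := mu x.
    by move=> /f0 e; case/eqP: y0; rewrite ex.
  exists (f b); split=> [_|/eqP]; first by rewrite ex -rmorphM hb rmorph1.
  by rewrite (negbTE y0).
have gV x : x != 0 -> g x * x = 1 by case: (hg x).
have g0 : g 0 = 0 by case: (hg 0) => _; apply.
pose F : fieldType := HB.pack (GRing.ComNzRing.sort Q) Q (GRing.ComNzRing_isField.Build Q gV g0).
by exists F, (f : {rmorphism R -> F}).
Qed.

(** * Projective dimension over a local ring of depth zero *)

Section DepthZero.
Variables (R : comNzRingType) (m : set R) (u : R).
Hypotheses (hm : local_noeth m) (u0 : u <> 0) (mu : forall a, m a -> a * u = 0).

Lemma socle_ann a : a * u = 0 -> m a.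
Proof.
move=> e; apply: contrapT => na; have [_ _ _ munit] := hm.
have [b hb] := munit a na; apply: u0.
by rewrite -[u]mul1r -hb -mulrA e mulr0.
Qed.

(** [B] has a generalised inverse C, so E = 1 - CB is idempotent with B E = 0 and E A = A. The socle
    element shows that A stays injective on the image of E modulo m; over the residue field it then
    has an inverse there, which lifts. *)
Lemma socle_pd_le1 k n (A : 'M[R]_(k, n)) : pd_le 1 A -> pd_le 0 A.
Proof.
move=> [l [B [hB [C eC]]]]; have BA := row_exact0 hB.
have [F [f fq]] := residue_field hm; have [fs f0] := fq.
have f0mx j j' (M : 'M_(j, j')) : map_mx f M = 0 <-> forall i i', m (M i i').
  split=> [e i i'|h]; last by apply/matrixP => i i'; rewrite !mxE; apply/f0.
  by apply/f0; have := congr1 (fun X : 'M_(_, _) => X i i') e; rewrite !mxE.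
pose E := 1%:M - C *m B.
have EA : E *m A = A by rewrite mulmxBl mul1mx -mulmxA BA mulmx0 subr0.
have EE : E *m E = E.
  rewrite {2}/E mulmxBr mulmx1 {2}/E.
  have -> : (1%:M - C *m B) *m (C *m B) = 0.
    by rewrite mulmxBl mul1mx -mulmxA [B *m _]mulmxA eC subrr.
  by rewrite subr0.
(* If v A vanishes modulo m, then u v A = 0, so u v factors through [B] and u v E = 0. Entries
   killed by [u] lie in m. *)
have key j (v : 'M_(j, k)) : map_mx f (v *m A) = 0 -> map_mx f (v *m E) = 0.
  move=> e.
  have [w ew] : exists w, u *: v = w *m B.
    apply: (row_exact_lift hB); rewrite -scalemxAl; apply/matrixP => i i'.
    by rewrite !mxE mulrC; have /f0mx/(_ i i')/mu := e; rewrite mxE.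
  apply/f0mx => i i'; apply: socle_ann.
  have : u *: (v *m E) = 0.
    by rewrite scalemxAl ew mulmxBr mulmx1 mulmxA -(mulmxA w B C) -(mulmxA w) eC subrr.
  by move=> /matrixP/(_ i i'); rewrite !mxE mulrC.
clearbody E.
have [X0 eX] := lift_mx (pinvmx (map_mx f A)) fq.
(* [X0] lifts a generalised inverse of A over the residue field. The error [N] vanishes modulo m by
   [key], so 1 + N is invertible by its determinant. *)
pose N := A *m X0 *m E - E.
have fN : map_mx f N = 0.
  have -> : N = - ((1%:M - A *m X0) *m E) by rewrite mulmxBl mul1mx opprB.
  rewrite map_mxN; apply/eqP; rewrite oppr_eq0; apply/eqP; apply: key.
  by rewrite mulmxBl mul1mx map_mxB !map_mxM -eX mulmxKpV ?submx_refl // subrr.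
have [_ _ _ munit] := hm.
have [b hb] : exists b, b * \det (1%:M + N) = 1.
  apply: munit => /f0; rewrite -det_map_mx map_mxD fN addr0 map_mx1 det1 => /eqP.
  by rewrite oner_eq0.
have AE : A *m X0 *m E = E *m (1%:M + N).
  rewrite mulmxDr mulmx1 /N mulmxBr EE.
  by rewrite (mulmxA E (A *m X0)) (mulmxA E A) EA addrC subrK.
exists (X0 *m E *m (b *: \adj (1%:M + N))).
rewrite !mulmxA AE -(mulmxA E) -scalemxAr mul_mx_adj scale_scalar_mx hb mulmx1.
exact: EA.
Qed.

Lemma socle_pd_le0 d k n (A : 'M[R]_(k, n)) : pd_le d A -> pd_le 0 A.
Proof.
elim: d k n A => [//|d IH] k n A [l [B [hB dB]]]; apply: socle_pd_le1.
by exists l, B; split=> //; exact: IH dB.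
Qed.

End DepthZero.

(** * The theorem of Auslander, Buchsbaum and Serre *)

Section NonZeroDivisors.
Variables (R : comNzRingType) (m : set R).
Hypothesis hm : local_noeth m.

(* Elements u k killed by c + z ^ (k + e) behave like eigenvectors for distinct
   eigenvalues, hence generate a direct sum unless z is nilpotent on one of them. *)
Lemma eigen_nilpotent c z e (u : nat -> R) : m z ->
  (forall k, (c + z ^+ (k + e)) * u k = 0) -> exists n N, z ^+ N * u n = 0.
Proof.
move=> mz hu; have [hR im _ _] := hm.
have [|||n hn] := @noeth_acc R R^o (fun n => ideal_gen (mkseq u n)) [:: 1] hR.
- by move=> n; exact: ideal_ideal_gen.
- by move=> n x _; rewrite -/(ideal_gen _) ideal_genT.
- move=> n; apply: ideal_gen_min; first exact: ideal_ideal_gen.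
  move=> x /mapP[i]; rewrite mem_iota => /andP[_ hi] ->; apply: ideal_gen_in.
  by apply/mapP; exists i; rewrite // mem_iota leq0n add0n ltnS ltnW.
have un : ideal_gen (mkseq u n) (u n).
  apply: (hn n.+1); apply: ideal_gen_in; apply/mapP; exists n => //.
  by rewrite mem_iota leq0n add0n ltnS /=.
pose T j := \prod_(i < j) (c + z ^+ (i + e)).
(* u_n lies in the ideal of the earlier u_i, each of which is killed by one factor of [T n]. *)
have Tu : T n * u n = 0.
  pose J : set R := [set x | T n * x = 0].
  have hJ : ideal J.
    apply/idealP; split; first by rewrite /J /= mulr0.
    by move=> a x y /= hx hy; rewrite /J /= mulrDr mulrCA hx hy mulr0 addr0.
  apply: (ideal_gen_min hJ) un => x /mapP[i]; rewrite mem_iota add0n => /andP[_ hi] ->.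
  by rewrite /J /= /T (bigD1 (Ordinal hi)) //= mulrAC hu mul0r.
exists n.
have : forall j w, (j <= n)%N -> (c + z ^+ (n + e)) * w = 0 -> T j * w = 0 ->
    exists N, z ^+ N * w = 0.
  elim=> [|j IH] w jn hw; first by rewrite /T big_ord0 => h; exists 0%N.
  rewrite /T big_ord_recr /= -/(T j) -mulrA => h.
  have [||N hN] := IH ((c + z ^+ (j + e)) * w) (ltnW jn).
  - by rewrite mulrCA hw mulr0.
  - exact: h.
  have mz' : m (z ^+ (n - j)) by rewrite -(subnSK jn) exprS; exact: ideal_mulr.
  have [b hb] := local_unit1B hm mz'.
  exists (N + (j + e))%N.
  (* On w, c acts as -z^(n+e). The factor with index j < n is therefore z^(j+e) times 1 - z^(n-j), a
     unit, and can be traded for a power of z. *)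
  have e1 : (c + z ^+ (j + e)) * w = z ^+ (j + e) * ((1 - z ^+ (n - j)) * w).
    apply/eqP; rewrite -subr_eq0; apply/eqP; rewrite -[RHS]hw.
    have -> : (n + e = (n - j) + (j + e))%N by rewrite addnA subnK // ltnW.
    by rewrite [z ^+ (_ + (j + e))]exprD; ring.
  move: hN; rewrite e1 mulrA -exprD => h2.
  have : b * (z ^+ (N + (j + e)) * ((1 - z ^+ (n - j)) * w)) = 0 by rewrite h2 mulr0.
  by rewrite mulrCA mulrA mulrA -(mulrA _ b) hb mulr1.
by move=> /(_ n (u n) (leqnn _) (hu n) Tu).
Qed.

Lemma mul_last_nonzero (z u : R) k : z ^+ k * u = 0 -> u <> 0 ->
  exists j, z ^+ j * u <> 0 /\ z * (z ^+ j * u) = 0.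
Proof.
elim: k => [|k IH] hk u0; first by case: u0; rewrite -[u]mul1r.
have [h|h] := pselect (z ^+ k * u = 0); first exact: IH.
by exists k; rewrite mulrA -exprS.
Qed.

(** Induction applied to the y-power torsion [W'] of W. A common annihilated element of [W'],
    multiplied by a suitable power of y, is also killed by y; otherwise an element c injective on
    [W'] is perturbed by a power of y. *)
Lemma common_annihilator ys (W : set R) : {in ys, forall y, m y} -> ideal W ->
  (exists u, [/\ W u, u <> 0 & {in ys, forall y, y * u = 0}]) \/
  (exists c, ideal_gen ys c /\ forall w, W w -> c * w = 0 -> w = 0).
Proof.
elim: ys W => [|y ys IH] W my hW.
  have [[u Wu u0]|nu] := pselect (exists2 u, W u & u <> 0); first by left; exists u.
  right; exists 0; split=> [|w hw _]; first exact/ideal_gen_nil.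
  by apply: contrapT => w0; apply: nu; exists w.
pose W' : set R := [set u | W u /\ exists k, y ^+ k * u = 0].
have hW' : ideal W'.
  apply/idealP; split; first by split; [exact: ideal0|exists 0%N; rewrite mulr0].
  move=> a u v [hu [k hk]] [hv [l hl]]; split.
    by apply: idealD => //; exact: ideal_mull.
  exists (k + l)%N; rewrite exprD.
  have -> : y ^+ k * y ^+ l * (a * u + v) =
    a * y ^+ l * (y ^+ k * u) + y ^+ k * (y ^+ l * v) by ring.
  by rewrite hk hl !mulr0 addr0.
have [|[u [[Wu [k hk]] u0 hu]]|[c [cy cW]]] := IH W' _ hW'.
- by move=> x hx; apply: my; rewrite in_cons hx orbT.
- left; have [j [j0 hj]] := mul_last_nonzero hk u0.
  exists (y ^+ j * u); split=> //; first exact: ideal_mull.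
  move=> x; rewrite in_cons => /orP[/eqP->//|hx].
  by rewrite mulrCA hu // mulr0.
(* Suppose every c + y^(k+1) kills a nonzero [u k] in W; the exponent is positive so that these
   elements stay in the ideal. Some [u n] is killed by a power of y, so lies in [W'], where c is
   injective; but c acts on it as -y^(n+1), which is nilpotent. *)
right; apply: contrapT => nex.
have /choice[u hu] : forall k, exists u, [/\ W u, u <> 0 & (c + y ^+ (k + 1)) * u = 0].
  move=> k; apply: contrapT => nu; apply: nex; exists (c + y ^+ (k + 1)); split.
    by apply/ideal_gen_cons; exists (y ^+ k), c; rewrite addrC addn1 exprSr.
  by move=> w hw e; apply: contrapT => w0; apply: nu; exists w.
have [|n [N hN]] := @eigen_nilpotent c y 1 u (my y (mem_head _ _)).
  by move=> k; case: (hu k).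
have [Wu u0 e] := hu n.
have e' : c * u n = - (y ^+ (n + 1) * u n).
  by apply/eqP; rewrite -addr_eq0 -mulrDl e.
have cinj l w : W' w -> c ^+ l * w = 0 -> w = 0.
  elim: l w => [|l IHl] w hw; first by rewrite mul1r.
  rewrite exprS -mulrA => /cW h; apply: IHl => //; apply: h.
  by case: (ideal_mull (c ^+ l) hW' hw).
apply: u0; apply: (cinj N); first by split=> //; exists N.
have -> : c ^+ N * u n = (- y ^+ (n + 1)) ^+ N * u n.
  elim: N {hN} => [|N IHN]; first by rewrite !mul1r.
  by rewrite !exprS -!mulrA IHN mulrCA e' -mulNr mulrCA.
by rewrite exprNn -exprM mulnC exprM addn1 exprS -!mulrA (mulrCA (y ^+ N)) hN !mulr0.
Qed.

Lemma socle_or_nonzero_divisor :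
  (exists2 u, u <> 0 & forall a, m a -> a * u = 0) \/
  (exists2 z, m z & forall a, z * a = 0 -> a = 0).
Proof.
have [hR im m1 mu] := hm; have [xs mE] := ideal_gens hm.
have mx : {in xs, forall y, m y} by move=> y hy; rewrite mE; exact: ideal_gen_in.
have [[u [_ u0 hu]]|[c [cx hc]]] := common_annihilator mx (@submodule_setT R R^o).
  left; exists u => // a; rewrite mE.
  have hJ : ideal [set a | a * u = 0].
    apply/idealP; split; first by rewrite /= mul0r.
    by move=> b x y /= hx hy; rewrite mulrDl -mulrA hx hy mulr0 addr0.
  exact: (ideal_gen_min hJ hu).
by right; exists c; [rewrite mE|move=> a; exact: hc].
Qed.

End NonZeroDivisors.

Section Serre.

(** As a relation matrix this column presents R/(ys). *)
Definition colv (R : comNzRingType) (ys : seq R) : 'cV[R]_(size ys) := \col_i ys`_i.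

Lemma ideal_gen_colv (R : comNzRingType) (ys : seq R) a :
  ideal_gen ys a <-> exists c : 'rV_(size ys), (c *m colv ys) 0 0 = a.
Proof.
split=> [[c ->]|[c <-]].
  by exists (\row_i c i); rewrite mxE; apply: eq_bigr => i _; rewrite !mxE.
exists (fun i => c 0 i); rewrite mxE; apply: eq_bigr => i _; by rewrite !mxE.
Qed.

Lemma pd_le_col (R : comNzRingType) d k k' (A : 'cV[R]_k) (A' : 'cV_k') :
  noetherian R ->
  (forall i, exists c : 'rV_k, A' i 0 = (c *m A) 0 0) ->
  (forall i, exists c : 'rV_k', A i 0 = (c *m A') 0 0) ->
  pd_le d A -> pd_le d A'.
Proof.
move=> hR /choice[f hf] /choice[g hg].
have eA' : A' = (\matrix_i f i) *m A.
  apply/matrixP => i j; rewrite ord1 hf !mxE; apply: eq_bigr => s _; by rewrite !mxE.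
have eA : A = (\matrix_i g i) *m A'.
  apply/matrixP => i j; rewrite ord1 hg !mxE; apply: eq_bigr => s _; by rewrite !mxE.
apply: (@pd_le_retract _ d _ _ A _ _ A' 0 1%:M 1%:M (\matrix_i f i) (\matrix_i g i) 0 0 0 hR).
- by rewrite mulmx1.
- by rewrite mulmx1.
- by rewrite mulmx0.
- by rewrite mulmx1 mulmx0 mul0mx !addr0.
Qed.

Lemma colv_mem (R : comNzRingType) (ys zs : seq R) : ideal_gen ys `<=` ideal_gen zs ->
  forall i, exists c : 'rV_(size zs), colv ys i 0 = (c *m colv zs) 0 0.
Proof.
move=> h i; have [|c hc] := proj1 (ideal_gen_colv zs ys`_i).
  by apply: h; apply: ideal_gen_in; exact: mem_nth.
by exists c; rewrite hc mxE.
Qed.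

Lemma pd_le_colv (R : comNzRingType) d (ys zs : seq R) : noetherian R ->
  ideal_gen ys = ideal_gen zs -> pd_le d (colv ys) -> pd_le d (colv zs).
Proof. by move=> hR e; apply: pd_le_col => //; apply: colv_mem; rewrite e. Qed.

(** A generalised inverse C gives y = s y for every entry, where s = C [colv ys] is a scalar in m,
    and 1 - s is a unit. *)
Lemma pd_le0_colv (R : comNzRingType) (m : set R) ys : local_noeth m ->
  {in ys, forall y, m y} -> pd_le 0 (colv ys) -> {in ys, forall y, y = 0}.
Proof.
move=> hm my [C eC] y hy; have [_ im _ _] := hm.
have mc : m ((C *m colv ys) 0 0).
  rewrite mxE; apply: (ideal_sum _ im) => i _; apply: (ideal_mull _ im).
  by rewrite mxE; apply: my; exact: mem_nth.
have [b hb] := local_unit1B hm mc.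
have hi : (index y ys < size ys)%N by rewrite index_mem.
have := congr1 (fun M : 'cV_ _ => M (Ordinal hi) 0) eC.
rewrite -mulmxA [C *m _]mx11_scalar mul_mx_scalar.
set s := (C *m colv ys) 0 0 in mc hb *; rewrite !mxE /= nth_index // => e.
by rewrite -[y]mul1r -hb -mulrA mulrBl mul1r e subrr mulr0.
Qed.

Lemma krull_dim_field (R : comNzRingType) (m : set R) : local_noeth m ->
  m `<=` [set 0] -> krull_dim R 0.
Proof.
move=> hm m0; have [hR im m1 mu] := hm; split.
  exists (fun=> m); split=> // i _; apply/prime_idealP; split=> // x y mxy.
  apply: contrapT => /not_orP[/mu[a ax] ny]; apply: ny.
  by rewrite -[y]mul1r -ax -mulrA; exact: ideal_mull.
move=> [//|n] [P [h1 h2]]; have [_ h] := h2 0%N isT; case: h.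
have /prime_idealP[i1 n1 _] := h1 1%N isT; have /prime_idealP[i0 _ _] := h1 0%N isT.
by move=> x /(local_sub hm i1 n1)/m0 ->; exact: ideal0.
Qed.

(* Induction on the number of generators of m: divide by a nonzerodivisor which
   is part of a minimal system of generators. *)
Theorem finite_pd_regular t (R : comNzRingType) (m : set R) (ys : seq R) d :
  (size ys <= t)%N -> local_noeth m -> m = ideal_gen ys -> pd_le d (colv ys) ->
  exists xs, m = ideal_gen xs /\ krull_dim R (size xs).
Proof.
elim: t R m ys d => [|t IH] R m ys d st hm mE hd.
  have ys0 : ys = [::] by apply: size0nil; apply/eqP; rewrite -leqn0.
  exists [::]; split; first by rewrite mE ys0.
  by apply: (krull_dim_field hm) => x; rewrite mE ys0 => /ideal_gen_nil ->.
have [hR im m1 munit] := hm.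
have my : {in ys, forall y, m y} by move=> y hy; rewrite mE; exact: ideal_gen_in.
(* In depth zero R/m becomes projective, which forces m = 0. Otherwise m contains a nonzerodivisor
   z. *)
have [[u u0 hu]|[z mz nz]] := socle_or_nonzero_divisor hm.
  have m0 : m `<=` [set 0].
    rewrite mE; apply: ideal_gen_min; first exact: (@submodule_set0 R R^o).
    exact: pd_le0_colv hm my (socle_pd_le0 hm u0 hu hd).
  exists [::]; split; last exact: krull_dim_field hm m0.
  apply/seteqP; split=> x; first by move=> /m0 ->; exact/ideal_gen_nil.
  by move=> /ideal_gen_nil ->; exact: ideal0.
have [[zs [sz mzs]]|nmin] := pselect (exists zs, (size zs <= t)%N /\ m = ideal_gen zs).
  by apply: (IH _ _ zs d sz hm mzs); apply: pd_le_colv hd => //; rewrite -mE.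
case: ys st mE hd my => [|y ys] st mE hd my.
  by case: nmin; exists [::].
(* If all these elements were zero divisors, [eigen_nilpotent] would give a nonzero element killed
   by a power of z. The exponent is at least 2 so that the change of y lies in zm and Nakayama keeps
   a generating system. *)
have [k nzk] : exists k, forall a, (y + z ^+ (k + 2)) * a = 0 -> a = 0.
  apply: contrapT => nk.
  have /choice[u hu] : forall k, exists u, (y + z ^+ (k + 2)) * u = 0 /\ u <> 0.
    move=> k; apply: contrapT => nu; apply: nk; exists k => a ha.
    by apply: contrapT => a0; apply: nu; exists a.
  have [|n [N hN]] := @eigen_nilpotent R m hm y z 2 u mz; first by move=> k; case: (hu k).
  have [_] := hu n; apply.
  elim: N hN => [|N IHN]; first by rewrite mul1r.
  by rewrite exprS -mulrA => /nz.
set x := y + z ^+ (k + 2) in nzk.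
have mk : m (z ^+ k.+1) by rewrite exprS; exact: ideal_mulr.
have mx : m x.
  apply: idealD => //; first by apply: my; rewrite mem_head.
  by rewrite addn2 exprSr; exact: ideal_mulr.
have mE' : m = ideal_gen (x :: ys).
  apply/seteqP; split.
    apply: (@nakayama R R^o m _ _ [:: z] hm); first by exact: hR.
    - exact: ideal_ideal_gen.
    - by move=> w /[1!inE] /eqP ->.
    - move=> a; rewrite {1}mE => /ideal_gen_cons[c [v [hv ->]]].
      exists (c * x + v), (z *: ((- c * z ^+ k.+1) : R^o)); split.
      + by apply/ideal_gen_cons; exists c, v.
      + by apply: (@smul_in R R^o) => //; [rewrite inE|exact: ideal_mull].
      + change (c * y + v = (c * x + v) + z * (- c * z ^+ k.+1)).
        by rewrite /x addn2 exprS; ring.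
  apply: ideal_gen_min => // w; rewrite in_cons => /orP[/eqP->//|hw].
  by apply: my; rewrite in_cons hw orbT.
have hd' : pd_le d (colv (x :: ys)).
  by apply: pd_le_colv hd => //; rewrite -mE.
have x0 : x <> 0 by move=> e; have := nzk 1; rewrite e mul0r => /(_ erefl)/eqP;
  rewrite oner_eq0.
case: d hd hd' => [|d] hd hd'.
  case: x0; apply: (pd_le0_colv hm _ hd'); last exact: mem_head.
  by move=> w hw; rewrite mE'; exact: ideal_gen_in.
have [l [B [hB dB]]] := hd'.
have iX := ideal_ideal_gen [:: x].
have Xm : ideal_gen [:: x] `<=` m.
  by apply: ideal_gen_min => // w /[1!inE] /eqP ->.
have [Q [f fq]] := quotient_ring iX (fun h => m1 (Xm _ h)).
have [fs f0] := fq.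
have fx : f x = 0 by apply/f0/ideal_gen1; exists 1; rewrite mul1r.
have hQ := quotient_noetherian fq hR.
have dBQ : pd_le d (map_mx f B) := pd_le_quotient fq nzk hB dB.
pose A' : 'cV[Q]_(size ys).+1 := map_mx f (colv (x :: ys)).
(* A unit in the first column of the syzygy matrix would express x through [ys], contrary to
   [nmin]. *)
have B0 j : m (B j 0).
  apply: contrapT => /munit[b hb].
  have e : x = - b * \sum_(i < size ys) B j (lift ord0 i) * ys`_i.
    have := congr1 (fun M : 'cV_ _ => M j 0) (row_exact0 hB).
    rewrite !mxE big_ord_recl /= !mxE /= => /eqP; rewrite addr_eq0 => /eqP e.
    rewrite mulNr -mulrN -[x]mul1r -hb -mulrA e; congr (_ * - _).
    by apply: eq_bigr => i _; rewrite !mxE.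
  apply: nmin; exists ys; split=> //; apply/seteqP; split; last first.
    apply: ideal_gen_min => // w hw; apply: my; by rewrite in_cons hw orbT.
  rewrite mE'; apply: ideal_gen_min; first exact: ideal_ideal_gen.
  move=> w; rewrite in_cons => /orP[/eqP->|hw]; last exact: ideal_gen_in.
  rewrite e; apply: ideal_mull; first exact: ideal_ideal_gen.
  apply: (ideal_sum _ (ideal_ideal_gen ys)) => i _.
  apply: ideal_mull; first exact: ideal_ideal_gen.
  by apply: ideal_gen_in; exact: mem_nth.
(* Modulo x, [B] presents m/xm and [A'] presents the residue field. Sending 1 to the class of x
   embeds the residue field in m/xm, and the first coordinate, well defined by [B0], is a
   retraction. *)
have dA' : pd_le d A'.
  have /choice[P hP] : forall i, exists c : 'rV_l, A' i 0 *: delta_mx 0 0 = c *m map_mx f B.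
    move=> i; pose yi := (x :: ys)`_i.
    (* The Koszul relation between x and the i-th generator; its x part disappears in the
       quotient. *)
    have [|c hc] := proj1 (hB (yi *: delta_mx 0 0 - x *: delta_mx 0 i)).
      rewrite mulmxBl -!scalemxAl -!rowE; apply/matrixP => i1 i2.
      by rewrite !mxE /= /yi mulrC subrr.
    exists (map_mx f c); rewrite -map_mxM -hc map_mxB !map_mxZ fx scale0r subr0.
    by rewrite map_delta_mx /A' mxE mxE.
  have /choice[Qm hQm] : forall j, exists c : 'rV_(size ys).+1, map_mx f B j 0 = (c *m A') 0 0.
    move=> j; have := B0 j; rewrite mE' => /ideal_gen_colv[c hc].
    by exists (map_mx f c); rewrite /A' -map_mxM mxE [RHS]mxE hc.
  apply: (@pd_le_retract _ d _ _ (map_mx f B) _ _ A' 0 (delta_mx 0 0) (delta_mx 0 0)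
    (\matrix_i P i) (\matrix_i Qm i) 0 0 0 hQ _ _ _ _ dBQ).
  - apply/row_matrixP => i; rewrite !row_mul rowK -hP.
    by rewrite [row i A']mx11_scalar mul_scalar_mx mxE.
  - apply/matrixP => i j; rewrite ord1.
    have -> : (map_mx f B *m delta_mx 0 0 : 'cV_l) i 0 = map_mx f B i 0.
      by rewrite -colE mxE.
    by rewrite hQm !mxE; apply: eq_bigr => s _; rewrite !mxE.
  - by rewrite mulmx0.
  - by rewrite mul_delta_mx !mul0mx ?mulmx0 !addr0; apply/matrixP => i j; rewrite !ord1 !mxE.
have mQ := quotient_local fq hm Xm.
have mQE : f @` m = ideal_gen (map f ys).
  apply/seteqP; split.
    move=> _ [a + <-]; rewrite mE' => /ideal_gen_cons[c [v [hv ->]]].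
    by rewrite rmorphD rmorphM fx mulr0 add0r; exact: ideal_gen_map.
  apply: ideal_gen_min; first exact: (ideal_image fq im).
  by move=> w /mapP[v hv ->]; exists v => //; apply: my; rewrite in_cons hv orbT.
(* Drops the entry f x = 0 of [A']. *)
have dQ : pd_le d (colv (map f ys)).
  apply: pd_le_col dA' => //.
  - move=> i; have hi : (i < size ys)%N by have := ltn_ord i; rewrite {2}size_map.
    exists (delta_mx 0 (lift ord0 (Ordinal hi))).
    by rewrite -rowE !mxE /= (nth_map 0).
  - move=> [[|i] hi].
      by exists 0; rewrite mul0mx /A' !mxE /= fx.
    have hi' : (i < size (map f ys))%N by rewrite size_map.
    exists (delta_mx 0 (Ordinal hi')).
    by rewrite -rowE /A' !mxE /= (nth_map 0).
have [|ws [wE wd]] := IH Q (f @` m) (map f ys) d _ mQ mQE dQ; first by rewrite size_map.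
have [xs exs] : exists xs, ws = map f xs.
  elim: (ws) => [|w ws' [xs ->]]; first by exists [::].
  by have [a ->] := fs w; exists (a :: xs).
exists (x :: xs); split; last first.
  have -> : size (x :: xs) = (size ws).+1 by rewrite exs size_map.
  exact: (krull_dim_quotient hm mx nzk fq).
have xsm : {in xs, forall w, m w}.
  move=> w hw; apply: (proj1 (quotient_image_mem fq w im Xm)).
  by rewrite wE exs; apply: ideal_gen_in; exact: map_f.
apply/seteqP; split; last first.
  apply: ideal_gen_min => // w; rewrite in_cons => /orP[/eqP->//|]; exact: xsm.
have lift b : ideal_gen (map f xs) b -> exists2 a, ideal_gen xs a & f a = b.
  elim: (xs) b => [|w xs' IHx] b /=.
    by move=> /ideal_gen_nil ->; exists 0; [exact/ideal_gen_nil|exact: rmorph0].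
  move=> /ideal_gen_cons[c [v [/IHx[a ha <-] ->]]]; have [c' ->] := fs c.
  exists (c' * w + a); last by rewrite rmorphD rmorphM.
  by apply/ideal_gen_cons; exists c', a.
move=> a ma; have [|b hb eb] := lift (f a); first by rewrite -exs -wE; exists a.
have /ideal_gen1[c hc] := proj1 (quotient_eq fq a b) (esym eb).
by apply/ideal_gen_cons; exists c, b; rewrite -hc subrK.
Qed.

End Serre.

(** * Isolated singularities *)

(** Localisation is exact: clear the denominators of u, then multiply by a further element outside p
    so that the relation already holds in R. *)
Lemma row_exact_localization (R S : comNzRingType) (p : set R) (f : {rmorphism R -> S})
    l k n (B : 'M[R]_(l, k)) (A : 'M[R]_(k, n)) :
  prime_ideal p -> is_localization p f -> row_exact B A ->
  row_exact (map_mx f B) (map_mx f A).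
Proof.
move=> /prime_idealP[ip p1 pM] [fu fs f0] hB u; split; last first.
  by move=> [c ->]; rewrite -mulmxA -map_mxM (row_exact0 hB) map_mx0 mulmx0.
have common j (I : 'I_j -> R -> Prop) :
    (forall i s t, I i s -> I i (t * s)) -> (forall i, exists2 s, ~ p s & I i s) ->
    exists2 s, ~ p s & forall i, I i s.
  move=> IM hex; have /choice[s hs] : forall i, exists s, ~ p s /\ I i s.
    by move=> i; have [s ? ?] := hex i; exists s.
  exists (\prod_i s i).
    by apply: (big_ind (fun x => ~ p x)) => [//|x y nx ny /pM[]//|i _]; case: (hs i).
  by move=> i; rewrite (bigD1 i) //= mulrC; apply: IM; case: (hs i).
have [s ns [v hv]] : exists2 s, ~ p s & exists v : 'rV_k, f s *: u = map_mx f v.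
  have [||s ns hs] := @common k (fun i s => exists a, u 0 i * f s = f a).
  - by move=> i s t [a e]; exists (t * a); rewrite !rmorphM -e mulrCA.
  - by move=> i; have [a [s [ns e]]] := fs (u 0 i); exists s => //; exists a.
  have /choice[a ha] : forall i, exists a, u 0 i * f s = f a by exact: hs.
  exists s => //; exists (\row_i a i).
  by apply/rowP => i; rewrite !mxE -ha mulrC.
move=> uA.
have vA : map_mx f (v *m A) = 0 by rewrite map_mxM -hv -scalemxAl uA scaler0.
have [||t nt ht] := @common n (fun j t => t * (v *m A) 0 j = 0).
- by move=> j t w e; rewrite -mulrA e mulr0.
- move=> j; apply/f0; have := congr1 (fun M : 'rV__ => M 0 j) vA.
  by rewrite [LHS]mxE [RHS]mxE.
have [c hc] : exists c, t *: v = c *m B.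
  by apply/hB; rewrite -scalemxAl; apply/rowP => j; rewrite [LHS]mxE ht mxE.
have [|a ha] := fu (t * s); first by move=> /pM[].
exists (a *: map_mx f c).
rewrite -scalemxAl -map_mxM -hc map_mxZ -hv !scalerA.
by rewrite -mulrA -rmorphM ha scale1r.
Qed.

(* D is the k-th map of a free resolution beginning with A; the last clause is all
   that is needed of the maps in between. *)
Lemma regular_syzygy (R : comNzRingType) (xs : seq R) k :
  noetherian R -> wreg xs [set: R^o] ->
  forall n q (A : 'M[R]_(n, q)) j,
  wreg (take j xs) [set u *m A | u in [set: 'rV[R]_n]] ->
  exists n' q' (D : 'M[R]_(n', q')) l (B : 'M_(l, n')),
    [/\ row_exact B D, wreg (take (j + k) xs) [set u *m D | u in [set: 'rV[R]_n']] &
    forall (S : comNzRingType) (p : set R) (f : {rmorphism R -> S}),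
      prime_ideal p -> is_localization p f -> pd_le 0 (map_mx f B) ->
      exists d, pd_le d (map_mx f A)].
Proof.
move=> hR hxs; elim: k => [|k IH] n q A j hA; have [l [B hB]] := row_exact_ex A hR.
  exists n, q, A, l, B; split=> //; first by rewrite addn0.
  move=> S p f hp fl hd; exists 1%N, l, (map_mx f B); split=> //.
  exact: row_exact_localization fl hB.
have hB' : wreg (take j.+1 xs) [set u *m B | u in [set: 'rV[R]_l]].
  have -> : [set u *m B | u in [set: 'rV[R]_l]] =
      [set: 'rV[R]_n] `&` (mulmxr A) @^-1` [set 0].
    apply/seteqP; split=> [_ [c _ <-]|u [_ /hB[c ->]]]; last by exists c.
    by split=> //; apply/hB; exists c.
  apply: wreg_syzygy => //.
  - exact: submodule_setT.
  - by move=> a u v _ _; rewrite linearP.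
  - exact: wreg_free.
have [n' [q' [D [l' [B' [h1 h2 h3]]]]]] := IH _ _ B j.+1 hB'.
exists n', q', D, l', B'; split=> //; first by rewrite addnS -addSn.
move=> S p f hp fl /(h3 _ _ _ hp fl)[d hd].
exists d.+1, l, (map_mx f B); split=> //.
exact: row_exact_localization fl hB.
Qed.

Theorem corollary2 (R : comNzRingType) (m : set R)
    (hloc : noetherian_local m) (hCM : cohen_macaulay m)
    (hfin : finite_cm_type m) :
  isolated_singularity m.
Proof.
move=> p hp pm; have hm := proj1 (local_noethP m) hloc.
have [hR im m1 munit] := hm.
have /prime_idealP[ip p1 pM] := hp.
have [d [[[xs [sxs mxs [hreg _]]] _] hdim]] := hCM.
have hd : krull_dim R (size xs) by rewrite sxs.
have hxs : wreg xs [set: R^o] by move=> i hi u _; rewrite -seq_mulE; exact: hreg.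
have psub := local_sub hm ip p1.
have [r mr npr] : exists2 r, m r & ~ p r.
  apply: contrapT => h; apply: pm; apply/seteqP; split=> // x mx.
  by apply: contrapT => nx; apply: h; exists x.
have mp : prime_ideal m.
  apply/prime_idealP; split=> // a b mab; apply: contrapT => /not_orP[/munit[c ca] nb].
  by apply: nb; rewrite -[b]mul1r -ca -mulrA; exact: ideal_mull.
have d1 : (0 < size xs)%N.
  case: hd => _; apply; exists (fun i => if i is 0%N then p else m).
  split=> [[|i] _ //|[|i] // _]; split=> // h.
  exact: npr (h _ mr).
have [ps ep] := hR _ ip.
(* The row space of [colv ps] is p, the first syzygy of R/p. As a submodule of R it admits the first
   term of [xs], so dim R - 1 further steps make [hM] reach the whole sequence. *)
have h1 : wreg (take 1 xs) [set u *m colv ps | u in [set: 'rV[R]_(size ps)]].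
  move=> i; rewrite size_take_min leq_min ltnS leqn0 => /andP[/eqP-> _] u _.
  rewrite take0 nth_take // => h.
  by have := @wreg_free R 1 xs hxs 0%N d1 u I; rewrite take0; apply.
have [n [q [D [l [B [BD hM hpd]]]]]] := @regular_syzygy R xs (size xs).-1 hR hxs _ _ _ _ h1.
rewrite add1n prednK // take_size in hM.
have hN : wreg xs [set u : 'rV[R]_n | u *m D = 0].
  have -> : [set u : 'rV[R]_n | u *m D = 0] = [set: 'rV[R]_n] `&` (mulmxr D) @^-1` [set 0].
    by apply/seteqP; split=> [u|u []].
  (* N is one syzygy beyond M; taking one term more than [xs] has matches the form of
     [wreg_syzygy]. *)
  rewrite -(take_oversize (leqnSn (size xs))).
  apply: wreg_syzygy; rewrite ?take_size //.
  - exact: submodule_setT.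
  - by move=> a u v _ _; rewrite linearP.
  - exact: wreg_free.
have [j [C hC]] := finite_type_split hm BD hd mxs hfin hN hM mr.
have fl := loc_mapP hp; set f := (X in is_localization _ X) in fl.
have [fu fs f0] := fl.
(* In R_p the power r^j is a unit, so C divided by it is a generalised inverse of the localised
   [B]. *)
have [|e he] := hpd _ p f hp fl.
  have [|a ha] := fu (r ^+ j); first by move=> /(prime_idealX hp).
  exists (a *: map_mx f C).
  by rewrite -scalemxAr -scalemxAl -!map_mxM hC map_mxZ scalerA ha scale1r.
have hloc' := localization_local hp fl hR.
(* The maximal ideal of R_p is generated by the images of [ps], so the localised resolution of R/p
   resolves the residue field of R_p. *)
have eE : extension f p p = ideal_gen (map f ps).
  apply: (localization_ideal_gen fl); first by case: hloc'.
  rewrite -ep; apply/seteqP; split=> x; first by move=> /(extension_mem hp fl _ hp (@subset_refl _ _)).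
  by move=> hx; apply/(extension_mem hp fl _ hp (@subset_refl _ _)).
(* The entries agree with those of the localised [colv ps], but the row index types are only
   propositionally equal. *)
have he' : pd_le e (colv (map f ps)).
  apply: pd_le_col he; first by case: hloc'.
  - move=> i; have hi : (i < size ps)%N by have := ltn_ord i; rewrite {2}size_map.
    by exists (delta_mx 0 (Ordinal hi)); rewrite -rowE !mxE /= (nth_map 0).
  - move=> i; have hi : (i < size (map f ps))%N by rewrite size_map.
    by exists (delta_mx 0 (Ordinal hi)); rewrite -rowE !mxE /= (nth_map 0).
have [zs [ez hz]] := finite_pd_regular (leqnn _) hloc' eE he'.
by exists (extension f p p); split; [exact/local_noethP|exists zs].
Qed.
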